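(* Every rearrangement invariant space $E$ on $[0,\infty)$ is isometrically lattice isomorphic to a sublattice of $W$.
   Context: Functions are real-valued. Let $\lambda$ be Lebesgue measure. Weak$L^1$ is the space of (a.e.-equivalence classes of) measurable functions $f$ on $[0,1]$ with $q(f)=\sup_{c>0}c\,\lambda\{t:|f(t)|>c\}<\infty$. Let $\rho$ be the gauge functional of the convex hull of $\{f:q(f)\le 1\}$ (the maximal seminorm); it is known (Cwikel–Fefferman) that $\rho(f)=\lim_{n\to\infty}\sup_{p,q>0,\,q/p>n}\frac{1}{\ln(q/p)}\int_{\{p\le|f|\le q\}}|f|\,d\lambda$. Let $N=\{f:\rho(f)=0\}$. The normed envelope is $W=(\text{Weak}L^1/N,\rho)$, a normed vector lattice with the quotient order. Rearrangement invariant spaces are taken in the sense of Lindenstrauss–Tzafriri (in their book Classical Banach Spaces II), which is the following. A Köthe function space on $[0,\infty)$ is a Banach space $E$ of (a.e.-classes of) locally integrable functions on $[0,\infty)$ such that (1) if $f$ is measurable, $g\in E$ and $|f|\le|g|$ a.e., then $f\in E$ and $\|f\|\le\|g\|$; (2) $\chi_A\in E$ for every measurable $A$ of finite measure. An integral on $E$ is a functional $x'_h(f)=\int fh$, where $h$ is measurable and $fh$ is integrable for every $f\in E$; let $E^{\times}$ be the space of integrals with the norm of the dual $E'$, itself regarded as a Köthe function space, and $E^{\times\times}=(E^\times)^\times$. $E$ is a rearrangement invariant space on $[0,\infty)$ if: (i) for every measure preserving automorphism $\tau$ of $[0,\infty)$ and every measurable $f$, $f\in E$ iff $f\circ\tau^{-1}\in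 E$, and then $\|f\|=\|f\circ\tau^{-1}\|$; (ii) $E^\times$ is norming, i.e. $\|f\|=\sup\{|x'(f)|:x'\in E^\times,\|x'\|\le1\}$ for all $f\in E$, and, as a subspace of $E^{\times\times}$, $E$ is either all of $E^{\times\times}$ or the closed linear span of the simple integrable functions in $E^{\times\times}$; (iii) $L^1\cap L^\infty\subseteq E\subseteq L^1+L^\infty$ on $[0,\infty)$ with both inclusions of norm one for the norms $\max(\|f\|_{L^1},\|f\|_{L^\infty})$ on $L^1\cap L^\infty$ and $\inf\{\|u\|_{L^1}+\|v\|_{L^\infty}:f=u+v\}=\int_0^1f^*(t)\,dt$ on $L^1+L^\infty$, $f^*$ being the decreasing rearrangement of $|f|$. $E$ is ordered by the a.e. pointwise order. ''Isometrically lattice isomorphic to a sublattice of $W$'' means that there is a linear norm preserving map into $W$ that preserves the lattice operations. *)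

(* Defs.v *)
From HB Require Import structures.
From mathcomp Require Import all_boot all_order all_algebra.
From mathcomp Require Import all_classical all_reals all_analysis measurable_realfun.
From mathcomp Require Import lra.
Set Implicit Arguments.
Unset Strict Implicit.
Unset Printing Implicit Defensive.
Import Order.TTheory GRing.Theory Num.Theory.
Import numFieldNormedType.Exports.
Local Open Scope classical_set_scope.
Local Open Scope ring_scope.

Lemma measurable_inv (R : realType) : measurable_fun setT (@GRing.inv R).
Proof.
have -> : [set: R] = [set 0] `|` [set~ 0] by rewrite setUv.
apply/measurable_funU => //; first exact: measurableC.
split; first exact: measurable_fun_set1.
apply: open_continuous_measurable_fun.
  by apply: closed_openC; exact: closed_eq.
by move=> x; rewrite inE/= => /eqP x0; exact: inv_continuous.
Qed.

Section weak_L1.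
Context d (T : measurableType d) (R : realType).
Variable mu : {measure set T -> \bar R}.
Implicit Types (f g h : {mfun T >-> R}) (c : R).

(* The supremum over c > 0 of c * mu {|f| > c}; only a quasi-norm, so
   Weak L^1 gets its seminorm from the convex hull of the unit ball below. *)
Definition weak_qnorm (f : T -> R) : \bar R :=
  ereal_sup
    [set (c%:E * mu [set t | (c < `|f t|)%R])%E | c in [set c : R | 0 < c]].

Lemma measurable_level f c : measurable [set t | c < `|f t|].
Proof.
have mf : measurable_fun setT (fun t => c < `|f t|).
  by apply: measurable_fun_ltr => //; exact: measurableT_comp.
rewrite (_ : [set _ | _] = setT `&` (fun t => c < `|f t|) @^-1` [set true]).
  exact: mf.
by rewrite setTI; apply/seteqP; split => t /=.
Qed.

Lemma weak_qnorm_leP (f : T -> R) (K : \bar R) :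
  (weak_qnorm f <= K)%E <->
  (forall c, 0 < c -> (c%:E * mu [set t | (c < `|f t|)%R] <= K)%E).
Proof.
split=> [fK c c0|fK].
  by apply: le_trans fK; apply: ereal_sup_ubound; exists c.
by apply: ge_ereal_sup => _ [c c0 <-]; exact: fK.
Qed.

Lemma weak_qnorm_ge (f : T -> R) c : 0 < c ->
  (c%:E * mu [set t | (c < `|f t|)%R] <= weak_qnorm f)%E.
Proof. by move=> c0; apply/(weak_qnorm_leP f _).1. Qed.

Lemma weak_qnorm_ge0 (f : T -> R) : (0 <= weak_qnorm f)%E.
Proof.
apply: le_trans (weak_qnorm_ge f ltr01).
by rewrite mul1e.
Qed.

Lemma le_weak_qnorm f g :
  {ae mu, forall t, `|f t| <= `|g t|} -> (weak_qnorm f <= weak_qnorm g)%E.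
Proof.
move=> [N [mN muN fgN]]; have N0 : mu N = 0%E := muN; apply/weak_qnorm_leP => c c0.
apply: le_trans (weak_qnorm_ge g c0).
rewrite lee_pmul2l//.
apply: (@le_trans _ _ (mu ([set t | (c < `|g t|)%R] `|` N))).
  apply: le_measure; rewrite ?inE.
  - exact: measurable_level.
  - by apply: measurableU => //; exact: measurable_level.
  - move=> t /= cf; have [fg|gf] := leP `|f t| `|g t|.
      by left; exact: lt_le_trans fg.
    by right; apply: fgN => /=; apply/negP; rewrite -ltNge.
suff <- : (mu [set t | (c < `|g t|)%R] + mu N = mu [set t | (c < `|g t|)%R])%E.
  by apply: measureU2 => //; exact: measurable_level.
by rewrite N0 adde0.
Qed.

Lemma weak_qnormZ_lty (a : R) f :
  (weak_qnorm f < +oo)%E -> (weak_qnorm (a *: f) < +oo)%E.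
Proof.
move=> fy; have K0 := weak_qnorm_ge0 f.
have : weak_qnorm f \is a fin_num by rewrite ge0_fin_numE.
move=> /fineK fK.
apply: (@le_lt_trans _ _ ((`|a|%:E * weak_qnorm f)%E)); last first.
  by rewrite -fK -EFinM ltry.
apply/weak_qnorm_leP => c c0 /=.
have [->|a0] := eqVneq a 0.
  rewrite (_ : [set _ | _] = set0) ?measure0 ?mule0 ?normr0 ?mul0e//.
  apply/seteqP; split => t //=.
  by rewrite scale0r normr0 ltNge (ltW c0).
have a0' : 0 < `|a| by rewrite normr_gt0.
rewrite (_ : [set _ | _] = [set t | c / `|a| < `|f t|]); last first.
  apply/seteqP; split => t /=; by rewrite normrM ltr_pdivrMr// mulrC.
rewrite -[c in X in (X * _)%E](@divfK _ `|a|) ?gt_eqF//.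
rewrite mulrC EFinM -muleA lee_pmul2l ?lte_fin//.
by apply: weak_qnorm_ge; rewrite divr_gt0.
Qed.

Lemma weak_qnormD_lty f g : (weak_qnorm f < +oo)%E -> (weak_qnorm g < +oo)%E ->
  (weak_qnorm (f + g)%R < +oo)%E.
Proof.
move=> fy gy.
apply: (@le_lt_trans _ _ (2%:E * (weak_qnorm f + weak_qnorm g))%E); last first.
  by rewrite lte_mul_pinfty// lte_add_pinfty.
apply/weak_qnorm_leP => c c0.
have c20 : 0 < c / 2 by rewrite divr_gt0.
apply: (@le_trans _ _ (2%:E * ((c / 2)%:E * (mu [set t | (c / 2 < `|f t|)%R] +
                                      mu [set t | (c / 2 < `|g t|)%R])))%E).
  rewrite muleA -EFinM mulrC divfK//.
  rewrite lee_pmul2l//.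
  apply: (le_trans _ (measureU2 mu (measurable_level _ _) (measurable_level _ _))).
  apply: le_measure; rewrite ?inE.
  - exact: (measurable_level (f + g)).
  - by apply: measurableU; exact: measurable_level.
  - move=> t /= cfg; have [|fc] := ltP (c / 2) `|f t|; first by left.
    right; rewrite ltNge; apply/negP => gc.
    move: cfg; rewrite ltNge (le_trans (ler_normD _ _))//.
    by rewrite [leRHS](splitr c) lerD.
rewrite lee_pmul2l// muleDr ?ge0_adde_def ?inE ?measure_ge0//.
by rewrite leeD// weak_qnorm_ge.
Qed.

Definition weakL1_pred : {pred {mfun T >-> R}} :=
  [pred f : {mfun T >-> R} | (weak_qnorm f < +oo)%E].

Lemma weakL1_submod_closed : submod_closed weakL1_pred.
Proof.
split=> [|a f g]; rewrite !inE/=.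
  by apply/(@le_lt_trans _ _ 0%E)/ltry/weak_qnorm_leP => c c0;
    rewrite (_ : [set _ | _] = set0) ?measure0 ?mule0//;
    apply/seteqP; split => t //=; rewrite normr0 ltNge (ltW c0).
by move=> fy gy; exact: (weak_qnormD_lty (weak_qnormZ_lty a fy) gy).
Qed.

HB.instance Definition _ :=
  GRing.isSubmodClosed.Build R {mfun T >-> R} weakL1_pred weakL1_submod_closed.

(* Elements are functions, not classes: a.e. null functions have gauge 0
   (weak_gauge_null), hence are identified with 0 in normed_envelope. *)
Record weakL1 := WeakL1 {
  weakL1_mfun :> {mfun T >-> R} ;
  weakL1P : weakL1_mfun \in weakL1_pred }.

HB.instance Definition _ := [isSub for weakL1_mfun].
HB.instance Definition _ := [Choice of weakL1 by <:].
HB.instance Definition _ := [SubChoice_isSubLmodule of weakL1 by <:].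

End weak_L1.

Section gauge.
Context d (T : measurableType d) (R : realType).
Variable mu : {measure set T -> \bar R}.
Local Notation L := (weakL1 mu).
Implicit Types (f g h : L).

Definition weak_hull : set (convex_lmodType L) :=
  smallest (@convex_set R L) [set f : L | (weak_qnorm mu f <= 1)%E].

(* The infimum is over a nonempty set (gauge_set_neq0), so it is not the
   default value of inf. *)
Definition weak_gauge f : R :=
  inf [set t : R | 0 < t /\ weak_hull (t^-1 *: f)].

Lemma weakL1_ext f g : (forall t, f t = g t) -> f = g.
Proof. by move=> fg; apply/val_inj/val_inj/funext. Qed.

Lemma weakL1D f g t : (f + g) t = f t + g t. Proof. by []. Qed.
Lemma weakL1B f g t : (f - g) t = f t - g t. Proof. by []. Qed.
Lemma weakL1Z (a : R) f t : (a *: f) t = a * f t. Proof. by []. Qed.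

Lemma weak_hull_convex f g (s t : R) : 0 <= s -> 0 <= t -> s + t = 1 ->
  weak_hull f -> weak_hull g -> weak_hull (s *: f + t *: g).
Proof.
move=> s0 t0 st Hf Hg A [cA UA].
have s1 : s <= 1 by rewrite -st lerDl.
have := cA f g (Itv01 s0 s1) (mem_set (Hf _ (conj cA UA))) (mem_set (Hg _ (conj cA UA))).
by rewrite inE (_ : t = 1 - s)// -st [s + t]addrC addrK.
Qed.

Lemma weakL1_mul_subproof (phi : {mfun T >-> R}) f :
  (forall t, `|phi t| <= 1) -> phi * f \in weakL1_pred mu.
Proof.
move=> phi1; rewrite inE/=; apply: le_lt_trans (weakL1P f).
apply: le_weak_qnorm; apply: aeW => t /=.
by rewrite normrM ler_piMl.
Qed.

Definition weakL1_mul (phi : {mfun T >-> R}) (phi1 : forall t, `|phi t| <= 1) f : L :=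
  WeakL1 (weakL1_mul_subproof f phi1).

Lemma weak_hull_mul (phi : {mfun T >-> R}) (phi1 : forall t, `|phi t| <= 1) f :
  weak_hull f -> weak_hull (weakL1_mul phi1 f).
Proof.
apply: (@smallest_sub _ _ _ [set f | weak_hull (weakL1_mul phi1 f)]) => //.
  move=> x y l; rewrite !inE/= => Hx Hy.
  have -> : weakL1_mul phi1 (l%:inum *: (x : L) + (1 - l%:inum) *: (y : L)) =
     l%:inum *: weakL1_mul phi1 x + (1 - l%:inum) *: weakL1_mul phi1 y.
    apply: weakL1_ext => t /=.
    by rewrite mulrDr; congr (_ + _); rewrite mulrCA.
  by apply: weak_hull_convex => //; rewrite ?subr_ge0// addrC subrK.
move=> {}f /= f1; apply: sub_gen_smallest => /=; apply: le_trans f1.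
by apply: le_weak_qnorm; apply: aeW => t /=; rewrite normrM ler_piMl.
Qed.

Lemma weak_hull_null f : weak_qnorm mu f = 0%E -> weak_hull f.
Proof. by move=> f0; apply: sub_gen_smallest; rewrite /= f0. Qed.

Lemma weak_qnorm_null f : {ae mu, forall t, f t = 0} -> weak_qnorm mu f = 0%E.
Proof.
move=> f0; apply/eqP; rewrite eq_le weak_qnorm_ge0 andbT.
apply: (@le_trans _ _ (weak_qnorm mu (0 : {mfun T >-> R}))).
  by apply: le_weak_qnorm; apply: filterS f0 => t ->.
apply/weak_qnorm_leP => c c0.
rewrite (_ : [set _ | _] = set0) ?measure0 ?mule0//.
by apply/seteqP; split => t //=; rewrite normr0 ltNge (ltW c0).
Qed.

Lemma weak_hull0 : weak_hull 0.
Proof. by apply: weak_hull_null; apply: weak_qnorm_null; exact: aeW. Qed.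

Lemma gauge_set_neq0 f : [set t : R | 0 < t /\ weak_hull (t^-1 *: f)] !=set0.
Proof.
have fy : weak_qnorm mu f \is a fin_num.
  by rewrite ge0_fin_numE ?weak_qnorm_ge0//; exact: (weakL1P f).
pose K := fine (weak_qnorm mu f) + 1.
have q0 : 0 <= fine (weak_qnorm mu f) by rewrite fine_ge0// weak_qnorm_ge0.
have K0 : 0 < K by rewrite ltr_wpDl.
exists K; split => //; apply: sub_gen_smallest => /=.
apply/weak_qnorm_leP => c c0 /=.
rewrite (_ : [set _ | _] = [set t | c * K < `|f t|]); last first.
  apply/seteqP; split => t /=;
  by rewrite normrM normfV (gtr0_norm K0) ltr_pdivlMl// [K * c]mulrC.
rewrite -(@lee_pmul2l _ K%:E)// muleA -EFinM mule1 mulrC.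
apply: le_trans (weak_qnorm_ge _ _ _) _; first exact: mulr_gt0.
by rewrite -(fineK fy) lee_fin lerDl.
Qed.

Lemma gauge_set_lb f :
  has_lbound [set t : R | 0 < t /\ weak_hull (t^-1 *: f)].
Proof. by exists 0 => t [/ltW]. Qed.

Let gauge_has_inf f := conj (gauge_set_neq0 f) (gauge_set_lb f).

Lemma weak_gauge_ge0 f : 0 <= weak_gauge f.
Proof. by apply: lb_le_inf => [|t [/ltW]]; first exact: gauge_set_neq0. Qed.

Lemma weak_gauge_le f (t : R) : 0 < t -> weak_hull (t^-1 *: f) ->
  weak_gauge f <= t.
Proof. by move=> t0 Ht; apply: ge_inf; first exact: gauge_set_lb. Qed.

Lemma weak_gaugeD f g : weak_gauge (f + g) <= weak_gauge f + weak_gauge g.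
Proof.
rewrite /weak_gauge -inf_sumE//; apply: lb_le_inf.
  have [[s Hs] [t Ht]] := (gauge_set_neq0 f, gauge_set_neq0 g).
  by exists (s + t), s => //; exists t.
move=> _ [s [s0 Hs]] [t [t0 Ht] <-]; apply: weak_gauge_le; first exact: addr_gt0.
have st0 : s + t != 0 by rewrite gt_eqF// addr_gt0.
have -> : (s + t)^-1 *: (f + g) =
   (s / (s + t)) *: (s^-1 *: f) + (t / (s + t)) *: (t^-1 *: g).
  rewrite scalerDr (scalerA _ _ f) (scalerA _ _ g).
  by rewrite ![_ / (s + t) * _]mulrAC !mulfV ?gt_eqF// !mul1r.
apply: weak_hull_convex => //; rewrite ?divr_ge0 ?addr_ge0 ?ltW//.
by rewrite -mulrDl mulfV.
Qed.

Lemma le_weak_gauge_pt f g : (forall t, `|f t| <= `|g t|) ->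
  weak_gauge f <= weak_gauge g.
Proof.
move=> fg; apply: lb_le_inf; first exact: gauge_set_neq0.
move=> s [s0 Hs]; apply: weak_gauge_le => //.
have mphi : measurable_fun setT (fun t => f t / g t).
  by apply: measurable_funM => //; apply: (measurableT_comp (@measurable_inv R)).
pose phi : {mfun T >-> R} := HB.pack (fun t => f t / g t)
  (@isMeasurableFun.Build _ _ T R _ mphi).
have phi1 t : `|phi t| <= 1.
  rewrite /phi/= normrM normfV; have [g0|g0] := eqVneq (g t) 0.
    by rewrite g0 normr0 invr0 mulr0.
  by rewrite ler_pdivrMr ?normr_gt0// mul1r.
have -> : s^-1 *: f = weakL1_mul phi1 (s^-1 *: g).
  apply: weakL1_ext => t /=; rewrite /GRing.scale/= mulrCA; congr (_ * _).
  change (f t = f t / g t * g t).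
  have [g0|g0] := eqVneq (g t) 0; last by rewrite divfK.
  by rewrite g0 mulr0; apply/eqP; rewrite -normr_le0 (le_trans (fg t))// g0 normr0.
exact: weak_hull_mul.
Qed.

Lemma weak_gauge_null f : {ae mu, forall t, f t = 0} -> weak_gauge f = 0.
Proof.
move=> f0; apply/eqP; rewrite eq_le weak_gauge_ge0 andbT.
apply/ler_addgt0Pl => e e0; rewrite addr0; apply: weak_gauge_le => //.
apply: weak_hull_null; apply: weak_qnorm_null.
by apply: filterS f0 => t ft0; rewrite weakL1Z ft0 mulr0.
Qed.

Lemma weak_gaugeZ_le (a : R) f : weak_gauge (a *: f) <= `|a| * weak_gauge f.
Proof.
have [->|a0] := eqVneq a 0.
  rewrite scale0r normr0 mul0r weak_gauge_null//.
  by apply: aeW.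
have a0' : 0 < `|a| by rewrite normr_gt0.
rewrite -ler_pdivrMl//; apply: lb_le_inf; first exact: gauge_set_neq0.
move=> t [t0 Ht]; rewrite ler_pdivrMl//.
apply: weak_gauge_le; first exact: mulr_gt0.
pose phi : {mfun T >-> R} := cst (a / `|a|).
have phi1 t' : `|phi t'| <= 1.
  by rewrite /phi/= normrM normfV normr_id mulfV// gt_eqF.
have -> : (`|a| * t)^-1 *: (a *: f) = weakL1_mul phi1 (t^-1 *: f).
  apply: weakL1_ext => u; change ((`|a| * t)^-1 * (a * f u) = a / `|a| * (t^-1 * f u)).
  by rewrite invfM mulrACA [_^-1 * a]mulrC.
exact: weak_hull_mul.
Qed.

Lemma weak_gaugeZ (a : R) f : weak_gauge (a *: f) = `|a| * weak_gauge f.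
Proof.
apply/eqP; rewrite eq_le weak_gaugeZ_le/=.
have [->|a0] := eqVneq a 0; first by rewrite normr0 mul0r weak_gauge_ge0.
rewrite -{1}(scale1r f) -(mulVf a0) -scalerA.
rewrite -ler_pdivlMl ?normr_gt0// -normfV; exact: weak_gaugeZ_le.
Qed.

Lemma weakL1_max_subproof f g : max_mfun f g \in weakL1_pred mu.
Proof.
have -> : max_mfun f g = (g : {mfun T >-> R}) + max_mfun (val (f - g)) 0.
  apply/val_inj/funext => t /=.
  change (Num.max (f t) (g t) = g t + Num.max (f t - g t) 0).
  by rewrite addr_maxr addr0 addrC subrK.
suff pos : max_mfun (val (f - g)) 0 \in weakL1_pred mu.
  exact: (weak_qnormD_lty (weakL1P g) pos).
apply: le_lt_trans (weakL1P (f - g)); apply: le_weak_qnorm; apply: aeW => t.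
change (`|Num.max ((f - g) t) 0| <= `|(f - g) t|).
by case: (leP ((f - g) t) 0) => // _; rewrite normr0.
Qed.

Definition weakL1_max f g : L := WeakL1 (weakL1_max_subproof f g).

Lemma weakL1_min_subproof f g : min_mfun f g \in weakL1_pred mu.
Proof.
have -> : min_mfun f g = - (weakL1_max (- f) (- g)) :> {mfun T >-> R}.
  apply/val_inj/funext => t.
  change (Num.min (f t) (g t) = - Num.max (- f t) (- g t)).
  by rewrite -oppr_min opprK.
exact: (weakL1P (- weakL1_max (- f) (- g))).
Qed.

Definition weakL1_min f g : L := WeakL1 (weakL1_min_subproof f g).

Lemma weakL1_maxE f g t : weakL1_max f g t = Num.max (f t) (g t).
Proof. by []. Qed.
Lemma weakL1_minE f g t : weakL1_min f g t = Num.min (f t) (g t).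
Proof. by []. Qed.

Lemma weak_gaugeN f : weak_gauge (- f) = weak_gauge f.
Proof. by rewrite -scaleN1r weak_gaugeZ normrN1 mul1r. Qed.

Lemma weak_gauge_ae f g : {ae mu, forall t, f t = g t} ->
  weak_gauge (f - g) = 0.
Proof.
by move=> fg; apply: weak_gauge_null; apply: filterS fg => t; rewrite weakL1B => ->; rewrite subrr.
Qed.

Lemma weak_gauge_abs f : weak_gauge (weakL1_max f (- f)) = weak_gauge f.
Proof.
have E t : weakL1_max f (- f) t = `|f t| by rewrite weakL1_maxE maxrN.
by apply/eqP; rewrite eq_le !le_weak_gauge_pt// => t; rewrite E normr_id.
Qed.

Lemma le_weak_gaugeD f g h :
  {ae mu, forall t, `|f t| <= `|g t| + `|h t|} ->
  weak_gauge f <= weak_gauge g + weak_gauge h.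
Proof.
move=> fgh; rewrite -(weak_gauge_abs g) -(weak_gauge_abs h).
apply: le_trans (weak_gaugeD _ _); set k := _ + _.
have kE t : k t = `|g t| + `|h t| by rewrite weakL1D !weakL1_maxE !maxrN.
pose f' := weakL1_max (weakL1_min f k) (- k).
have f'E t : f' t = Num.max (Num.min (f t) (k t)) (- k t) by [].
have ff' : weak_gauge (f - f') = 0.
  apply: weak_gauge_ae; apply: filterS fgh => t.
  rewrite -kE f'E ler_norml => /andP[kf fk].
  by rewrite (min_idPl fk) (max_idPl kf).
rewrite -(subrK f' f) (le_trans (weak_gaugeD _ _))// ff' add0r.
apply: le_weak_gauge_pt => t.
have k0 : 0 <= k t by rewrite kE addr_ge0.
by rewrite (ger0_norm k0) ler_norml f'E le_max lexx orbT/= ge_max ge_min lexx orbT/= ge0_cp.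
Qed.

Definition weak_null : {pred L} := [pred f : L | weak_gauge f == 0].

Lemma weak_null_zmod_closed : zmod_closed weak_null.
Proof.
split=> [|f g]; rewrite !inE; first by rewrite weak_gauge_null//; exact: aeW.
move=> /eqP f0 /eqP g0; rewrite eq_le weak_gauge_ge0 andbT.
by apply: le_trans (weak_gaugeD _ _) _; rewrite weak_gaugeN f0 g0 addr0.
Qed.

HB.instance Definition _ := GRing.isZmodClosed.Build L weak_null weak_null_zmod_closed.

End gauge.

Definition normed_envelope d (T : measurableType d) (R : realType)
    (mu : {measure set T -> \bar R}) : Type :=
  Quotient.quot (@weak_null d T R mu).

Section normed_envelope.
Context d (T : measurableType d) (R : realType).
Variable mu : {measure set T -> \bar R}.
Local Notation L := (weakL1 mu).
Local Notation W := (normed_envelope mu).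
Implicit Types (f g h : L) (x y z : W).
Local Open Scope quotient_scope.

HB.instance Definition _ := GRing.Zmodule.on W.
HB.instance Definition _ := EqQuotient.on W.

Definition envelope_class f : W := \pi_W f.
Local Notation cl := envelope_class.

Lemma envelope_classP f g : cl f = cl g <-> weak_gauge (f - g) = 0.
Proof.
split=> [/eqP|fg]; last apply/eqP.
  by rewrite -[_ == _]Quotient.idealrBE inE => /eqP.
by rewrite -[_ == _]Quotient.idealrBE inE fg.
Qed.

Lemma envelope_repr x : cl (repr x) = x.
Proof. exact: reprK. Qed.

Lemma envelope_classD f g : cl (f + g) = cl f + cl g.
Proof. exact: Quotient.pi_add. Qed.

Lemma envelope_class0 : cl 0 = 0.
Proof. by apply: (addrI (cl 0)); rewrite -envelope_classD !addr0. Qed.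

Let scale (a : R) x : W := cl (a *: repr x).

Let scaleE a f : scale a (cl f) = cl (a *: f).
Proof.
apply/envelope_classP; rewrite -scalerBr weak_gaugeZ.
by have /envelope_classP -> := envelope_repr (cl f); rewrite mulr0.
Qed.

Let scalerA_ a b x : scale a (scale b x) = scale (a * b) x.
Proof. by rewrite -(envelope_repr x) !scaleE scalerA. Qed.

Let scale1r_ : left_id 1 scale.
Proof. by move=> x; rewrite -(envelope_repr x) !scaleE scale1r. Qed.

Let scalerDr_ : right_distributive scale +%R.
Proof.
move=> a x y; rewrite -(envelope_repr x) -(envelope_repr y).
by rewrite -envelope_classD !scaleE scalerDr envelope_classD.
Qed.

Let scalerDl_ x : {morph scale^~ x : a b / a + b}.
Proof.
by move=> a b; rewrite -(envelope_repr x) !scaleE scalerDl envelope_classD.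
Qed.

HB.instance Definition _ :=
  GRing.Zmodule_isLmodule.Build R W scalerA_ scale1r_ scalerDr_ scalerDl_.

Lemma envelope_classZ (a : R) f : cl (a *: f) = a *: cl f.
Proof. by rewrite -scaleE. Qed.

Let norm x : R := weak_gauge (repr x).

Let normE f : norm (cl f) = weak_gauge f.
Proof.
have H g h : weak_gauge (g - h) = 0 -> weak_gauge g <= weak_gauge h.
  by move=> gh; rewrite -[g](subrK h) (le_trans (weak_gaugeD _ _))// gh add0r.
have fr := envelope_repr (cl f).
by apply/eqP; rewrite eq_le; apply/andP; split; apply: H; apply/envelope_classP.
Qed.

Let ler_normD_ x y : norm (x + y) <= norm x + norm y.
Proof.
rewrite -(envelope_repr x) -(envelope_repr y) -envelope_classD !normE.
exact: weak_gaugeD.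
Qed.

Let normrZ_ (a : R) x : norm (a *: x) = `|a| * norm x.
Proof. by rewrite -(envelope_repr x) -envelope_classZ !normE weak_gaugeZ. Qed.

Let normr0_eq0_ x : norm x = 0 -> x = 0.
Proof.
rewrite -(envelope_repr x) normE => x0.
by rewrite -envelope_class0; apply/envelope_classP; rewrite subr0.
Qed.

HB.instance Definition _ :=
  Lmodule_isNormed.Build R W ler_normD_ normrZ_ normr0_eq0_.

Lemma envelope_norm f : `|cl f| = weak_gauge f.
Proof. exact: normE. Qed.

(* Quotient order: the positive cone of W is the image of the positive cone
   of Weak L^1 (pointwise a.e. order). *)
Definition envelope_le x y : bool :=
  `[< exists f g, [/\ cl f = x, cl g = y & {ae mu, forall t, f t <= g t}] >].

Lemma envelope_leP f g :
  envelope_le (cl f) (cl g) <-> weak_gauge (weakL1_max (f - g) 0) = 0.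
Proof.
split=> [/asboolP[f' [g' [/envelope_classP ff' /envelope_classP gg' fg']]]|fg].
  apply/eqP; rewrite eq_le weak_gauge_ge0 andbT -[leRHS]addr0 -{1}ff' -gg'.
  apply: le_weak_gaugeD; apply: filterS fg' => t fg.
  change (`|Num.max (f t - g t) 0| <= `|f' t - f t| + `|g' t - g t|).
  have A := ler_norm (g' t - g t); have B := ler_norm (- (f' t - f t)).
  rewrite normrN in B.
  have C := normr_ge0 (f' t - f t); have D := normr_ge0 (g' t - g t).
  have E : 0 <= Num.max (f t - g t) 0 by rewrite le_max lexx orbT.
  rewrite (ger0_norm E) ge_max; apply/andP; split; lra.
apply/asboolP; exists (weakL1_min f g), g; split=> //.
  apply/envelope_classP; rewrite -weak_gaugeN -[RHS]fg; congr weak_gauge.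
  apply: weakL1_ext => t.
  change (- (Num.min (f t) (g t) - f t) = Num.max (f t - g t) 0).
  have [fg'|gf] := leP (f t) (g t).
    by rewrite subrr oppr0; apply/esym/max_idPr; rewrite subr_le0.
  by rewrite opprB; apply/esym/max_idPl; rewrite subr_ge0 ltW.
by apply: aeW => t; rewrite weakL1_minE ge_min lexx orbT.
Qed.

Let pos_le f g h : (forall t, (weakL1_max f 0) t <= (weakL1_max g 0) t + (weakL1_max h 0) t) ->
  weak_gauge (weakL1_max g 0) = 0 -> weak_gauge (weakL1_max h 0) = 0 ->
  weak_gauge (weakL1_max f 0) = 0.
Proof.
move=> fgh g0 h0; apply/eqP; rewrite eq_le weak_gauge_ge0 andbT.
rewrite -[leRHS]addr0 -{1}g0 -h0; apply: le_weak_gaugeD; apply: aeW => t.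
by rewrite !ger0_norm// weakL1_maxE le_max lexx orbT.
Qed.

Let le_refl_ : reflexive envelope_le.
Proof.
move=> x; rewrite -(envelope_repr x); apply/envelope_leP.
by apply: weak_gauge_null; apply: aeW => t; rewrite weakL1_maxE weakL1B subrr maxxx.
Qed.

Let le_anti_ : antisymmetric envelope_le.
Proof.
move=> x y; rewrite -(envelope_repr x) -(envelope_repr y).
move: (repr x) (repr y) => f g /andP[/envelope_leP fg /envelope_leP gf].
apply/envelope_classP/eqP; rewrite eq_le weak_gauge_ge0 andbT.
rewrite -[leRHS]addr0 -{1}fg -gf; apply: le_weak_gaugeD; apply: aeW => t.
rewrite [`|weakL1_max (f - g) 0 t|]ger0_norm; last by rewrite weakL1_maxE le_max lexx orbT.
rewrite [`|weakL1_max (g - f) 0 t|]ger0_norm; last by rewrite weakL1_maxE le_max lexx orbT.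
change (`|f t - g t| <= Num.max (f t - g t) 0 + Num.max (g t - f t) 0).
have A : f t - g t <= Num.max (f t - g t) 0 by rewrite le_max lexx.
have B : g t - f t <= Num.max (g t - f t) 0 by rewrite le_max lexx.
have C : 0 <= Num.max (f t - g t) 0 by rewrite le_max lexx orbT.
have D : 0 <= Num.max (g t - f t) 0 by rewrite le_max lexx orbT.
rewrite ler_norml; apply/andP; split; lra.
Qed.

Let le_trans_ : transitive envelope_le.
Proof.
move=> y x z; rewrite -(envelope_repr x) -(envelope_repr y) -(envelope_repr z).
move: (repr x) (repr y) (repr z) => f g h /envelope_leP fg /envelope_leP gh.
apply/envelope_leP; apply: pos_le fg gh => t.
change (Num.max (f t - h t) 0 <= Num.max (f t - g t) 0 + Num.max (g t - h t) 0).
have A : f t - g t <= Num.max (f t - g t) 0 by rewrite le_max lexx.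
have B : g t - h t <= Num.max (g t - h t) 0 by rewrite le_max lexx.
have C : 0 <= Num.max (f t - g t) 0 by rewrite le_max lexx orbT.
have D : 0 <= Num.max (g t - h t) 0 by rewrite le_max lexx orbT.
rewrite ge_max; apply/andP; split; lra.
Qed.

HB.instance Definition _ :=
  Order.Le_isPOrder.Build ring_display W le_refl_ le_anti_ le_trans_.

Let meet x y : W := cl (weakL1_min (repr x) (repr y)).
Let join x y : W := cl (weakL1_max (repr x) (repr y)).

Let le_min f g h : envelope_le (cl f) (cl (weakL1_min g h)) =
  envelope_le (cl f) (cl g) && envelope_le (cl f) (cl h).
Proof.
apply/idP/andP => [/envelope_leP fgh|[/envelope_leP fg /envelope_leP fh]].
  split; apply/envelope_leP; apply: pos_le (fgh) (fgh) => t.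
    change (Num.max (f t - g t) 0 <= Num.max (f t - Num.min (g t) (h t)) 0 +
      Num.max (f t - Num.min (g t) (h t)) 0).
    have A : f t - Num.min (g t) (h t) <= Num.max (f t - Num.min (g t) (h t)) 0 by rewrite le_max lexx.
    have B : 0 <= Num.max (f t - Num.min (g t) (h t)) 0 by rewrite le_max lexx orbT.
    have C : Num.min (g t) (h t) <= g t by rewrite ge_min lexx.
    rewrite ge_max; apply/andP; split; lra.
  change (Num.max (f t - h t) 0 <= Num.max (f t - Num.min (g t) (h t)) 0 +
      Num.max (f t - Num.min (g t) (h t)) 0).
  have A : f t - Num.min (g t) (h t) <= Num.max (f t - Num.min (g t) (h t)) 0 by rewrite le_max lexx.
  have B : 0 <= Num.max (f t - Num.min (g t) (h t)) 0 by rewrite le_max lexx orbT.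
  have C : Num.min (g t) (h t) <= h t by rewrite ge_min lexx orbT.
  rewrite ge_max; apply/andP; split; lra.
apply/envelope_leP; apply: pos_le fg fh => t.
change (Num.max (f t - Num.min (g t) (h t)) 0 <=
  Num.max (f t - g t) 0 + Num.max (f t - h t) 0).
have A : f t - g t <= Num.max (f t - g t) 0 by rewrite le_max lexx.
have B : f t - h t <= Num.max (f t - h t) 0 by rewrite le_max lexx.
have C : 0 <= Num.max (f t - g t) 0 by rewrite le_max lexx orbT.
have D : 0 <= Num.max (f t - h t) 0 by rewrite le_max lexx orbT.
rewrite ge_max; apply/andP; split; last lra.
by case: (leP (g t) (h t)) => _; lra.
Qed.

Let max_le f g h : envelope_le (cl (weakL1_max f g)) (cl h) =
  envelope_le (cl f) (cl h) && envelope_le (cl g) (cl h).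
Proof.
apply/idP/andP => [/envelope_leP fgh|[/envelope_leP fh /envelope_leP gh]].
  split; apply/envelope_leP; apply: pos_le (fgh) (fgh) => t.
    change (Num.max (f t - h t) 0 <= Num.max (Num.max (f t) (g t) - h t) 0 +
      Num.max (Num.max (f t) (g t) - h t) 0).
    have A : Num.max (f t) (g t) - h t <= Num.max (Num.max (f t) (g t) - h t) 0 by rewrite le_max lexx.
    have B : 0 <= Num.max (Num.max (f t) (g t) - h t) 0 by rewrite le_max lexx orbT.
    have C : f t <= Num.max (f t) (g t) by rewrite le_max lexx.
    rewrite ge_max; apply/andP; split; lra.
  change (Num.max (g t - h t) 0 <= Num.max (Num.max (f t) (g t) - h t) 0 +
      Num.max (Num.max (f t) (g t) - h t) 0).
  have A : Num.max (f t) (g t) - h t <= Num.max (Num.max (f t) (g t) - h t) 0 by rewrite le_max lexx.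
  have B : 0 <= Num.max (Num.max (f t) (g t) - h t) 0 by rewrite le_max lexx orbT.
  have C : g t <= Num.max (f t) (g t) by rewrite le_max lexx orbT.
  rewrite ge_max; apply/andP; split; lra.
apply/envelope_leP; apply: pos_le fh gh => t.
change (Num.max (Num.max (f t) (g t) - h t) 0 <=
  Num.max (f t - h t) 0 + Num.max (g t - h t) 0).
have A : f t - h t <= Num.max (f t - h t) 0 by rewrite le_max lexx.
have B : g t - h t <= Num.max (g t - h t) 0 by rewrite le_max lexx.
have C : 0 <= Num.max (f t - h t) 0 by rewrite le_max lexx orbT.
have D : 0 <= Num.max (g t - h t) 0 by rewrite le_max lexx orbT.
rewrite ge_max; apply/andP; split; last lra.
by case: (leP (f t) (g t)) => _; lra.
Qed.

Let meetP_ x y z : (x <= meet y z) = (x <= y) && (x <= z).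
Proof.
rewrite -[in LHS](envelope_repr x) [LHS]le_min.
by rewrite !envelope_repr.
Qed.

Let joinP_ x y z : (join x y <= z) = (x <= z) && (y <= z).
Proof.
rewrite -[in LHS](envelope_repr z) [LHS]max_le.
by rewrite !envelope_repr.
Qed.

HB.instance Definition _ :=
  Order.POrder_MeetJoin_isLattice.Build ring_display W meetP_ joinP_.

Let max_leW f g z : (cl (weakL1_max f g) <= z) = (cl f <= z) && (cl g <= z).
Proof.
rewrite -[in LHS](envelope_repr z) [LHS]max_le.
by rewrite !envelope_repr.
Qed.

Let le_minW x g h : (x <= cl (weakL1_min g h)) = (x <= cl g) && (x <= cl h).
Proof.
rewrite -[in LHS](envelope_repr x) [LHS]le_min.
by rewrite !envelope_repr.
Qed.

Lemma envelope_join f g : Order.join (cl f) (cl g) = cl (weakL1_max f g).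
Proof. by apply/eqP; rewrite eq_le leUx -max_leW lexx max_leW leUl leUr. Qed.

Lemma envelope_meet f g : Order.meet (cl f) (cl g) = cl (weakL1_min f g).
Proof. by apply/eqP; rewrite eq_le lexI -le_minW lexx le_minW leIl leIr. Qed.

End normed_envelope.

(* A function on a half-line or on the unit interval is represented by a Borel
   function on R; the measure is Lebesgue measure restricted to the
   interval, so points outside it are negligible.  Every Lebesgue measurable function is a.e.
   equal to a Borel one, so the a.e. classes are the usual ones. *)
Definition lebesgue_unit (R : realType) :
    {measure set (measurableTypeR R) -> \bar R} :=
  mrestr (@lebesgue_measure R) (measurable_itv `[0, 1]%R).

Definition lebesgue_half_line (R : realType) :
    {measure set (measurableTypeR R) -> \bar R} :=
  mrestr (@lebesgue_measure R) (measurable_itv `[0, +oo[%R).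

Section koethe.
Context d (T : measurableType d) (R : realType).
Variable mu : {measure set T -> \bar R}.
Local Notation F := {mfun T >-> R}.
Implicit Types (f g h : F) (E : set F).

Definition locally_integrable f : Prop :=
  forall A, measurable A -> (mu A < +oo)%E -> mu.-integrable A (EFin \o f).

(* A space of a.e. classes is given by the set E of all representatives of its
   elements (koethe_solid makes E and nrm invariant under a.e. equality); the
   values of nrm outside E are irrelevant. *)
Record koethe_space E (nrm : F -> R) : Prop := {
  koethe_locally_integrable : forall f, E f -> locally_integrable f ;
  koethe_linear : forall (a : R) f g, E f -> E g -> E (a *: f + g) ;
  koethe_normD : forall f g, E f -> E g -> nrm (f + g) <= nrm f + nrm g ;
  koethe_normZ : forall (a : R) f, E f -> nrm (a *: f) = `|a| * nrm f ;
  koethe_norm_eq0 : forall f, E f -> nrm f = 0 -> {ae mu, forall t, f t = 0} ;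
  koethe_complete : forall u : nat -> F, (forall n, E (u n)) ->
    (forall e : R, 0 < e -> exists N, forall m n, (N <= m)%N -> (N <= n)%N ->
       nrm (u m - u n) < e) ->
    exists2 f, E f & nrm (u n - f) @[n --> \oo] --> (0 : R) ;
  koethe_solid : forall f g, E g -> {ae mu, forall t, `|f t| <= `|g t|} ->
    E f /\ nrm f <= nrm g ;
  koethe_indic : forall A (mA : measurable A), (mu A < +oo)%E ->
    E (indic_mfun A mA) }.

(* The integral f |-> \int f h is represented by its density h. *)
Definition koethe_dual E : set F :=
  [set h | forall f, E f -> mu.-integrable setT (EFin \o (f * h))].

Definition koethe_dual_norm E (nrm : F -> \bar R) h : \bar R :=
  ereal_sup [set `|\int[mu]_t (f t * h t)%:E|%E
            | f in [set f | E f /\ (nrm f <= 1)%E]].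

(* The simple integrable functions form a linear space, so their closed linear
   span is their norm closure. *)
Definition simple_closure E (nrm : F -> \bar R) : set F :=
  [set f | E f /\ forall e : R, 0 < e -> exists s : F,
     [/\ finite_set (range s), mu.-integrable setT (EFin \o s) &
         (nrm (f - s)%R < e%:E)%E]].

Definition L1_cap_Loo : set F :=
  [set f | ('N[mu]_1 [EFin \o f] < +oo)%E /\ ('N[mu]_+oo [EFin \o f] < +oo)%E].

Definition L1_cap_Loo_norm f : \bar R :=
  maxe ('N[mu]_1 [EFin \o f])%E ('N[mu]_+oo [EFin \o f])%E.

Definition L1_plus_Loo_decomposition f : set (F * F) :=
  [set uv : F * F | [/\ ('N[mu]_1 [EFin \o uv.1] < +oo)%E,
                ('N[mu]_+oo [EFin \o uv.2] < +oo)%E &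
                {ae mu, forall t, f t = uv.1 t + uv.2 t}]].

Definition L1_plus_Loo : set F :=
  [set f | L1_plus_Loo_decomposition f !=set0].

Definition L1_plus_Loo_norm f : \bar R :=
  ereal_inf [set ('N[mu]_1 [EFin \o uv.1] + 'N[mu]_+oo [EFin \o uv.2])%E
            | uv in L1_plus_Loo_decomposition f].

Definition norm_one_inclusion (A B : set F) (nA nB : F -> \bar R) : Prop :=
  A `<=` B /\ ereal_sup [set nB f | f in [set f | A f /\ (nA f <= 1)%E]] = 1%E.

End koethe.

Section rearrangement_invariant.
Variable R : realType.
Local Notation mu := (lebesgue_half_line R).
Local Notation X := (measurableTypeR R).
Local Notation F := {mfun X >-> R}.

(* tau is an automorphism of [0, +oo[ with inverse sigma; the values of both
   functions on negative reals are irrelevant. *)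
Definition half_line_automorphism (tau sigma : {mfun X >-> X}) : Prop :=
  [/\ forall t : R, 0 <= t -> 0 <= (tau t : R) /\ 0 <= (sigma t : R),
      forall t : R, 0 <= t -> sigma (tau t) = t /\ tau (sigma t) = t &
      forall A, measurable A -> mu (tau @^-1` A) = mu A].

Record rearrangement_invariant (E : set F) (nrm : F -> R) : Prop := {
  ri_koethe : koethe_space mu E nrm ;
  ri_automorphism : forall tau sigma, half_line_automorphism tau sigma ->
    forall f : F, (E f <-> E [mfun of f \o sigma]) /\
      (E f -> nrm f = nrm [mfun of f \o sigma]) ;
  ri_norming : let E' := koethe_dual mu E in
    let nrm' := koethe_dual_norm mu E (EFin \o nrm) in
    forall f, E f -> (nrm f)%:E =
      ereal_sup [set `|\int[mu]_t (f t * h t)%:E|%E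
                | h in [set h | E' h /\ (nrm' h <= 1)%E]] ;
  ri_bidual : let E' := koethe_dual mu E in
    let nrm' := koethe_dual_norm mu E (EFin \o nrm) in
    let E'' := koethe_dual mu E' in
    let nrm'' := koethe_dual_norm mu E' nrm' in
    E = E'' \/ E = simple_closure mu E'' nrm'' ;
  ri_cap : norm_one_inclusion (L1_cap_Loo mu) E
    (L1_cap_Loo_norm mu) (EFin \o nrm) ;
  ri_plus : norm_one_inclusion E (L1_plus_Loo mu)
    (EFin \o nrm) (L1_plus_Loo_norm mu) }.

End rearrangement_invariant.

(* Main.v *)
Require Import Defs.
From HB Require Import structures.
From mathcomp Require Import all_boot all_order all_algebra.
From mathcomp Require Import all_classical all_reals all_analysis measurable_realfun.
From mathcomp Require Import lra.
Set Implicit Arguments.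
Unset Strict Implicit.
Unset Printing Implicit Defensive.
Import Order.TTheory GRing.Theory Num.Theory.
Import numFieldNormedType.Exports.
Local Open Scope classical_set_scope.
Local Open Scope ring_scope.

(* The unit ball of the dual of E contains a countable norming family of
   bounded functions h_n >= 0 supported in [0, k_n[; list it so that each member
   occurs infinitely often.  Write f h_n, clamped to [-K_n, K_n], on geometrically
   shrinking copies of [0, k_n[ with heights inverse to their widths, and place
   these blocks one after the other towards 0 to get J f in Weak L^1.  For such
   a function the distribution function is governed by the integrals of the
   individual blocks, so rho (J f) is the limsup of the integrals of |f h_n|,
   which is the norm of f: the upper bound holds because rho vanishes on bounded
   functions and q controls the tail, and the lower bound because membership
   in the convex hull forces a logarithmic growth bound on truncated integrals.
   Clamping is not linear, so K_n must be such that the part of f h_n above K_n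
   tends to 0 in L^1 for every f in E.  Either small sets carry small integrals
   uniformly on the ball of E, and K_n is chosen large; or some c > 0 is exceeded
   on arbitrarily short intervals, and then averaging over rearrangements
   bounds every h in the dual ball by 1/c, so that K_n = n + 1 works. *)

(** * Logarithmic growth of truncated integrals on the convex hull *)

Section hull_growth.
Context d (T : measurableType d) (R : realType).
Variable mu : {measure set T -> \bar R}.
Local Notation L := (weakL1 mu).

(** The gauge is bounded below by an invariant of the hull. On the quasi-norm ball the integral over
    A of |g| truncated at c r^N is at most c mu(A) + N (r - 1). A convex combination raises the
    truncation level, which costs an additive constant D depending on the combination. A block
    therefore needs a ladder so long that N (r - 1) dwarfs D, with r so close to 1 that N (1 - 1/r)
    and N (r - 1) agree in the limit; this dictates [ratio] and [steps]. Heights and gaps of the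
    blocks are fixed before f is seen, and E may be nonseparable, so every block needs a bound
    independent of f: hence the clamping. Clamping on both sides is monotone, so it commutes with
    max and min exactly; only linearity is lost, and it is recovered up to functions of gauge zero.
    Rearrangement invariance is what lets one sequence K serve every f: mass sitting near 0 can be
    carried anywhere else without changing the norm. *)

Lemma min_geometric_le (y c r : R) (N : nat) : 0 <= c -> 1 <= r -> 0 <= y ->
  Num.min y (c * r ^+ N) <=
    c + \sum_(l < N) (c * r ^+ l * (r - 1)) * (c * r ^+ l < y)%R%:R.
Proof.
(* A discrete layer-cake: rung [l] of the ladder has height c r^l (r - 1) and is counted as soon as
   y exceeds its lower end. *)
move=> c0 r1 y0; elim: N => [|N IH].
  by rewrite big_ord0 addr0 expr0 mulr1 ge_min lexx orbT.
rewrite big_ord_recr/= addrA exprSr.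
have cN : 0 <= c * r ^+ N by rewrite mulr_ge0// exprn_ge0// (le_trans ler01).
have cN1 : c * r ^+ N <= c * r ^+ N * r by rewrite ler_peMr.
have [yN|Ny] := ltP (c * r ^+ N) y; last first.
  rewrite mulr0 addr0; apply: le_trans IH; rewrite mulrA.
  by rewrite (min_idPl Ny) (min_idPl (le_trans Ny cN1)).
move: IH; rewrite (min_idPr (ltW yN)) => IH.
rewrite mulr1 mulrA ge_min; apply/orP; right.
lra.
Qed.

Lemma measurable_minr_cst (f : {mfun T >-> R}) (A : set T) (M : R) :
  measurable_fun A (fun t => Num.min `|f t| M).
Proof.
by apply: measurable_funTS; apply: measurable_minr => //; exact: measurableT_comp.
Qed.

(** After integrating the layer-cake, rung [l] contributes at most (r - 1) times c r^l mu{|f| > c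
    r^l}, hence at most r - 1 by the definition of the quasi-norm; the summand c gives c mu(A). *)
Lemma le_integral_min_weak (f : {mfun T >-> R}) (A : set T) (r c : R) (N : nat) :
  (weak_qnorm mu f <= 1)%E -> measurable A -> 1 <= r -> 0 < c ->
  (\int[mu]_(t in A) (Num.min `|f t| (c * r ^+ N))%:E <=
   c%:E * mu A + (N%:R * (r - 1))%:E)%E.
Proof.
move=> f1 mA r1 c0.
have c0' := ltW c0.
have r0 : 0 <= r - 1 by rewrite subr_ge0.
have rpos : 0 < r by exact: lt_le_trans r1.
pose F (l : nat) (t : T) : \bar R :=
  ((c * r ^+ l * (r - 1))%:E * (\1_[set t | c * r ^+ l < `|f t|] t)%:E)%E.
have mF l (D : set T) : measurable_fun D (F l).
  apply: measurable_funeM; apply/measurable_EFinP/measurable_funTS/measurable_indic.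
  exact: measurable_level.
have F0 l t : (0 <= F l t)%E.
  by rewrite mule_ge0// lee_fin ?mulr_ge0// exprn_ge0// ltW.
apply: (@le_trans _ _ (\int[mu]_(t in A) (c%:E + \sum_(l < N) F l t))%E).
  apply: ge0_le_integral => //.
  - by move=> t _; rewrite lee_fin le_min normr_ge0/= mulr_ge0// exprn_ge0// ltW.
  - by apply/measurable_EFinP; exact: measurable_minr_cst.
  - by apply: emeasurable_funD => //; exact: emeasurable_sum.
  - move=> t _; have := @min_geometric_le `|f t| c r N c0' r1 (normr_ge0 _).
    rewrite -lee_fin EFinD => /le_trans; apply; apply: leeD => //.
    rewrite -sumEFin; apply: lee_sum => l _.
    rewrite /F -EFinM lee_fin indicE; have [xl|xl] := ltP (c * r ^+ l) `|f t|.
      by rewrite mem_set.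
    by rewrite mulr0 mulr_ge0// ?mulr_ge0// exprn_ge0// ltW.
rewrite ge0_integralD//; last 2 first.
  - by move=> t _; exact: sume_ge0.
  - exact: emeasurable_sum.
rewrite integral_cst//; apply: leeD => //.
rewrite ge0_integral_sum//.
apply: (@le_trans _ _ (\sum_(l < N) (r - 1)%:E)%E); last first.
  by rewrite sumEFin sumr_const card_ord mulr_natl.
apply: lee_sum => l _.
rewrite /F ge0_integralZl//; last 2 first.
  - by apply/measurable_EFinP/measurable_funTS/measurable_indic; exact: measurable_level.
  - by rewrite lee_fin ?mulr_ge0// exprn_ge0// ltW.
rewrite integral_indic//; last exact: measurable_level.
have cl : 0 < c * r ^+ l by rewrite mulr_gt0// exprn_gt0.
apply: (@le_trans _ _ ((c * r ^+ l * (r - 1))%:E * mu [set t | (c * r ^+ l < `|f t|)%R])%E).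
  apply: lee_wpmul2l; first by rewrite lee_fin mulr_ge0// ltW.
  apply: le_measure; rewrite ?inE.
  - by apply: measurableI => //; exact: measurable_level.
  - exact: measurable_level.
  - exact: subIsetl.
rewrite [(c * r ^+ l * _)%R]mulrC EFinM -muleA -[leRHS]mule1.
apply: lee_wpmul2l; first by rewrite lee_fin.
by apply: le_trans f1; exact: weak_qnorm_ge.
Qed.

(** [D] may depend on [g] but not on the ladder: it absorbs the loss under convex combinations and
    is negligible against N (r - 1) on long ladders. The bound r <= 2 keeps that loss independent of
    r. *)
Definition log_growth : set L :=
  [set g : L | exists D : R, forall (r c : R) (N : nat) (A : set T),
    1 < r -> r <= 2 -> 0 < c -> measurable A ->
    (\int[mu]_(t in A) (Num.min `|g t| (c * r ^+ N))%:E <=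
     c%:E * mu A + (N%:R * (r - 1) + D)%:E)%E].

(* Bernoulli: dividing the truncation level by s costs e further steps of the
   geometric ladder, with e (r - 1) bounded independently of r. *)
Lemma geometric_steps (s r : R) : 0 < s -> 1 < r -> r <= 2 ->
  exists e : nat, s^-1 <= r ^+ e /\ e%:R * (r - 1) <= s^-1 + 1.
Proof.
move=> s0 r1 r2.
have r10 : 0 < r - 1 by rewrite subr_gt0.
have x0 : 0 <= s^-1 / (r - 1) by rewrite divr_ge0 ?invr_ge0 ?ltW.
have /andP[lo hi] := truncn_itv x0.
exists (Num.truncn (s^-1 / (r - 1))).+1; split.
  move: hi; rewrite ltr_pdivrMr// => /ltW/le_trans; apply.
  move: (_.+1) => e; elim: e => [|e IH]; first by rewrite mul0r expr0.
  rewrite exprSr -natr1 mulrDl mul1r -[leRHS](subrK (r ^+ e)) [leRHS]addrC lerD//.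
  by rewrite -{2}[r ^+ e]mulr1 -mulrBr ler_peMl ?(ltW r10)// exprn_ege1// ltW.
rewrite -natr1 mulrDl mul1r lerD//; last by rewrite lerBlDr.
by rewrite -ler_pdivlMr.
Qed.

(** Truncating a g1 + (1 - a) g2 at M is dominated by truncating g1 at M / a and g2 at M / (1 - a):
    if one of them is cut, its weighted cut already reaches M; otherwise the triangle inequality
    applies. Raising the levels takes [e1] and [e2] further rungs, whose cost goes into the new [D].
    The end points a = 0 and a = 1 are treated apart because of the divisions. *)
Lemma log_growth_convex : @convex_set R (convex_lmodType L) log_growth.
Proof.
move=> g1 g2 s; rewrite !inE => -[D1 H1] [D2 H2].
have : 0 <= s%:inum :> R by [].
have : s%:inum <= 1 :> R by [].
set a : R := s%:inum => a1 a0.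
have -> : (conv s g1 g2 : L) = a *: (g1 : L) + (1 - a) *: (g2 : L) by [].
have [->|an0] := eqVneq a 0.
  by rewrite scale0r add0r subr0 scale1r; exists D2.
have [->|an1] := eqVneq a 1.
  by rewrite subrr scale0r addr0 scale1r; exists D1.
have {}a0 : 0 < a by rewrite lt_def an0.
have {}a1 : 0 < 1 - a by rewrite subr_gt0 lt_def eq_sym an1.
exists (a * (a^-1 + 1 + D1) + (1 - a) * ((1 - a)^-1 + 1 + D2)) => r c N A r1 r2 c0 mA.
have [e1 [e1r e1b]] := geometric_steps a0 r1 r2.
have [e2 [e2r e2b]] := geometric_steps a1 r1 r2.
have := H1 r c (N + e1)%N A r1 r2 c0 mA.
have := H2 r c (N + e2)%N A r1 r2 c0 mA.
have rp : 0 < r by exact: lt_trans r1.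
have cr n : 0 <= c * r ^+ n by rewrite mulr_ge0 ?exprn_ge0 ?ltW.
have key (x y : R) : Num.min `|a * x + (1 - a) * y| (c * r ^+ N) <=
    a * Num.min `|x| (c * r ^+ (N + e1)) + (1 - a) * Num.min `|y| (c * r ^+ (N + e2)).
  have tri : `|a * x + (1 - a) * y| <= a * `|x| + (1 - a) * `|y|.
    by rewrite (le_trans (ler_normD _ _))// !normrM (gtr0_norm a0) (gtr0_norm a1).
  have p1 : 0 <= Num.min `|x| (c * r ^+ (N + e1)) by rewrite le_min normr_ge0/=.
  have p2 : 0 <= Num.min `|y| (c * r ^+ (N + e2)) by rewrite le_min normr_ge0/=.
  have big b e : 0 < b -> b^-1 <= r ^+ e -> c * r ^+ N <= b * (c * r ^+ (N + e)).
    move=> b0 be; rewrite exprD !mulrA -[b * c]mulrC -!mulrA ler_wpM2l ?(ltW c0)//.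
    have rN : 0 <= r ^+ N by rewrite exprn_ge0// ltW.
    by rewrite mulrCA ler_peMr// -ler_pdivrMl// mulr1.
  have q1 := big _ _ a0 e1r; have q2 := big _ _ a1 e2r.
  have ap1 : 0 <= a * Num.min `|x| (c * r ^+ (N + e1)) by rewrite mulr_ge0// ltW.
  have ap2 : 0 <= (1 - a) * Num.min `|y| (c * r ^+ (N + e2)) by rewrite mulr_ge0// ltW.
  rewrite ge_min; have [h1|h1] := leP `|x| (c * r ^+ (N + e1)); last first.
    by apply/orP; right; rewrite (le_trans q1)// lerDl.
  have [h2|h2] := leP `|y| (c * r ^+ (N + e2)); last first.
    by apply/orP; right; rewrite (le_trans q2)// lerDr mulr_ge0// ltW.
  by rewrite tri.
move=> B2 B1.
have mm (g : L) e (D : set T) :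
    measurable_fun D (fun t => (Num.min `|g t| (c * r ^+ e))%:E).
  by apply/measurable_EFinP; exact: measurable_minr_cst.
have p0 (g : L) e t : (0 <= (Num.min `|g t| (c * r ^+ e))%:E)%E.
  by rewrite lee_fin le_min normr_ge0/=.
apply: (@le_trans _ _ (a%:E * \int[mu]_(t in A) (Num.min `|g1 t| (c * r ^+ (N + e1)))%:E +
   (1 - a)%:E * \int[mu]_(t in A) (Num.min `|g2 t| (c * r ^+ (N + e2)))%:E)%E).
  rewrite -!ge0_integralZl ?lee_fin ?(ltW a0) ?(ltW a1)//; try exact: mm.
  rewrite -ge0_integralD//.
  - apply: ge0_le_integral => //.
    + by apply: emeasurable_funD; apply: measurable_funeM; exact: mm.
    + move=> t _; have := key (weakL1_mfun g1 t) (weakL1_mfun g2 t).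
      by rewrite -lee_fin EFinD !EFinM.
  - by move=> t _; apply: mule_ge0; [rewrite lee_fin ltW|exact: p0].
  - by apply: measurable_funeM; exact: mm.
  - by move=> t _; apply: mule_ge0; [rewrite lee_fin ltW|exact: p0].
  - by apply: measurable_funeM; exact: mm.
have a0' : (0 <= a%:E)%E by rewrite lee_fin ltW.
have a1' : (0 <= (1 - a)%:E)%E by rewrite lee_fin ltW.
apply: (le_trans (leeD (lee_wpmul2l a0' B1) (lee_wpmul2l a1' B2))).
have [->|muA] := eqVneq (mu A) +oo%E.
  by rewrite [X in (_ <= X + _)%E]gt0_muley ?lte_fin// addye// leey.
have mf : mu A \is a fin_num by rewrite ge0_fin_numE// ltey.
rewrite -(fineK mf); move: (fine _) => m; rewrite -!(EFinM, EFinD) lee_fin.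
have -> : a * (c * m + ((N + e1)%:R * (r - 1) + D1)) +
  (1 - a) * (c * m + ((N + e2)%:R * (r - 1) + D2)) =
  c * m + (N%:R * (r - 1) + (a * (e1%:R * (r - 1) + D1) + (1 - a) * (e2%:R * (r - 1) + D2))).
  by rewrite !natrD; lra.
by rewrite !lerD2l; apply: lerD; (apply: ler_wpM2l; [exact: ltW|rewrite lerD2r]).
Qed.

Lemma weak_hull_log_growth : @weak_hull d T R mu `<=` log_growth.
Proof.
apply: smallest_sub; first exact: log_growth_convex.
move=> f f1; exists 0 => r c N A r1 r2 c0 mA; rewrite addr0.
by apply: le_integral_min_weak => //; exact: ltW.
Qed.

(** The tool for lower bounds on the gauge: for t above it, some s < t puts g / s in the hull, and
    |g / t| <= |g / s|. *)
Lemma weak_gauge_growth (g : L) (t : R) : weak_gauge g < t ->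
  exists D : R, forall (r c : R) (N : nat) (A : set T),
    1 < r -> r <= 2 -> 0 < c -> measurable A ->
    (\int[mu]_(x in A) (Num.min `|t^-1 * g x| (c * r ^+ N))%:E <=
     c%:E * mu A + (N%:R * (r - 1) + D)%:E)%E.
Proof.
move=> gt.
have [s [s0 Hs] st] := inf_lt (gauge_set_neq0 g) gt.
have [D HD] := weak_hull_log_growth Hs; exists D => r c N A r1 r2 c0 mA.
apply: le_trans (HD r c N A r1 r2 c0 mA); apply: ge0_le_integral => //.
- move=> x _; rewrite lee_fin le_min normr_ge0/= mulr_ge0 ?exprn_ge0 ?ltW//.
  exact: lt_trans r1.
- apply/measurable_EFinP/measurable_funTS/measurable_minr => //.
  by apply: measurableT_comp => //; exact: measurable_funM.
- by apply/measurable_EFinP; exact: measurable_minr_cst.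
- move=> x _; rewrite lee_fin le_min !ge_min lexx orbT andbT.
  apply/orP; left; change (`|t^-1 * g x| <= `|s^-1 * g x|).
  rewrite !normrM ler_wpM2r// !gtr0_norm ?invr_gt0//; last exact: lt_trans st.
  by rewrite lef_pV2 ?posrE//; [exact: ltW|exact: lt_trans st].
Qed.

End hull_growth.

(** * The gauge against the quasi-norm, and on finite sums *)

Section gauge_qnorm.
Context d (T : measurableType d) (R : realType).
Variable mu : {measure set T -> \bar R}.
Local Notation L := (weakL1 mu).

Lemma weak_gauge_le_qnorm (f : L) (K : R) : 0 < K ->
  (weak_qnorm mu f <= K%:E)%E -> weak_gauge f <= K.
Proof.
move=> K0 fK; apply: weak_gauge_le => //; apply: sub_gen_smallest => /=.
apply/weak_qnorm_leP => c c0 /=.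
rewrite (_ : [set _ | _] = [set t | c * K < `|f t|]); last first.
  apply/seteqP; split => t /=;
  by rewrite normrM normfV (gtr0_norm K0) ltr_pdivlMl// [K * c]mulrC.
rewrite -(@lee_pmul2l _ K%:E)// muleA -EFinM mule1 mulrC.
by apply: le_trans (weak_qnorm_ge _ _ _) fK; exact: mulr_gt0.
Qed.

Lemma weakL1_sumE (I : Type) (s : seq I) (f : I -> L) t :
  (\sum_(i <- s) f i) t = \sum_(i <- s) f i t.
Proof.
elim: s => [|i s IH]; first by rewrite !big_nil.
by rewrite !big_cons weakL1D IH.
Qed.

Lemma weak_gauge_sum (I : Type) (s : seq I) (f : I -> L) :
  weak_gauge (\sum_(i <- s) f i) <= \sum_(i <- s) weak_gauge (f i).
Proof.
elim: s => [|i s IH].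
  by rewrite !big_nil weak_gauge_null//; exact: aeW.
by rewrite !big_cons (le_trans (weak_gaugeD _ _))// lerD2l.
Qed.

End gauge_qnorm.

(** * Bounded functions have gauge zero *)

Section bounded_null.
Variable R : realType.
Local Notation mu := (lebesgue_unit R).
Local Notation L := (weakL1 mu).

Lemma count_succ_lt (X : R) (n : nat) : 0 <= X ->
  \sum_(i < n) (i.+1%:R < X)%R%:R <= X.
Proof.
move=> X0; elim: n => [|n IH]; first by rewrite big_ord0.
have [nX|Xn] := ltP n.+1%:R X; last first.
  by rewrite big_ord_recr/= ltNge Xn/= addr0.
apply: le_trans (ltW nX); rewrite -[leRHS]mulr1 -[in leRHS](card_ord n.+1).
rewrite mulr_natl -sumr_const; apply: ler_sum => i _.
by case: (_ < X).
Qed.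

Section shifts.
Variable n : nat.
Let N := n.+1.
Let I (i : 'I_N) : set (measurableTypeR R) := [set` `[i%:R / N%:R, i.+1%:R / N%:R[%R].
(** A cyclic shift of the step function with values N, N/2, ..., N/N on cells of length 1/N, a
    discrete 1/t; addition in ['I_N] is modulo N. Each shift has quasi-norm at most 1, while the sum
    of all N of them is constant on [0, 1[, namely N times the harmonic sum. *)
Let g (j : 'I_N) (t : measurableTypeR R) : R :=
  \sum_(i < N) N%:R / (i + j : 'I_N)%R.+1%:R * \1_(I i) t.

Let mg j : measurable_fun setT (g j).
Proof.
apply: measurable_sum => i; apply: measurable_funM => //.
by apply: measurable_indic; exact: measurable_itv.
Qed.

HB.instance Definition _ j := @isMeasurableFun.Build _ _ _ _ (g j) (mg j).

Let I_disj i k t : I i t -> I k t -> i = k.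
Proof.
rewrite /I /= !in_itv/= => /andP[a1 a2] /andP[b1 b2].
have N0 : 0 < N%:R^-1 :> R by rewrite invr_gt0.
have := le_lt_trans a1 b2; have := le_lt_trans b1 a2.
by rewrite !ltr_pM2r// !ltr_nat !ltnS => ki ik; apply/val_inj/anti_leq; rewrite ki ik.
Qed.

Let gE i j t : I i t -> g j t = N%:R / (i + j : 'I_N)%R.+1%:R.
Proof.
move=> It; rewrite /g (bigD1 i)//= indicE mem_set// mulr1 big1 ?addr0// => k ki.
rewrite indicE memNset ?mulr0// => Ik; move/negP: ki; apply; apply/eqP.
exact: I_disj Ik It.
Qed.

Let g_out j t : (forall i, ~ I i t) -> g j t = 0.
Proof. by move=> It; rewrite /g big1// => i _; rewrite indicE memNset ?mulr0. Qed.

Let lamI i : (mu (I i) <= N%:R^-1%:E)%E.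
Proof.
rewrite /mu /lebesgue_unit /= /mrestr.
apply: (@le_trans _ _ (@lebesgue_measure R (I i))).
  apply: le_measure; rewrite ?inE.
  - by apply: measurableI; exact: measurable_itv.
  - exact: measurable_itv.
  - exact: subIsetl.
rewrite /I lebesgue_measure_itv/= lte_fin ltr_pM2r ?invr_gt0// ltr_nat ltnSn.
by rewrite -EFinD lee_fin -mulrBl -natr1 addrAC subrr add0r mul1r.
Qed.

Let g_qnorm j : (weak_qnorm mu (g j) <= 1)%E.
Proof.
apply/weak_qnorm_leP => c c0.
pose B (i : 'I_N) := if (c < N%:R / (i + j : 'I_N)%R.+1%:R)%R then I i else set0.
have mB i : measurable (B i) by rewrite /B; case: ifP => // _; exact: measurable_itv.
apply: (@le_trans _ _ (c%:E * \sum_(i < N) mu (B i))%E).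
  apply: lee_wpmul2l; first by rewrite lee_fin ltW.
  apply: (@le_trans _ _ (mu (\big[setU/set0]_(i < N) B i))); last first.
    suff [] : measurable (\big[setU/set0]_(i < N) B i) /\
        (mu (\big[setU/set0]_(i < N) B i) <= \sum_(i < N) mu (B i))%E by [].
    elim/big_rec2 : _ => [|i x X _ [mX Xx]]; first by rewrite measure0.
    split; first exact: measurableU.
    by apply: le_trans (measureU2 mu (mB i) mX) _; exact: leeD.
  apply: le_measure; rewrite ?inE.
  - exact: measurable_level.
  - exact: bigsetU_measurable.
  - move=> t /= ct; rewrite -bigcup_seq.
    have [[i Ii]|nI] := pselect (exists i, I i t); last first.
      by move: ct; rewrite g_out ?normr0 ?ltNge ?(ltW c0)// => i Ii; apply: nI; exists i.
    exists i; first by rewrite /= mem_index_enum.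
    by move: ct; rewrite (gE _ Ii) ger0_norm ?divr_ge0// /B => ->.
apply: (@le_trans _ _ (c%:E * \sum_(i < N) ((N%:R^-1 * (c < N%:R / (i + j : 'I_N)%R.+1%:R)%R%:R)%:E))%E).
  apply: lee_wpmul2l; first by rewrite lee_fin ltW.
  apply: lee_sum => i _; rewrite /B; case: ifP => _; first by rewrite mulr1.
  by rewrite measure0 mulr0.
rewrite sumEFin -mulr_sumr -EFinM lee_fin.
(* The shift permutes the values, so it suffices to count the i with i.+1 < N / c. *)
rewrite (reindex_inj (addIr (- j))).
under eq_bigr do rewrite subrK.
rewrite mulrCA ler_pdivrMl// mulr1 mulrC -ler_pdivlMr//.
apply: le_trans (@count_succ_lt (N%:R / c) N _); last by rewrite divr_ge0// ltW.
by apply: ler_sum => i _; rewrite !ltr_pdivlMr// mulrC.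
Qed.

Let gL_subproof j : (g j : {mfun measurableTypeR R >-> R}) \in weakL1_pred mu.
Proof. by rewrite inE/=; apply: le_lt_trans (g_qnorm j) _; exact: ltry. Qed.

Let gL j : L := WeakL1 (gL_subproof j).

Let gL_sum t : 0 <= t -> t < 1 -> (\sum_(j < N) gL j) t = N%:R * \sum_(i < N) i.+1%:R^-1.
Proof.
move=> t0 t1; rewrite weakL1_sumE.
have tN0 : 0 <= t * N%:R by rewrite mulr_ge0.
have /andP[lo hi] := truncn_itv tN0.
have iN : (Num.truncn (t * N%:R) < N)%N.
  by rewrite -(ltr_nat R); apply: le_lt_trans lo _; rewrite gtr_pMl.
pose i := Ordinal iN.
have Ii : I i t by rewrite /I/= in_itv/= ler_pdivrMr// lo ltr_pdivlMr.
have gLE j : gL j t = N%:R / (i + j : 'I_N)%R.+1%:R by exact: gE.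
under eq_bigr do rewrite gLE.
by rewrite -mulr_sumr [in RHS](reindex_inj (addrI i)).
Qed.

(** With H the harmonic sum, |f| is dominated by M / (N H) times the sum of the N shifts, each of
    gauge at most 1. *)
Lemma weak_gauge_bounded_harmonic (f : L) (M : R) : 0 <= M ->
  (forall t, `|f t| <= M) -> weak_gauge f * \sum_(i < n.+1) i.+1%:R^-1 <= M.
Proof.
move=> M0 fM.
set H := \sum_(i < n.+1) _.
have H0 : 0 < H.
  rewrite /H big_ord_recl ltr_pwDl// ?invr1//; first by apply: sumr_ge0.
rewrite -ler_pdivlMr//.
pose u : L := (M / (N%:R * H)) *: \sum_(j < N) gL j.
have uE t : u t = M / (N%:R * H) * (\sum_(j < N) gL j) t by [].
have k0 : 0 <= M / (N%:R * H) by rewrite divr_ge0// mulr_ge0// ltW.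
have fu : weak_gauge f <= weak_gauge u + weak_gauge (0 : L).
  (* The zero second summand turns this into monotonicity almost everywhere; the cells miss the
     point 1 of [0, 1]. *)
  apply: le_weak_gaugeD.
  exists (~` `[0, 1[); split.
  - by apply: measurableC; exact: measurable_itv.
  - rewrite /mu /lebesgue_unit /= /mrestr.
    rewrite (_ : _ `&` _ = [set 1]) ?lebesgue_measure_set1//.
    apply/seteqP; split => t /=; rewrite !in_itv/=.
      move=> [h /andP[t0 t1]]; apply/eqP; rewrite eq_le t1/= leNgt; apply/negP => t1'.
      by apply: h; rewrite t0.
    by move=> ->; rewrite ltxx lexx ler01 andbF; split.
  - move=> t h; rewrite /= in_itv/= => /andP[t0 t1]; apply: h.
    change (`|f t| <= `|u t| + `|(0 : L) t|).
    rewrite uE gL_sum// -/H normr0 addr0 divfK ?(ger0_norm M0)//.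
    by rewrite mulf_neq0 ?gt_eqF.
apply: le_trans fu _; rewrite [X in _ + X]weak_gauge_null ?addr0; last exact: aeW.
rewrite weak_gaugeZ (ger0_norm k0).
apply: (@le_trans _ _ (M / (N%:R * H) * N%:R)).
  apply: ler_wpM2l => //; apply: le_trans (weak_gauge_sum _ _) _.
  rewrite -[leRHS]mulr1 -[in leRHS](card_ord N) mulr_natl -sumr_const.
  by apply: ler_sum => j _; apply: weak_gauge_le_qnorm => //; exact: g_qnorm.
by rewrite [N%:R * H]mulrC invfM mulrA divfK// pnatr_eq0.
Qed.

End shifts.

Lemma weak_gauge_bounded (f : L) (M : R) : (forall t, `|f t| <= M) -> weak_gauge f = 0.
Proof.
move=> fM; have M0 : 0 <= M by exact: le_trans (fM 0).
apply/eqP; rewrite eq_le weak_gauge_ge0 andbT leNgt; apply/negP => f0.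
(* A positive gauge would bound the harmonic partial sums by [M / weak_gauge f]. *)
apply: (@dvg_harmonic R); apply: nondecreasing_is_cvgn.
  by apply: nondecreasing_series => i _ _; exact: harmonic_ge0.
exists (M / weak_gauge f) => _ [n _ <-].
rewrite ler_pdivlMr// mulrC.
case: n => [|n]; first by rewrite /series/= big_geq// mulr0.
by rewrite /series/= big_mkord; exact: weak_gauge_bounded_harmonic.
Qed.

End bounded_null.

(** * Affine changes of variable for Lebesgue measure *)

Section affine.
Variable R : realType.
Local Notation X := (measurableTypeR R).
Local Notation lam := (@lebesgue_measure R).

Definition affine (a b : R) (t : X) : X := a * t + b.

Lemma measurable_affine a b : measurable_fun setT (affine a b).
Proof.
by apply: measurable_funD => //; apply: measurable_funM => //; exact: measurable_cst.
Qed.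

HB.instance Definition _ a b :=
  @isMeasurableFun.Build _ _ _ _ (affine a b) (measurable_affine a b).

Lemma lebesgue_measure_affine (a b : R) (A : set X) : 0 < a -> measurable A ->
  (a%:E * lam (affine a b @^-1` A) = lam A)%E.
Proof.
move=> a0 mA.
(* By uniqueness of Lebesgue measure, it is enough to compare the scaled push-forward with it on the
   intervals ]x, y]. *)
pose m0 : {measure set X -> \bar R} := mscale (NngNum (ltW a0)) (pushforward lam (affine a b)).
pose m := m0 (measurable_affine a b).
transitivity (m A); first by [].
apply/esym/lebesgue_measure_unique => //= _ [[x y]] _ <-.
rewrite /m /m0 /= /mscale/=.
rewrite /pushforward.
have -> : affine a b @^-1` `]x, y]%classic = `](x - b) / a, (y - b) / a]%classic.
  apply/seteqP; split => t /=; rewrite !in_itv/= /affine;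
  by rewrite ltr_pdivrMr// ler_pdivlMr// ltrBlDr lerBrDr mulrC.
rewrite !lebesgue_measure_itv/= !lte_fin ltr_pM2r ?invr_gt0// ltrD2r.
case: ifP => _; last by rewrite mule0.
rewrite -!EFinD -EFinM -mulrBl; congr EFin.
by rewrite mulrCA mulfV ?gt_eqF// mulr1 opprB addrA subrK.
Qed.

Lemma ge0_integral_affine (a b : R) (A : set X) (f : X -> \bar R) : 0 < a ->
  measurable A -> measurable_fun setT f -> (forall x, 0 <= f x)%E ->
  (a%:E * \int[lam]_(t in affine a b @^-1` A) f (affine a b t) = \int[lam]_(t in A) f t)%E.
Proof.
move=> a0 mA mf f0.
have mfA : measurable_fun A f by exact: measurable_funTS.
rewrite -(@ge0_integral_pushforward _ _ _ _ _ _ (measurable_affine a b) lam A f)//.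
rewrite -[a%:E]/((NngNum (ltW a0))%:num%:E) -ge0_integral_mscale//.
apply: eq_measure_integral => B mB BA.
exact: lebesgue_measure_affine.
Qed.

Lemma ge0_integral_half_line (A : set X) (f : X -> \bar R) :
  A `<=` `[0, +oo[ -> (\int[lebesgue_half_line R]_(t in A) f t = \int[lam]_(t in A) f t)%E.
Proof.
move=> A0; apply: eq_measure_integral => B mB BA.
by rewrite /lebesgue_half_line /= /mrestr setIidl//; exact: subset_trans A0.
Qed.

Lemma ge0_integral_unit (A : set X) (f : X -> \bar R) :
  A `<=` `[0, 1] -> (\int[lebesgue_unit R]_(t in A) f t = \int[lam]_(t in A) f t)%E.
Proof.
move=> A0; apply: eq_measure_integral => B mB BA.
by rewrite /lebesgue_unit /= /mrestr setIidl//; exact: subset_trans A0.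
Qed.

End affine.

(** * A telescoping sum over decreasing levels *)

Section telescope.
Variable R : realType.

(** The levels below [y] form a tail of the sequence, so the sum telescopes to at most the first
    level below [y]. *)
Lemma telescope_level_le (s : nat -> R) (y : R) (N : nat) :
  (forall j, s j.+1 <= s j) -> (forall j, 0 <= s j) -> 0 <= y ->
  \sum_(j < N) (s j - s j.+1) * (s j < y)%R%:R <= y.
Proof.
elim: N s => [|N IH] s sd s0 y0; first by rewrite big_ord0.
have [sy|ys] := ltP (s 0) y; last first.
  rewrite big_ord_recl/= ltNge ys mulr0 add0r.
  by apply: (IH (fun j => s j.+1)).
apply: (@le_trans _ _ (\sum_(0 <= j < N.+1) (s j - s j.+1))).
  rewrite big_mkord; apply: ler_sum => j _.
  by case: (_ < _); rewrite ?mulr1// mulr0 subr_ge0.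
rewrite -[leLHS]opprK -sumrN (eq_bigr (fun j => s j.+1 - s j)); last first.
  by move=> j _; rewrite opprB.
by rewrite telescope_sumr// opprB (le_trans _ (ltW sy))// lerBlDr lerDl.
Qed.

End telescope.

(** * Ladders of blocks in [0, 1], and the gauge of a glued function *)

Section blocks.
Variables (R : realType) (k K : nat -> nat).
Hypotheses (k_gt0 : forall n, (0 < k n)%N) (K_gt0 : forall n, (0 < K n)%N).
Local Notation X := (measurableTypeR R).
Local Notation lam := (@lebesgue_measure R).

(* Block n is written on a ladder of [steps n] cells: cell (n, j) is [0, k n[
   scaled by width (n, j), and carries values bounded by K n divided by
   level n j.  The blocks accumulate at 0, and the factor K m * k m.+1 * m.+2
   in [top] makes the values of block m negligible against those of block m.+1. *)
Definition ratio (n : nat) : R := 1 + n.+1%:R^-1.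
Definition steps (n : nat) : nat := (n.+1 ^ 2 * (K n * k n))%N.
Fixpoint top (n : nat) : R :=
  if n is m.+1 then top m / ratio m ^+ steps m / (K m * (k m.+1 * m.+2))%:R
  else (k 0)%:R^-1.
Definition level (n j : nat) : R := top n / ratio n ^+ j.
Definition width (i : nat * nat) : R := level i.1 i.2 - level i.1 i.2.+1.
Definition coord (i : nat * nat) : X -> X :=
  affine (width i)^-1 (- ((k i.1)%:R * level i.1 i.2.+1 / width i)).
Definition cell (i : nat * nat) : set X :=
  [set t | (i.2 < steps i.1)%N /\ coord i t \in `[0, (k i.1)%:R[].

Lemma ratio_gt1 n : 1 < ratio n.
Proof. by rewrite ltrDl invr_gt0. Qed.

Lemma ratio_gt0 n : 0 < ratio n.
Proof. exact: lt_trans (ratio_gt1 n). Qed.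

Lemma ratio_le2 n : ratio n <= 2.
Proof. by rewrite lerD2l invf_le1// ler1n. Qed.

Lemma top_gt0 n : 0 < top n.
Proof.
elim: n => [|n IH] /=; first by rewrite invr_gt0 ltr0n.
rewrite divr_gt0//; first by rewrite divr_gt0// exprn_gt0// ratio_gt0.
by rewrite ltr0n !muln_gt0 K_gt0 k_gt0.
Qed.

Lemma level_gt0 n j : 0 < level n j.
Proof. by rewrite divr_gt0 ?top_gt0 ?exprn_gt0 ?ratio_gt0. Qed.

Lemma levelS n j : level n j = level n j.+1 * ratio n.
Proof.
rewrite /level exprSr invfM mulrA divfK// gt_eqF//; exact: ratio_gt0.
Qed.

Lemma level_ltS n j : level n j.+1 < level n j.
Proof. by rewrite [ltRHS]levelS ltr_pMr ?level_gt0// ratio_gt1. Qed.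

Lemma level_le n i j : (i <= j)%N -> level n j <= level n i.
Proof.
elim: j => [|j IH]; first by rewrite leqn0 => /eqP ->.
rewrite leq_eqVlt => /predU1P[->//|]; rewrite ltnS => /IH.
by apply: le_trans; exact/ltW/level_ltS.
Qed.

Lemma level0 n : level n 0 = top n.
Proof. by rewrite /level expr0 invr1 mulr1. Qed.

Lemma width_gt0 i : 0 < width i.
Proof. by rewrite subr_gt0 level_ltS. Qed.

Lemma k1 n : 1 <= (k n)%:R :> R.
Proof. by rewrite ler1n. Qed.

(** The left side is the length of the initial interval holding block n.+1 and all later ones. On
    the right, [K n] offsets the bound on block n, and [n.+2] makes the error in
    [weak_qnorm_glue_le] tend to 0. *)
Lemma top_next n : (k n.+1)%:R * top n.+1 = level n (steps n) / ((K n)%:R * n.+2%:R).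
Proof.
rewrite /= -/(level n (steps n)) !natrM.
rewrite (mulrCA (K n)%:R (k n.+1)%:R) invfM mulrCA mulVKf//.
by rewrite gt_eqF// ltr0n.
Qed.

Lemma top_next_le n : (k n.+1)%:R * top n.+1 <= level n (steps n).
Proof.
rewrite top_next ler_pdivrMr; last by rewrite mulr_gt0// ltr0n.
rewrite ler_peMr ?(ltW (level_gt0 _ _))//.
by rewrite -natrM ler1n muln_gt0 K_gt0.
Qed.

Lemma top_le_ktop n : top n <= (k n)%:R * top n.
Proof. by rewrite ler_peMl ?k1// ltW// top_gt0. Qed.

Lemma top_le_level m n : (m < n)%N -> (k n)%:R * top n <= level m (steps m).
Proof.
elim: n => // n IH; rewrite ltnS leq_eqVlt => /predU1P[->|/IH mn].
  exact: top_next_le.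
apply: le_trans mn; apply: le_trans (top_next_le n) _.
by apply: le_trans (top_le_ktop n); rewrite -[leRHS]level0; exact: level_le.
Qed.

Lemma coord_itv i t : (coord i t \in `[0, (k i.1)%:R[) =
  ((k i.1)%:R * level i.1 i.2.+1 <= t < (k i.1)%:R * level i.1 i.2).
Proof.
rewrite in_itv/= /coord /affine mulrC -mulrBl.
rewrite ler_pdivlMr ?width_gt0// mul0r subr_ge0.
rewrite ltr_pdivrMr ?width_gt0// ltrBlDr /width mulrBr subrK.
by [].
Qed.

Lemma cell_lt_next n j m t : (n < m)%N -> cell (n, j) t -> (k m)%:R * top m <= t.
Proof.
move=> nm [/= jN]; rewrite coord_itv/= => /andP[h _].
apply: le_trans h; apply: le_trans (top_le_level nm) _.
apply: (@le_trans _ _ (level n j.+1)); first exact: level_le.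
by rewrite ler_peMl ?k1// ltW// level_gt0.
Qed.

Lemma cell_lt_top n j t : cell (n, j) t -> t < (k n)%:R * top n.
Proof.
move=> [/= jN]; rewrite coord_itv/= => /andP[_ h].
apply: lt_le_trans h _; rewrite ler_pM2l ?ltr0n// -level0; exact: level_le.
Qed.

Lemma cell_inj i i' t : cell i t -> cell i' t -> i = i'.
Proof.
move: i i' => [n j] [n' j'].
wlog nn : n j n' j' / (n <= n')%N.
  have [nn|/ltnW nn] := leqP n n' => h ? ?; first exact: h.
  by apply/esym; exact: h.
move: nn; rewrite leq_eqVlt => /predU1P[<-|nn] H H'; last first.
  by have := cell_lt_top H'; rewrite ltNge (cell_lt_next nn H).
have lt_absurd a b : (a < b)%N -> cell (n, a) t -> cell (n, b) t -> False.
  move=> ab [_ ]; rewrite coord_itv/= => /andP[h1 _] [_].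
  rewrite coord_itv/= => /andP[_ h2]; have := le_lt_trans h1 h2.
  by rewrite ltr_pM2l ?ltr0n// ltNge level_le.
have [/lt_absurd|/lt_absurd|->//] := ltngtP j j'.
  by move=> /(_ H H').
by move=> /(_ H' H).
Qed.

Lemma measurable_cell i : measurable (cell i).
Proof.
have [h|h] := boolP (i.2 < steps i.1)%N; last first.
  by rewrite (_ : cell i = set0)//; apply/seteqP; split => t //= -[]; rewrite (negbTE h).
rewrite (_ : cell i = coord i @^-1` `[0, (k i.1)%:R[%classic).
  rewrite -[X in measurable X]setTI; apply: measurable_affine => //; exact: measurable_itv.
by apply/seteqP; split => t /=; rewrite /cell/= h//; case.
Qed.

Definition cell_index (t : X) : option (nat * nat) :=
  if pselect (exists i, cell i t) is left H then Some (projT1 (cid H)) else None.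

Lemma cell_index_some i t : cell i t -> cell_index t = Some i.
Proof.
move=> Ci; rewrite /cell_index; case: pselect => [H|[]]; last by exists i.
by congr Some; apply: cell_inj Ci; exact: projT2 (cid H).
Qed.

Lemma cell_indexP t : (exists2 i, cell_index t = Some i & cell i t) \/
  (cell_index t = None /\ forall i, ~ cell i t).
Proof.
rewrite /cell_index; case: pselect => [H|H]; last by right; split=> // i Ci; apply: H; exists i.
by left; exists (projT1 (cid H)) => //; exact: projT2 (cid H).
Qed.

Definition glue_blocks (g : nat -> X -> R) (t : X) : R :=
  if cell_index t is Some i then g i.1 (coord i t) / level i.1 i.2 else 0.

Lemma glue_cell g i t : cell i t -> glue_blocks g t = g i.1 (coord i t) / level i.1 i.2.
Proof. by move=> /cell_index_some; rewrite /glue_blocks => ->. Qed.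

Lemma measurable_glue g : (forall n, measurable_fun setT (g n)) ->
  measurable_fun setT (glue_blocks g).
Proof.
move=> mg _ B mB; rewrite setTI.
pose G (i : nat * nat) (t : X) := g i.1 (coord i t) / level i.1 i.2.
have mG i : measurable_fun setT (G i).
  apply: measurable_funM; last exact: measurable_cst.
  by apply: measurableT_comp => //; exact: measurable_affine.
have -> : glue_blocks g @^-1` B = (\bigcup_i (cell i `&` G i @^-1` B)) `|`
    (if 0 \in B then ~` \bigcup_i cell i else set0).
  apply/seteqP; split => t /=.
    have [[i ti Ci]|[ti nC]] := cell_indexP t; rewrite /glue_blocks ti => Bt.
      by left; exists i.
    by right; rewrite mem_set// => -[i _]; exact: nC.
  case=> [[i _ [Ci]]|]; first by rewrite /= (glue_cell _ Ci).
  case: ifPn => //; rewrite inE => B0 nC.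
  have [[i ti Ci]|[ti _]] := cell_indexP t; first by exfalso; apply: nC; exists i.
  by rewrite /glue_blocks ti.
apply: measurableU.
  apply: countable_bigcupT_measurable => // i; apply: measurableI; first exact: measurable_cell.
  by rewrite -[X in measurable X]setTI; exact: mG.
case: ifP => // _; apply: measurableC.
by apply: countable_bigcupT_measurable => // i; exact: measurable_cell.
Qed.

(* Cells of block n have |glue_blocks g| > c only where |g n| > c * level; summing
   over the levels telescopes to the integral of |g n| / c. *)
Lemma block_level_le (g : nat -> X -> R) n (c : R) : 0 < c ->
  (forall n, measurable_fun setT (g n)) ->
  (\sum_(j < steps n) lam (cell (n, val j) `&` [set t | (c < `|glue_blocks g t|)%R]) <=
   c^-1%:E * \int[lam]_(t in `[0%R, (k n)%:R[) `|g n t|%:E)%E.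
Proof.
move=> c0 mg.
pose I : set X := `[0%R, (k n)%:R[%classic.
have mI : measurable I by exact: measurable_itv.
have mlt (f : X -> R) (a : R) : measurable_fun setT f -> measurable [set t | a < `|f t|].
  move=> mf; have mn : measurable_fun setT (fun t => `|f t|) by exact: measurableT_comp.
  rewrite (_ : [set _ | _] = setT `&` (fun t => `|f t|) @^-1` `]a, +oo[%classic); last first.
    by rewrite setTI; apply/seteqP; split => t /=; rewrite in_itv/= andbT.
  by apply: mn => //; exact: measurable_itv.
pose S j : set X := [set t | c * level n j < `|g n t|].
have mS j : measurable (S j) by exact: mlt.
apply: (@le_trans _ _ (\sum_(j < steps n) (width (n, val j))%:E * lam (S j `&` I))%E).
  apply: lee_sum => j _.
  have w0 : 0 < (width (n, val j))^-1 by rewrite invr_gt0 width_gt0.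
  have mSI : measurable (S j `&` I) by exact: measurableI.
  rewrite -(@lebesgue_measure_affine _ _ (- ((k n)%:R * level n j.+1 / width (n, val j)))
    (S j `&` I) w0)//.
  rewrite muleA -EFinM mulfV ?gt_eqF ?width_gt0// mul1e.
  apply: le_measure; rewrite ?inE.
  - apply: measurableI; first exact: measurable_cell.
    by apply: mlt; exact: measurable_glue.
  - by rewrite -[X in measurable X]setTI; exact: measurable_affine.
  - move=> t [Ct]; rewrite /= (glue_cell _ Ct)/= normrM normfV (gtr0_norm (level_gt0 _ _)).
    by rewrite ltr_pdivlMr ?level_gt0// => h; split => //; case: Ct.
rewrite lee_pdivlMl// ge0_sume_distrr; last first.
  by move=> j _; rewrite mule_ge0// lee_fin ltW// width_gt0.
pose F j t : \bar R := ((c * width (n, j))%:E * (\1_(S j) t)%:E)%E.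
have cw0 j : 0 <= c * width (n, j) by rewrite mulr_ge0 ?ltW// width_gt0.
have F0 j t : (0 <= F j t)%E by rewrite mule_ge0// lee_fin.
have mF j (D : set X) : measurable_fun D (F j).
  by apply: measurable_funeM; apply/measurable_EFinP/measurable_funTS/measurable_indic.
apply: (@le_trans _ _ (\int[lam]_(t in I) \sum_(j < steps n) F j t)%E).
  rewrite ge0_integral_sum//; apply: lee_sum => j _.
  rewrite /F ge0_integralZl//; last by rewrite lee_fin.
    by rewrite integral_indic// EFinM muleA.
  by apply/measurable_EFinP/measurable_funTS/measurable_indic.
apply: ge0_le_integral => //.
- by move=> t _; exact: sume_ge0.
- exact: emeasurable_sum.
- by apply/measurable_EFinP/measurable_funTS; exact: measurableT_comp.
- move=> t _.
  have h1 j : c * level n j.+1 <= c * level n j by rewrite ler_pM2l// ltW// level_ltS.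
  have h2 j : 0 <= c * level n j by rewrite mulr_ge0// ltW// level_gt0.
  have := telescope_level_le (steps n) h1 h2 (normr_ge0 (g n t)).
  rewrite -lee_fin; apply: le_trans; rewrite -sumEFin; apply: lee_sum => j _.
  rewrite /F -EFinM lee_fin /width/= mulrBr indicE.
  by have [xl|xl] := ltP (c * level n j) `|g n t|;
    [rewrite mem_set|rewrite memNset// /S/= ltNge xl].
Qed.

Lemma glue_out_block (g : nat -> X -> R) t : glue_blocks g t != 0 ->
  exists2 i, cell i t & g i.1 (coord i t) != 0.
Proof.
have [[i ti Ci]|[ti _]] := cell_indexP t; rewrite /glue_blocks ti ?eqxx// => h.
by exists i => //; apply: contra_neq h => ->; rewrite mul0r.
Qed.

Lemma cell_unit i : cell i `<=` `[0, 1].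
Proof.
case: i => n j t Ct; rewrite /= in_itv/=; apply/andP; split.
  case: Ct => _; rewrite coord_itv/= => /andP[h _]; apply: le_trans h.
  by rewrite mulr_ge0// ltW// level_gt0.
apply: le_trans (ltW (cell_lt_top Ct)) _.
apply: (@le_trans _ _ ((k 0)%:R * top 0)); last by rewrite /= mulfV// gt_eqF// ltr0n.
clear Ct; elim: n => // n IH; apply: le_trans IH.
apply: le_trans (top_next_le n) (le_trans _ (top_le_ktop n)).
by rewrite -[leRHS]level0; exact: level_le.
Qed.

(** Given a level c, let [n0] be the first block whose values may exceed c. Earlier blocks
    contribute nothing, block [n0] at most B / c by [block_level_le], and all later ones lie in an
    initial interval of length at most C / (c n1.+1) by the choice of [top]. *)
Lemma weak_qnorm_glue_le (g : nat -> X -> R) (n1 : nat) (B C : R) : 0 <= B -> 0 < C ->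
  (forall n, measurable_fun setT (g n)) ->
  (forall n t, `|g n t| <= C * (K n)%:R) ->
  (forall n t, (n < n1)%N -> g n t = 0) ->
  (forall n, (n1 <= n)%N ->
    (\int[lam]_(t in `[0%R, (k n)%:R[) `|g n t|%:E <= B%:E)%E) ->
  (weak_qnorm (lebesgue_unit R) (glue_blocks g) <= (B + C / n1.+1%:R)%:E)%E.
Proof.
move=> B0 C0 mg gK g0 gB; apply/weak_qnorm_leP => c c0.
have mglue := measurable_glue mg.
pose G : {mfun X >-> R} := HB.pack (glue_blocks g) (@isMeasurableFun.Build _ _ _ _ _ mglue).
have mL : measurable [set t | c < `|glue_blocks g t|] by exact: (measurable_level G).
apply: (@le_trans _ _ (c%:E * lam [set t | (c < `|glue_blocks g t|)%R])%E).
  apply: lee_wpmul2l; first by rewrite lee_fin ltW.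
  rewrite /lebesgue_unit /= /mrestr; apply: le_measure; rewrite ?inE.
  - by apply: measurableI => //; exact: measurable_itv.
  - by [].
  - exact: subIsetl.
(* [level n (steps n)] lies below every level used in block n, so this quotient bounds the values
   there. *)
pose P n := (n1 <= n)%N && (c < C * (K n)%:R / level n (steps n)).
have PE n j t : cell (n, j) t -> c < `|glue_blocks g t| -> P n.
  move=> Ct; rewrite (glue_cell _ Ct)/= normrM normfV (gtr0_norm (level_gt0 _ _)) => h.
  apply/andP; split.
    by rewrite leqNgt; apply/negP => /g0 gn; move: h; rewrite gn normr0 mul0r ltNge ltW.
  apply: lt_le_trans h _; apply: (@le_trans _ _ (C * (K n)%:R / level n j)).
    by rewrite ler_pM2r ?invr_gt0 ?level_gt0.
  rewrite ler_pM2l ?mulr_gt0 ?ltr0n//.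
  by rewrite lef_pV2 ?posrE ?level_gt0//; apply: level_le; case: Ct => /= /ltnW.
have glueP t : c < `|glue_blocks g t| -> exists2 i, cell i t & P i.1.
  move=> ct; have [|[n j] Ct _] := @glue_out_block g t.
    by apply: contraTneq ct => ->; rewrite normr0 -leNgt ltW.
  by exists (n, j) => //; exact: PE Ct ct.
have err0 : 0 <= C / n1.+1%:R by rewrite divr_ge0// ltW.
have [[n Pn]|nP] := pselect (exists n, P n); last first.
  rewrite (_ : [set _ | _] = set0) ?measure0 ?mule0 ?lee_fin ?addr_ge0//.
  by apply/seteqP; split => t //= /glueP[i _ Pi]; apply: nP; exists i.1.
pose n0 := ex_minn (ex_intro _ n Pn).
have [Pn0 minP] : P n0 /\ forall m, P m -> (n0 <= m)%N by rewrite /n0; case: ex_minnP.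
have /andP[n10 cn0] := Pn0.
pose Bl : set X := \big[setU/set0]_(j < steps n0) (cell (n0, val j) `&` [set t | c < `|glue_blocks g t|]).
have mcl j : measurable (cell (n0, j) `&` [set t | c < `|glue_blocks g t|]).
  by apply: measurableI => //; exact: measurable_cell.
have mBl : measurable Bl by exact: bigsetU_measurable.
pose rest : set X := `[0, (k n0.+1)%:R * top n0.+1[%classic.
have mrest : measurable rest by exact: measurable_itv.
have cover : [set t | c < `|glue_blocks g t|] `<=` Bl `|` rest.
  move=> t /= ct; have [[m j] Ct Pm] := glueP t ct.
  have := minP _ Pm; rewrite leq_eqVlt => /predU1P[/= n0m|/= n0m].
    left; rewrite /Bl -(bigcup_mkord _ (fun j => cell (n0, j) `&` [set t | c < `|glue_blocks g t|])).
    exists j; first by case: Ct => /=; rewrite -n0m.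
    by split => //; rewrite n0m.
  right; rewrite /rest/= in_itv/=; apply/andP; split.
    by have := cell_unit Ct; rewrite /= in_itv/= => /andP[].
  apply: lt_le_trans (cell_lt_top Ct) _.
  move: n0m; rewrite leq_eqVlt => /predU1P[<-//|n0m].
  apply: le_trans (top_le_level n0m) _; apply: le_trans (top_le_ktop _).
  by rewrite -[leRHS]level0; exact: level_le.
have lamBl : (lam Bl <= c^-1%:E * B%:E)%E.
  apply: (@le_trans _ _ (\sum_(j < steps n0) lam (cell (n0, val j) `&` [set t | (c < `|glue_blocks g t|)%R]))%E).
    suff [] : measurable Bl /\
      (lam Bl <= \sum_(j < steps n0) lam (cell (n0, val j) `&` [set t | (c < `|glue_blocks g t|)%R]))%E by [].
    rewrite /Bl; elim/big_rec2 : _ => [|j x X _ [mX Xx]]; first by rewrite measure0.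
    split; first exact: measurableU.
    by apply: le_trans (measureU2 _ (mcl j) mX) _; exact: leeD.
  apply: le_trans (block_level_le _ c0 mg) _.
  by apply: lee_wpmul2l; [rewrite lee_fin invr_ge0 ltW|exact: gB].
have kt0 : 0 < (k n0.+1)%:R * top n0.+1 :> R by rewrite mulr_gt0 ?ltr0n ?top_gt0.
have lamr : (lam rest <= (c^-1 * (C / n1.+1%:R))%:E)%E.
  rewrite /rest lebesgue_measure_itv/= lte_fin kt0 oppr0 adde0 lee_fin top_next.
  rewrite invfM mulrA mulrA ler_pM//.
  - by rewrite divr_ge0// ltW// level_gt0.
  - have l0 := level_gt0 n0 (steps n0); have K00 : 0 < (K n0)%:R :> R by rewrite ltr0n.
    rewrite ler_pdivrMr// -mulrA ler_pdivlMl//.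
    by apply: ltW; rewrite -ltr_pdivlMr.
  - by rewrite lef_pV2 ?posrE ?ltr0n// ler_nat; exact: leqW.
apply: (@le_trans _ _ (c%:E * (c^-1%:E * B%:E + (c^-1 * (C / n1.+1%:R))%:E))%E).
  apply: lee_wpmul2l; first by rewrite lee_fin ltW.
  apply: (@le_trans _ _ (lam (Bl `|` rest))).
    by apply: le_measure; rewrite ?inE//; exact: measurableU.
  by apply: le_trans (measureU2 _ mBl mrest) _; exact: leeD.
by rewrite -!(EFinM, EFinD) lee_fin -mulrDr mulVKf// gt_eqF.
Qed.

Local Notation lu := (lebesgue_unit R).

(** Removing finitely many blocks changes [x] by a bounded function, of gauge 0. So only the
    integrals of late blocks count, and the error C / n1.+1 is as small as desired. *)
Lemma weak_gauge_glue_le (x : weakL1 lu) (g : nat -> X -> R) (B C : R) (n2 : nat) :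
  0 <= B -> 0 < C -> (forall t, x t = glue_blocks g t) ->
  (forall n, measurable_fun setT (g n)) ->
  (forall n t, `|g n t| <= C * (K n)%:R) ->
  (forall n, (n2 <= n)%N ->
    (\int[lam]_(t in `[0%R, (k n)%:R[) `|g n t|%:E <= B%:E)%E) ->
  weak_gauge x <= B.
Proof.
move=> B0 C0 xE mg gK gB.
apply/ler_addgt0Pr => e e0.
have Ce0 : 0 <= C / e by rewrite divr_ge0// ltW.
pose n1 := maxn n2 (Num.truncn (C / e)).
have err : C / n1.+1%:R <= e.
  rewrite ler_pdivrMr ?ltr0n// -ler_pdivrMl// mulrC.
  have /andP[_ /ltW h] := truncn_itv Ce0; apply: le_trans h _.
  by rewrite ler_nat ltnS leq_maxr.
pose g' n : X -> R := if (n < n1)%N then cst 0 else g n.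
have mg' n : measurable_fun setT (g' n).
  by rewrite /g'; case: ifP => _; [exact: measurable_cst|exact: mg].
have mG := measurable_glue mg'.
pose G : {mfun X >-> R} := HB.pack (glue_blocks g') (@isMeasurableFun.Build _ _ _ _ _ mG).
have qG : (weak_qnorm lu (glue_blocks g') <= (B + C / n1.+1%:R)%:E)%E.
  apply: weak_qnorm_glue_le => //.
  - move=> n t; rewrite /g'; case: ifP => _ //.
    by rewrite normr0 mulr_ge0// ltW.
  - by move=> n t nn; rewrite /g' nn.
  - move=> n nn; rewrite /g' ltnNge nn/=; apply: gB.
    by apply: leq_trans nn; exact: leq_maxl.
have GW : G \in weakL1_pred lu by rewrite inE/=; apply: le_lt_trans qG (ltry _).
pose x' : weakL1 lu := WeakL1 GW.
have -> : x = (x - x') + x' by rewrite subrK.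
apply: (le_trans (weak_gaugeD _ _)).
have [M xM] : exists M, forall t, `|(x - x') t| <= M.
  exists (\sum_(n < n1) C * (K n)%:R / level n (steps n)) => t.
  have -> : (x - x') t = glue_blocks g t - glue_blocks g' t by rewrite weakL1B xE.
  have pos n : 0 <= C * (K n)%:R / level n (steps n).
    apply: divr_ge0; first by rewrite mulr_ge0// ltW.
    exact/ltW/level_gt0.
  have [[[n j] ti Ct]|[ti _]] := cell_indexP t; last first.
    by rewrite /glue_blocks ti subrr normr0; exact: sumr_ge0.
  rewrite /glue_blocks ti -mulrBl /g'/=.
  case: ifPn => nn; last by rewrite subrr mul0r normr0; exact: sumr_ge0.
  rewrite subr0 (bigD1 (Ordinal nn))//=; apply: ler_wpDr; first exact: sumr_ge0.
  rewrite normrM normfV (gtr0_norm (level_gt0 _ _)) ler_pM ?invr_ge0//.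
    by rewrite ltW// level_gt0.
  rewrite lef_pV2 ?posrE ?level_gt0//; apply: level_le => //.
  by case: Ct => /= /ltnW.
rewrite (weak_gauge_bounded xM) add0r.
apply: (@le_trans _ _ (B + C / n1.+1%:R)); last by rewrite lerD2l.
apply: weak_gauge_le_qnorm => //.
by rewrite ltr_wpDl// divr_gt0.
Qed.

(** The growth bound is applied on block n with r = [ratio n] and N = [steps n]. Each of its N cells
    carries (1 - r^-1) times the integral of |g n|; after division by N (1 - r^-1) / tau the terms
    from c mu(A) and from the additive constant become O(1 / n.+1), uniformly in n. *)
Lemma weak_gauge_glue_ge (x : weakL1 lu) (g : nat -> X -> R) (tau : R) :
  (forall t, x t = glue_blocks g t) ->
  (forall n, measurable_fun setT (g n)) ->
  (forall n t, `|g n t| <= (K n)%:R) ->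
  weak_gauge x < tau ->
  exists2 D : R, 0 <= D & forall n,
    (\int[lam]_(t in `[0%R, (k n)%:R[) `|g n t|%:E <=
     (ratio n * (tau + D / n.+1%:R))%:E)%E.
Proof.
move=> xE mg gK xtau.
have tau0 : 0 < tau by apply: le_lt_trans xtau; exact: weak_gauge_ge0.
have [D HD] := weak_gauge_growth xtau.
(* The 1 comes from c mu(A), the other summand from the constant of the growth bound. *)
exists (1 + tau * `|D|) => [|n]; first by rewrite addr_ge0// mulr_ge0// ltW.
set I := (\int[lam]_(t in _) _)%E.
pose N := steps n; pose r := ratio n.
have r1 : 1 < r by exact: ratio_gt1.
have r0 : 0 < r by exact: ratio_gt0.
have topn := top_gt0 n.
have lev j := level_gt0 n j.
have Kn : 0 < (K n)%:R :> R by rewrite ltr0n.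
have kn : 0 < (k n)%:R :> R by rewrite ltr0n.
(* With this c the truncation level c r^N equals K n / (tau * level n N), which |x| / tau does not
   exceed on block n: nothing is cut off. *)
pose c := (K n)%:R / (top n * tau).
have c0 : 0 < c by rewrite divr_gt0// mulr_gt0.
pose A : set X := \big[setU/set0]_(j < N) cell (n, val j).
have mC j : measurable (cell (n, j)) by exact: measurable_cell.
have mA : measurable A by exact: bigsetU_measurable.
have AE t : A t -> exists2 j, (j < N)%N & cell (n, j) t.
  by rewrite /A -(bigcup_mkord _ (fun j => cell (n, j))) => -[j jN Ct]; exists j.
have A01 : A `<=` `[0, 1] by move=> t /AE[j _]; exact: cell_unit.
have lamA : (lu A <= ((k n)%:R * top n)%:E)%E.
  apply: (@le_trans _ _ (lam `[0%R, (k n)%:R * top n])).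
    rewrite /lebesgue_unit /= /mrestr; apply: le_measure; rewrite ?inE.
    - by apply: measurableI => //; exact: measurable_itv.
    - exact: measurable_itv.
    - move=> t [At] /=; rewrite !in_itv/= => /andP[-> _]/=.
      by have [j _ Ct] := AE _ At; apply: ltW; exact: cell_lt_top Ct.
  by rewrite lebesgue_measure_itv/= lte_fin mulr_gt0// oppr0 adde0.
have bound := HD r c N A r1 (ratio_le2 n) c0 mA.
have mx : measurable_fun setT x by [].
have lower : (I * ((1 - r^-1) * N%:R / tau)%:E <=
    \int[lu]_(t in A) (Num.min `|tau^-1 * x t| (c * r ^+ N))%:E)%E.
  rewrite ge0_integral_unit//.
  apply: (@le_trans _ _ (\int[lam]_(t in A) `|tau^-1 * x t|%:E)%E); last first.
    apply: ge0_le_integral => //.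
    - by apply/measurable_EFinP/measurable_funTS/measurableT_comp => //; exact: measurable_funM.
    - apply/measurable_EFinP/measurable_funTS/measurable_minr => //.
      by apply: measurableT_comp => //; exact: measurable_funM.
    - move=> t At; rewrite lee_fin le_min lexx/=.
      have [j jN Ct] := AE _ At; rewrite xE (glue_cell _ Ct)/=.
      rewrite !normrM !normfV (gtr0_norm tau0) (gtr0_norm (lev _)).
      have -> : c * r ^+ N = tau^-1 * ((K n)%:R / level n N).
        rewrite /c /level -/r !invfM invrK; lra.
      rewrite ler_pM2l ?invr_gt0// ler_pM ?invr_ge0 ?(ltW (lev _))//.
      by rewrite lef_pV2 ?posrE//; apply: level_le => //; exact: ltnW.
  rewrite /A (@ge0_integral_bigsetU _ _ _ lam _ (fun j : 'I_N => cell (n, val j)))//.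
  - apply: (@le_trans _ _ (\sum_(j < N) I * ((1 - r^-1) / tau)%:E)%E).
      rewrite -ge0_sume_distrr; last by move=> j _; rewrite lee_fin divr_ge0 ?(ltW tau0)// subr_ge0 invf_le1// ltW.
      rewrite sumEFin sumr_const card_ord -[(_ / tau) *+ N]mulr_natl.
      by rewrite [N%:R * _]mulrC mulrAC.
    apply: lee_sum => j _.
    pose i := (n, val j).
    have w0 := width_gt0 i.
    have CE : cell i = coord i @^-1` `[0, (k n)%:R[%classic.
      by apply/seteqP; split => t; rewrite /cell/= ltn_ord//; case.
    have w0' : 0 < (width i)^-1 by rewrite invr_gt0.
    have mgn : measurable_fun setT (fun t => `|g n t|%:E).
      by apply/measurable_EFinP; exact: measurableT_comp.
    have mgc := measurableT_comp mgn
      (@measurable_affine R (width i)^-1 (- ((k n)%:R * level n j.+1 / width i))).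
    have := @ge0_integral_affine R _ (- ((k n)%:R * level n j.+1 / width i))
       `[0%R, (k n)%:R[%classic (fun t => `|g n t|%:E) w0' (measurable_itv _) mgn (fun t => normr_ge0 _).
    rewrite -/I => <-.
    rewrite -[X in (_ <= \int[_]_(t in X) _)%E]/(cell i) CE.
    have cpos : 0 <= (1 - r^-1) / tau * (width i)^-1.
      by rewrite mulr_ge0 ?invr_ge0 ?(ltW w0)// divr_ge0 ?(ltW tau0)// subr_ge0 invf_le1// ltW.
    rewrite muleC muleA -EFinM -ge0_integralZl//.
    + rewrite -CE; apply: ge0_le_integral => //.
      * exact: measurable_cell.
      * by move=> t _; rewrite mule_ge0 ?lee_fin.
      * by apply: measurable_funeM; exact: measurable_funTS mgc.
      * by apply/measurable_EFinP/measurable_funTS/measurableT_comp => //; exact: measurable_funM.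
      * move=> t Ct; rewrite -EFinM lee_fin xE (glue_cell _ Ct)/=.
        rewrite [X in _ * X <= _](_ : _ = `|g n (coord i t)|)//.
        rewrite !normrM !normfV (gtr0_norm tau0) (gtr0_norm (lev _)).
        move: `|g n _| => Y.
        have wE : width i = level n j * (1 - r^-1).
          by rewrite /width /= mulrBr mulr1 {3}levelS mulfK// gt_eqF.
        have r10 : 1 - r^-1 != 0 by rewrite subr_eq0 eq_sym invr_eq1 gt_eqF.
        rewrite wE invfM; move: r10; set d := 1 - r^-1 => d0.
        rewrite le_eqVlt; apply/orP; left; apply/eqP.
        transitivity (d * d^-1 * (tau^-1 * (Y / level n j))); first lra.
        by rewrite mulfV// mul1r.
    + by have := mC (val j); rewrite -/i CE.
    + exact: measurable_funTS mgc.
  - by rewrite /index_enum -enumT; exact: enum_uniq.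
  - apply/trivIsetP => j1 j2 _ _ /eqP j12; apply/seteqP; split => // t [C1 C2].
    by apply: j12; apply: val_inj; have [] := cell_inj C1 C2.
  - by apply/measurable_EFinP/measurable_funTS/measurableT_comp => //; exact: measurable_funM.
have q0 : 0 < (1 - r^-1) * N%:R / tau.
  rewrite divr_gt0// mulr_gt0//; first by rewrite subr_gt0 invf_lt1.
  by rewrite ltr0n /N /steps !muln_gt0 K_gt0 k_gt0.
have {lower bound} := le_trans lower bound.
have cl : (c%:E * lu A <= ((K n)%:R * (k n)%:R / tau)%:E)%E.
  apply: (@le_trans _ _ (c%:E * ((k n)%:R * top n)%:E)%E).
    by apply: lee_wpmul2l => //; rewrite lee_fin ltW.
  have tt : (top n)^-1 * top n = 1 by rewrite mulVf// gt_eqF.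
  rewrite -EFinM lee_fin /c invfM.
  have -> : (K n)%:R * ((top n)^-1 / tau) * ((k n)%:R * top n) =
      ((top n)^-1 * top n) * ((K n)%:R * (k n)%:R / tau).
    by move: (top n)^-1 (top n) tau^-1 (K n)%:R (k n)%:R => p q u v w; lra.
  by rewrite tt mul1r.
move=> h; have {cl h} := le_trans h (leeD cl (lexx _)).
rewrite -EFinD -lee_pdivlMr// -EFinM => /le_trans; apply.
rewrite lee_fin.
(* The origin of [steps]: N (r - 1) is n.+1 times K n * k n, and c mu(A) is at most K n * k n /
   tau. *)
have PE : N%:R * (r - 1) = n.+1%:R * ((K n)%:R * (k n)%:R).
  rewrite /N /steps /r /ratio addrAC subrr add0r natrM natrX expr2 natrM.
  by rewrite mulrAC mulfK// mulrC.
set P := n.+1%:R * _ in PE.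
have Kk1 : 1 <= (K n)%:R * (k n)%:R :> R by rewrite -natrM ler1n muln_gt0 K_gt0 k_gt0.
have P0 : 0 < P by rewrite mulr_gt0 ?ltr0n// (lt_le_trans ltr01).
have qE : (1 - r^-1) * N%:R / tau = P / (r * tau).
  rewrite -PE invfM mulrA; congr (_ / tau).
  by rewrite -mulrA [(r - 1) / r]mulrBl mulfV ?gt_eqF// mul1r mulrC.
rewrite PE qE ler_pdivrMr; last by rewrite divr_gt0// mulr_gt0.
have n1 : n.+1%:R * n.+1%:R^-1 = 1 :> R by rewrite mulfV.
have rr : r * r^-1 = 1 by rewrite mulfV// gt_eqF.
have tt : tau * tau^-1 = 1 by rewrite mulfV// gt_eqF.
rewrite /P invfM; move: Kk1; set Kk := _ * _ => Kk1.
(* Inverses become independent variables, so that the identity is polynomial; the products a ai, t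
   ti and m mi are replaced by 1 afterwards. *)
have alg (a t e m q ai ti mi : R) : a * (t + (1 + t * e) * mi) * (m * q * (ai * ti)) =
    (a * ai) * ((t * ti) * (m * q) + (m * mi) * (q * ti + (t * ti) * (q * e))) by lra.
rewrite -/r alg rr tt n1 !mul1r addrCA !lerD2l.
by apply: le_trans (ler_norm D) _; rewrite ler_peMl.
Qed.

End blocks.

(** * Step functions with rational values, dense in L^1 of [0, k[ *)

Section step_density.
Variable R : realType.
Local Notation X := (measurableTypeR R).
Local Notation lam := (@lebesgue_measure R).

Definition grid (m i : nat) : set X := `[i%:R / m.+1%:R, i.+1%:R / m.+1%:R[%classic.

(** Encoded by a natural number and a rational sequence, so that there are countably many. *)
Definition grid_step (m : nat) (s : seq rat) (t : X) : R :=
  \sum_(i < size s) ratr (s`_i) * \1_(grid m i) t.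

Lemma measurable_grid m i : measurable (grid m i).
Proof. exact: measurable_itv. Qed.

Lemma grid_inj m i j t : grid m i t -> grid m j t -> i = j.
Proof.
rewrite /grid /= !in_itv/= => /andP[a1 a2] /andP[b1 b2].
have m0 : 0 < m.+1%:R^-1 :> R by rewrite invr_gt0.
have := le_lt_trans a1 b2; have := le_lt_trans b1 a2.
by rewrite !ltr_pM2r// !ltr_nat !ltnS => ji ij; apply/anti_leq; rewrite ij ji.
Qed.

Lemma gridP m t : 0 <= t -> grid m (Num.truncn (t * m.+1%:R)) t.
Proof.
move=> t0; rewrite /grid/= in_itv/=.
have /andP[lo hi] := truncn_itv (mulr_ge0 t0 (ler0n R m.+1)).
by rewrite ler_pdivrMr// lo ltr_pdivlMr.
Qed.

Lemma grid_stepE m s i t : (i < size s)%N -> grid m i t -> grid_step m s t = ratr s`_i.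
Proof.
move=> si ti; rewrite /grid_step (bigD1 (Ordinal si))//= indicE mem_set// mulr1.
rewrite big1 ?addr0// => j ji; rewrite indicE memNset ?mulr0// => tj.
by move/eqP: ji; apply; apply: val_inj => /=; exact: grid_inj tj ti.
Qed.

Lemma grid_step_out m s t : (forall i, (i < size s)%N -> ~ grid m i t) -> grid_step m s t = 0.
Proof.
by move=> ts; rewrite /grid_step big1// => i _; rewrite indicE memNset ?mulr0//; exact: ts.
Qed.

Lemma measurable_grid_step m s : measurable_fun setT (grid_step m s).
Proof.
apply: measurable_sum => i; apply: measurable_funM => //.
by apply: measurable_indic; exact: measurable_grid.
Qed.

(** Uniform continuity, with y allowed outside [a, b], from the near-covering form of
    compactness. *)
Lemma continuous_uniform_itv (g : R -> R) (a b e : R) : continuous g -> 0 < e ->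
  exists n : nat, forall x y, x \in `[a, b] -> `|y - x| <= n.+1%:R^-1 -> `|g y - g x| < e.
Proof.
move=> cg e0.
have /compact_near_coveringP cK := @segment_compact R a b.
pose P (n : nat) (x : R) := forall y, `|y - x| <= n.+1%:R^-1 -> `|g y - g x| < e.
have /= : \forall n \near \oo, `[a, b]%classic `<=` P n.
  apply: cK => x _.
  have e2 : 0 < e / 2 by rewrite divr_gt0.
  have /cvgrPdist_lt/(_ _ e2) := cg x.
  move=> /nbhs_ballP[d /= d0 dg].
  have d2 : 0 < d / 2 by rewrite divr_gt0.
  near=> x' n => y /= yx'.
  have xx' : `|x - x'| < d / 2 by near: x'; exists (d / 2) => //= z; rewrite /ball/=.
  have nd : n.+1%:R^-1 < d / 2 by near: n; exact: near_infty_natSinv_lt (PosNum d2).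
  have gx' : `|g x - g x'| < e / 2.
    by apply: dg => /=; rewrite /ball/= (lt_trans xx')// ltr_pdivrMr// ltr_pMr// ltr1n.
  have gy : `|g x - g y| < e / 2.
    apply: dg => /=; rewrite /ball/=.
    rewrite (_ : x - y = (x - x') - (y - x')); last lra.
    rewrite (le_lt_trans (ler_normB _ _))// [ltRHS](splitr d) ltrD//.
    exact: le_lt_trans nd.
  rewrite (_ : g y - g x' = (g x - g x') - (g x - g y)); last lra.
  by rewrite (le_lt_trans (ler_normB _ _))// [ltRHS](splitr e) ltrD.
move=> [n _ nP]; exists n => x y xab; apply: (nP n) => //=.
Unshelve. all: by end_near. Qed.

Lemma grid_step_dense (k : nat) (f : X -> R) (e : R) : 0 < e ->
  lam.-integrable `[0%R, k%:R] (EFin \o f) ->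
  exists m s, (size s <= k * m.+1)%N /\
    (\int[lam]_(t in `[0%R, k%:R[) `|f t - grid_step m s t|%:E <= e%:E)%E.
Proof.
move=> e0 intf.
have mI : measurable (`[0, k%:R]%classic : set X) by exact: measurable_itv.
have lamI : (lam `[0%R, k%:R] < +oo)%E.
  by rewrite lebesgue_measure_itv/=; case: ifP => _; rewrite ?ltry// -EFinD ltry.
have [g [cg ig gcvg]] := approximation_continuous_integrable mI lamI intf.
have e2 : 0 < e / 2 by rewrite divr_gt0.
have /fine_cvgP[[n1 _ fin] /cvgrPdist_lt/(_ _ e2)[n2 _ small]] := gcvg.
pose n := maxn n1 n2.
have {fin} fin := fin n (leq_maxl _ _).
have {small} small := small n (leq_maxr _ _).
have {small fin} gn : (\int[lam]_(t in `[0%R, k%:R]) `|(f t - g n t)%:E| < (e / 2)%:E)%E.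
  rewrite -(fineK fin) lte_fin; move: small => /=; rewrite sub0r normrN.
  by apply: le_lt_trans; exact: ler_norm.
(* Half of e goes to the continuous approximation, half to d times the length k; the successor
   admits k = 0. *)
pose d := e / (2 * k.+1%:R).
have d0 : 0 < d by rewrite divr_gt0// mulr_gt0.
have d2 : 0 < d / 2 by rewrite divr_gt0.
have [m mP] := continuous_uniform_itv 0 k%:R (cg n) d2.
have qP i : exists q : rat, `|g n (i%:R / m.+1%:R) - ratr q| < d / 2.
  set y := g n _; have ydd : y - d / 2 < y + d / 2 by lra.
  have [q] := rat_in_itvoo ydd; rewrite in_itv/= => /andP[q1 q2]; exists q.
  by rewrite ltr_norml; apply/andP; split; lra.
pose s := mkseq (fun i => projT1 (cid (qP i))) (k * m.+1)%N.
exists m, s; split; first by rewrite size_mkseq.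
pose J : set X := `[0, k%:R[%classic.
have mJ : measurable J by exact: measurable_itv.
have JI : J `<=` `[0, k%:R] by apply: subset_itvl; rewrite bnd_simp.
have mf : measurable_fun J f.
  by apply: measurable_funS JI _ => //; apply/measurable_EFinP; exact: measurable_int intf.
have mg : measurable_fun J (g n).
  by apply: measurable_funS JI _ => //; apply/measurable_EFinP; exact: measurable_int (ig n).
have ms : measurable_fun J (grid_step m s) by apply: measurable_funTS; exact: measurable_grid_step.
apply: (@le_trans _ _ (\int[lam]_(t in J) (`|(f t - g n t)%:E| + d%:E))%E).
  apply: ge0_le_integral => //.
  - by apply/measurable_EFinP; apply: measurableT_comp => //; exact: measurable_funB.
  - apply: emeasurable_funD => //; apply: measurableT_comp => //.
    by apply/measurable_EFinP; exact: measurable_funB.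
  - move=> t; rewrite /J/= in_itv/= => /andP[t0 tk].
    rewrite -EFinD lee_fin (_ : f t - _ = (f t - g n t) + (g n t - grid_step m s t)); last lra.
    rewrite (le_trans (ler_normD _ _))// lerD2l.
    pose i := Num.truncn (t * m.+1%:R).
    have ti : grid m i t by exact: gridP.
    have ik : (i < k * m.+1)%N.
      move: (ti); rewrite /grid/= in_itv/= => /andP[it _].
      have := le_lt_trans it tk; rewrite ltr_pdivrMr// -natrM ltr_nat.
      by [].
    rewrite (grid_stepE _ ti) ?size_mkseq// nth_mkseq//.
    have h1 := projT2 (cid (qP i)); set q := projT1 _ in h1 *.
    have h2 : `|g n (i%:R / m.+1%:R) - g n t| < d / 2.
      apply: mP; first by rewrite in_itv/= t0 ltW.
      move: ti; rewrite /grid/= in_itv/= -[i.+1%:R]natr1 mulrDl mul1r => /andP[a1 /ltW a2].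
      by rewrite ler0_norm ?subr_le0// opprB lerBlDl.
    rewrite (_ : g n t - _ = (g n (i%:R / m.+1%:R) - ratr q) - (g n (i%:R / m.+1%:R) - g n t)); last lra.
    rewrite (le_trans (ler_normB _ _))// [leRHS](splitr d) lerD// ltW//.
rewrite ge0_integralD//; last 2 first.
  - by apply: measurableT_comp => //; apply/measurable_EFinP; exact: measurable_funB.
  - by move=> t _; rewrite lee_fin ltW.
rewrite integral_cst// (splitr e) EFinD; apply: leeD.
  apply: le_trans (ltW gn); apply: ge0_subset_integral => //.
  apply: measurableT_comp => //; apply/measurable_EFinP.
  by apply: measurable_funB; apply/measurable_EFinP; [exact: measurable_int intf|exact: measurable_int (ig n)].
change (d%:E * lam J <= (e / 2)%:E)%E.
rewrite /J lebesgue_measure_itv/= lte_fin; case: ifP => [k0|_].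
  have kk : k%:R / k.+1%:R <= 1 :> R by rewrite ler_pdivrMr ?ltr0n// mul1r ler_nat.
  rewrite oppr0 adde0 -EFinM lee_fin /d invfM mulrA -(mulrA (e / 2)) [_^-1 * _]mulrC.
  by rewrite ler_piMr// ltW.
by rewrite mule0 lee_fin ltW.
Qed.

End step_density.

(** * Bundled measurable functions *)

Section mfun_of.
Context d (T : measurableType d) (R : realType).
Implicit Types f g : {mfun T >-> R}.

Definition mfun_of (f : T -> R) (mf : measurable_fun setT f) : {mfun T >-> R} :=
  HB.pack f (@isMeasurableFun.Build _ _ _ _ f mf).

Lemma mfun_ext f g : f =1 g -> f = g.
Proof. by move=> fg; apply/val_inj/funext. Qed.

Lemma measurable_norm_mul (f g : T -> R) (D : set T) :
  measurable_fun setT f -> measurable_fun setT g ->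
  measurable_fun D (fun t => `|f t * g t|%:E).
Proof.
move=> mf mg; apply/measurable_EFinP/measurable_funTS/measurableT_comp => //.
exact: measurable_funM.
Qed.

End mfun_of.

(** * Positive norming functions and the decomposition in L^1 + L^oo *)

Section ri_basic.
Variable R : realType.
Local Notation mu := (lebesgue_half_line R).
Local Notation lam := (@lebesgue_measure R).
Local Notation X := (measurableTypeR R).
Local Notation F := {mfun X >-> R}.
Variables (E : set F) (nrm : F -> R).
Hypothesis hE : rearrangement_invariant E nrm.
Let kE := ri_koethe hE.
Implicit Types (f g h u : F).

Lemma ri_scale (a : R) f : E f -> E (a *: f).
Proof.
move=> Ef; have E0 : E 0.
  by rewrite -(addNr f) -scaleN1r; exact: (koethe_linear kE).
by rewrite -[_ *: _]addr0; exact: (koethe_linear kE).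
Qed.

Lemma ri_solid f g : E g -> (forall t, `|f t| <= `|g t|) -> E f /\ nrm f <= nrm g.
Proof. by move=> Eg fg; apply: (koethe_solid kE Eg); exact: aeW. Qed.

Lemma ri_norm_ge0 f : E f -> 0 <= nrm f.
Proof.
move=> Ef; have [E0 le0] : E 0 /\ nrm 0 <= nrm f.
  by apply: ri_solid => // t; rewrite normr0.
by apply: le_trans le0; rewrite -(scale0r f) (koethe_normZ kE)// normr0 mul0r.
Qed.

(** The positive part of the unit ball of the dual; the absolute value inside the integral makes it
    stable under passing to smaller positive functions. *)
Definition pos_dual (h : F) : Prop := (forall t, 0 <= h t) /\
  forall f, E f -> (\int[mu]_t `|f t * h t|%:E <= (nrm f)%:E)%E.

Lemma pos_dual_solid (h g : F) : pos_dual h -> (forall t, 0 <= g t <= h t) -> pos_dual g.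
Proof.
move=> [h0 hf] gh; split=> [t|f Ef]; first by have /andP[] := gh t.
apply: le_trans (hf f Ef); apply: ge0_le_integral => //.
- exact: measurable_norm_mul.
- exact: measurable_norm_mul.
- move=> t _; have /andP[g0 gt] := gh t.
  by rewrite lee_fin !normrM ler_wpM2l// !ger0_norm// (le_trans g0).
Qed.

(** If h is norming for f up to e, then |h| is too and stays in the dual ball: pairing |g| with |h|
    amounts to pairing h with |g| sign(h), which lies in E by solidity. *)
Lemma pos_dual_norming f (e : R) : E f -> 0 < e ->
  exists2 h, pos_dual h & ((nrm f - e)%:E < \int[mu]_t `|f t * h t|%:E)%E.
Proof.
move=> Ef e0.
have : ((nrm f - e)%:E < (nrm f)%:E)%E by rewrite lte_fin ltrBlDr ltrDl.
rewrite (ri_norming hE Ef) => /ereal_sup_gt[_ [h [Eh h1] <-] fh].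
have mh : measurable_fun setT (fun t => `|h t|) by exact: measurableT_comp.
exists (mfun_of mh); last first.
  apply: lt_le_trans fh _; apply: le_trans (le_abse_integral _ _ _) _ => //.
    by apply/measurable_EFinP; exact: measurable_funM.
  rewrite le_eqVlt; apply/orP; left; apply/eqP; apply: eq_integral => t _ /=; rewrite !normrM normr_id//.
split=> [t|g Eg]; first exact: normr_ge0.
(* h / |h| is the sign of h, and 0 where h vanishes because 0^-1 = 0. *)
have msg : measurable_fun setT (fun t => `|g t| * (h t * (`|h t|)^-1)).
  apply: measurable_funM; first exact: measurableT_comp.
  by apply: measurable_funM => //; apply: (measurableT_comp (@measurable_inv R)).
pose gs := mfun_of msg.
have [Egs gsg] : E gs /\ nrm gs <= nrm g.
  apply: ri_solid => // t; rewrite /gs/= !normrM normr_id normfV normr_id.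
  by apply: ler_piMr => //; have [->|h0] := eqVneq `|h t| 0; rewrite ?mul0r// mulfV.
(* The slack s keeps the divisor positive when nrm g = 0. *)
apply/lee_addgt0Pr => s s0; rewrite -EFinD.
have sp : 0 < nrm g + s by rewrite ltr_wpDl// ri_norm_ge0.
pose b := (nrm g + s)^-1 *: gs.
have Eb : E b by exact: ri_scale.
have b1 : nrm b <= 1.
  rewrite (koethe_normZ kE)// gtr0_norm ?invr_gt0// ler_pdivrMl// mulr1.
  by rewrite (le_trans gsg)// lerDl ltW.
have : (`|\int[mu]_t (b t * h t)%:E| <= 1)%E.
  apply: le_trans h1; apply: ereal_sup_ubound; exists b => //; split => //.
rewrite (_ : \int[mu]_t _ = (nrm g + s)^-1%:E * \int[mu]_t `|g t * `|h t| |%:E)%E; last first.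
  rewrite -ge0_integralZl ?lee_fin ?invr_ge0 ?(ltW sp)//; last exact: measurable_norm_mul.
  apply: eq_integral => t _; rewrite -EFinM; congr EFin.
  rewrite normrM normr_id /b.
  change ((nrm g + s)^-1 * (`|g t| * (h t / `|h t|)) * h t = (nrm g + s)^-1 * (`|g t| * `|h t|)).
  rewrite -!mulrA; congr (_ * (_ * _)).
  have [h0|h0] := eqVneq (h t) 0; first by rewrite h0 !mul0r normr0.
  by rewrite mulrCA -expr2 -real_normK ?num_real// expr2 mulKf ?normr_eq0.
rewrite gee0_abs ?mule_ge0 ?lee_fin ?invr_ge0 ?(ltW sp)//; last exact: integral_ge0.
by rewrite lee_pdivrMl// mule1.
Qed.

(** The inclusion into L^1 + L^oo has norm one, so f / (nrm f + 1) has norm at most 1 there; the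
    infimum over decompositions need not be attained, whence the 2. *)
Lemma ri_decomposition f : E f -> exists2 u : F, (\int[mu]_t `|u t|%:E <= 2%:E)%E &
  {ae mu, forall t, `|f t| <= (nrm f + 1) * (`|u t| + 2)}.
Proof.
move=> Ef; have s0 : 0 < nrm f + 1 by rewrite ltr_wpDl// ri_norm_ge0.
pose g := (nrm f + 1)^-1 *: f.
have Eg : E g by exact: ri_scale.
have g1 : nrm g <= 1.
  rewrite (koethe_normZ kE)// gtr0_norm ?invr_gt0// ler_pdivrMl// mulr1.
  by rewrite lerDl.
have [_ sup1] := ri_plus hE.
have g2 : (L1_plus_Loo_norm mu g < 2%:E)%E.
  apply: (@le_lt_trans _ _ 1%E); last by rewrite lte_fin ltr1n.
  by rewrite -sup1; apply: ereal_sup_ubound; exists g.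
have [_ [[u v] [/= u1 voo guv] <-] uv2] := ereal_inf_lt g2.
have v0 := Lnorm_ge0 mu +oo%E (EFin \o v).
have u0 := Lnorm_ge0 mu 1 (EFin \o u).
exists u.
  rewrite -(Lnorm1 mu (EFin \o u)); apply: le_trans (ltW uv2); exact: leeDl.
have v2 : {ae mu, forall t, `|v t| <= 2}.
  have vle : ('N[mu]_+oo [EFin \o v] <= 2%:E)%E.
    by apply: le_trans (ltW uv2); exact: leeDr.
  (* The norm at infinity unfolds to an essential supremum only for a measure of positive total
     mass. *)
  have muT : (0 < mu setT)%E.
    rewrite /lebesgue_half_line /= /mrestr setTI.
    by rewrite lebesgue_measure_itv/= ltry oppr0 adde0 ltry.
  move: vle; rewrite unlock muT => vle.
  apply: filterS (ess_sup_inf.ess_sup_ge mu (abse \o (EFin \o v))) => t.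
  by move=> /le_trans/(_ vle); rewrite lee_fin.
apply: filterS2 guv v2 => t gt vt.
have ft : f t = (nrm f + 1) * (u t + v t).
  rewrite -gt; change (f t = (nrm f + 1) * ((nrm f + 1)^-1 * f t)).
  by rewrite mulVKf// gt_eqF.
rewrite ft normrM (gtr0_norm s0) ler_pM2l//.
by rewrite (le_trans (ler_normD _ _))// lerD2l.
Qed.

End ri_basic.

(** * Exchanging two intervals of equal length *)

Section swap.
Variable R : realType.
Local Notation X := (measurableTypeR R).
Local Notation lam := (@lebesgue_measure R).
Local Notation mu := (lebesgue_half_line R).
Variables (x y a : R).

Definition swap (t : X) : X :=
  if x <= t < x + a then t + (y - x) else if y <= t < y + a then t - (y - x) else t.

Let measurable_itv_bool (b : R) : measurable_fun setT (fun t : X => b <= t < b + a).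
Proof.
apply: measurable_and; first exact: measurable_fun_ler.
exact: measurable_fun_ltr.
Qed.

Lemma measurable_swap : measurable_fun setT swap.
Proof.
apply: measurable_fun_ifT => //; first exact: measurable_funD.
by apply: measurable_fun_ifT => //; exact: measurable_funB.
Qed.

HB.instance Definition _ := @isMeasurableFun.Build _ _ X X swap measurable_swap.

Hypotheses (x0 : 0 <= x) (a0 : 0 <= a) (xay : x + a <= y).

Lemma swap_left (t : R) : x <= t < x + a -> swap t = t + (y - x).
Proof. by rewrite /swap => ->. Qed.

Lemma swap_right (t : R) : y <= t < y + a -> swap t = t - (y - x).
Proof.
move=> ty; rewrite /swap ty ifF//; apply/negbTE; rewrite negb_and -!ltNge -leNgt.
by apply/orP; right; apply: le_trans xay _; case/andP: ty.
Qed.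

Lemma swap_out (t : R) : ~~ (x <= t < x + a) -> ~~ (y <= t < y + a) -> swap t = t.
Proof. by rewrite /swap => /negbTE -> /negbTE ->. Qed.

Variant swap_spec (t : R) : R -> Type :=
| SwapLeft of x <= t < x + a & y <= t + (y - x) < y + a : swap_spec t (t + (y - x))
| SwapRight of y <= t < y + a & x <= t - (y - x) < x + a : swap_spec t (t - (y - x))
| SwapOut of ~~ (x <= t < x + a) & ~~ (y <= t < y + a) : swap_spec t t.

Lemma swapP (t : R) : swap_spec t (swap t).
Proof.
have [tx|tx] := boolP (x <= t < x + a).
  rewrite swap_left//; apply: SwapLeft => //.
  by case/andP: tx => t1 t2; apply/andP; split; lra.
have [ty|ty] := boolP (y <= t < y + a); last by rewrite swap_out//; exact: SwapOut.
rewrite swap_right//; apply: SwapRight => //.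
by case/andP: ty => t1 t2; apply/andP; split; lra.
Qed.

Lemma swapK (t : R) : swap (swap t) = t.
Proof.
case: (swapP t) => [h1 h2|h1 h2|h1 h2].
- by rewrite (swap_right h2) addrK.
- by rewrite (swap_left h2) subrK.
- exact: swap_out.
Qed.

Lemma swap_ge0 (t : R) : 0 <= t -> 0 <= swap t.
Proof.
case: (swapP t) => [_ /andP[h _]|_ /andP[h _]|//] _; last exact: le_trans h.
by apply: le_trans h; apply: le_trans xay; exact: addr_ge0.
Qed.

Lemma swap_lt0 (t : R) : 0 <= swap t -> 0 <= t.
Proof. by move=> /swap_ge0; rewrite swapK. Qed.

Lemma lebesgue_measure_swap (A : set X) : measurable A -> lam (swap @^-1` A) = lam A.
Proof.
move=> mA.
pose I : set X := `[x, x + a[%classic; pose J : set X := `[y, y + a[%classic.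
have IE (t : R) : I t = (x <= t < x + a) :> Prop by rewrite /I/= in_itv.
have JE (t : R) : J t = (y <= t < y + a) :> Prop by rewrite /J/= in_itv.
have mI : measurable I by exact: measurable_itv.
have mJ : measurable J by exact: measurable_itv.
have mP : measurable (swap @^-1` A).
  by rewrite -[X in measurable X]setTI; exact: measurable_swap.
(* [swap] translates I and J onto each other and fixes the rest: the pieces of the preimage in I and
   J match those of A crosswise. *)
have split3 (P : set X) : measurable P ->
    lam P = (lam (P `\` I `\` J) + lam (P `&` J) + lam (P `&` I))%E.
  move=> mP'; rewrite (measureDI _ mP' mI) (measureDI _ (measurableD mP' mI) mJ).
  congr (_ + lam _ + _)%E; apply/seteqP; split=> t /=; first by move=> [[]].
  move=> [Pt Jt]; split => //; split => //; rewrite IE => /andP[_ t1].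
  by move: Jt; rewrite JE => /andP[t2 _]; have := lt_le_trans t1 xay; rewrite ltNge t2.
have shift (b : R) (P : set X) : measurable P -> lam (affine 1 b @^-1` P) = lam P.
  by move=> mP'; rewrite -(@lebesgue_measure_affine R 1 b P)// mul1e.
have fwd (t : R) : (x <= t < x + a) = (y <= t + (y - x) < y + a).
  by apply/idP/idP => /andP[h1 h2]; apply/andP; split; lra.
have PI : swap @^-1` A `&` I = affine 1 (y - x) @^-1` (A `&` J).
  apply/seteqP; split => t /=; rewrite /affine mul1r IE JE.
    by move=> [At tI]; move: At; rewrite (swap_left tI) => At; split => //; rewrite -fwd.
  move=> [At tJ]; have tI : x <= t < x + a by rewrite fwd.
  by rewrite (swap_left tI).
have PJ : swap @^-1` A `&` J = affine 1 (- (y - x)) @^-1` (A `&` I).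
  apply/seteqP; split => t /=; rewrite /affine mul1r IE JE.
    by move=> [At tI]; move: At; rewrite (swap_right tI) => At; split => //; rewrite fwd subrK.
  move=> [At tJ]; have tI : y <= t < y + a by move: tJ; rewrite fwd subrK.
  by rewrite (swap_right tI).
have PO : swap @^-1` A `\` I `\` J = A `\` I `\` J.
  apply/seteqP; split => t /= [[At /negP tI] /negP tJ]; move: At;
  by rewrite IE JE in tI tJ *; rewrite swap_out//; move/negP: tI; move/negP: tJ.
rewrite (split3 _ mP) (split3 _ mA) PI PJ PO !shift ?addeA//; last 2 first.
  - exact: measurableI.
  - exact: measurableI.
by rewrite -addeA [X in (_ + X)%E]addeC addeA.
Qed.

Lemma half_line_swap (A : set X) : measurable A -> mu (swap @^-1` A) = mu A.
Proof.
move=> mA; rewrite /lebesgue_half_line /= /mrestr.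
have m0 : measurable (`[0, +oo[%classic : set X) by exact: measurable_itv.
rewrite -(lebesgue_measure_swap (measurableI _ _ mA m0)); congr (lam _).
apply/seteqP; split => t /= [At]; rewrite !in_itv/= !andbT => t0; split => //.
  exact: swap_ge0.
exact: swap_lt0.
Qed.

Lemma swap_automorphism : half_line_automorphism swap swap.
Proof.
split => [t t0|t t0|A mA]; last exact: half_line_swap.
  by split; exact: swap_ge0.
by split; exact: swapK.
Qed.

Lemma ge0_integral_swap (A : set X) (f : X -> \bar R) : measurable A ->
  measurable_fun setT f -> (forall t, 0 <= f t)%E ->
  (\int[mu]_(t in swap @^-1` A) f (swap t) = \int[mu]_(t in A) f t)%E.
Proof.
move=> mA mf f0.
rewrite -(@ge0_integral_pushforward _ _ _ _ _ _ measurable_swap mu A f)//; last first.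
  exact: measurable_funTS.
by apply: eq_measure_integral => B mB BA; exact: half_line_swap.
Qed.

End swap.

(** * Gathering grid cells at the left by exchanges *)

Section gather.
Variable R : realType.
Local Notation mu := (lebesgue_half_line R).
Local Notation lam := (@lebesgue_measure R).
Local Notation X := (measurableTypeR R).
Local Notation F := {mfun X >-> R}.
Variables (E : set F) (nrm : F -> R).
Hypothesis hE : rearrangement_invariant E nrm.

Lemma ri_swap (x y a : R) (f : F) : 0 <= x -> 0 <= a -> x + a <= y -> E f ->
  exists f' : F, [/\ E f', nrm f' = nrm f & forall t, f' t = f (swap x y a t)].
Proof.
move=> x0 a0 xay Ef.
have [EE nn] := ri_automorphism hE (swap_automorphism x0 a0 xay) f.
exists [mfun of f \o swap x y a]; split => //; first exact/EE.
by rewrite nn.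
Qed.

Definition grid_mass (m : nat) (f : F) (i : nat) : \bar R :=
  (\int[mu]_(t in @grid R m i) `|f t|%:E)%E.

(** The new mass of cell j is left open: the exchange is made only when cell i is not among those to
    be gathered. *)
Lemma ri_swap_grid (m i j : nat) (f : F) : (i < j)%N -> E f ->
  exists f' : F, [/\ E f', nrm f' = nrm f, grid_mass m f' i = grid_mass m f j &
    forall l, l != i -> l != j -> grid_mass m f' l = grid_mass m f l].
Proof.
move=> ij Ef.
pose w : R := m.+1%:R^-1.
have w0 : 0 < w by rewrite invr_gt0.
pose x : R := i%:R * w; pose y : R := j%:R * w.
have x0 : 0 <= x by rewrite mulr_ge0// ltW.
have xS (l : nat) : l.+1%:R * w = l%:R * w + w by rewrite -[l.+1%:R]natr1 mulrDl mul1r.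
have xwy : x + w <= y by rewrite /x /y -xS ler_pM2r// ler_nat.
have gE l (t : R) : @grid R m l t = (l%:R * w <= t < l%:R * w + w) :> Prop.
  by rewrite /grid/= in_itv/= -xS.
have [f' [Ef' nf' f'E]] := ri_swap x0 (ltW w0) xwy Ef.
have mf : measurable_fun setT (fun t => `|f t|%:E).
  by apply/measurable_EFinP; exact: measurableT_comp.
have mass (l l' : nat) : swap x y w @^-1` @grid R m l = @grid R m l' ->
    grid_mass m f' l' = grid_mass m f l.
  move=> ll'; rewrite /grid_mass -(ge0_integral_swap x0 (ltW w0) xwy _ mf)//; last first.
    exact: measurable_grid.
  by rewrite ll'; apply: eq_integral => t _; rewrite f'E.
have disj (l l' : nat) t : l != l' -> @grid R m l t -> @grid R m l' t -> False.
  by move=> /eqP ll' h /(grid_inj h).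
have gx (t : R) : @grid R m i t = (x <= t < x + w) :> Prop by exact: gE.
have gy (t : R) : @grid R m j t = (y <= t < y + w) :> Prop by exact: gE.
exists f'; split => //.
- apply: mass; apply/seteqP; split => t; rewrite /preimage/= gx gy.
    case: (swapP xwy t) => // [/andP[? ?] /andP[? ?] /andP[? ?]|? /negP//].
    by exfalso; lra.
  by move=> tx; case: (swapP xwy t) => // [/andP[? ?] ? |/negP//]; case/andP: tx => ? ?; exfalso; lra.
- move=> l li lj; apply: mass; apply/seteqP; split => t; rewrite /preimage/=.
    case: (swapP xwy t) => // [_ |_]; rewrite -?gx -?gy => h /disj.
      by move=> /(_ _ lj) /(_ h).
    by move=> /(_ _ li) /(_ h).
  move=> tl; case: (swapP xwy t) => //; rewrite -?gx -?gy => h _.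
    by case: (disj _ _ _ li tl h).
  by case: (disj _ _ _ lj tl h).
Qed.

(** Cells j, j + 1, ... are filled in turn; the clause on cells below j protects those already
    filled. *)
Lemma ri_gather (m : nat) (s : seq nat) (j : nat) (f : F) : E f -> uniq s ->
  all (leq j) s -> exists f' : F, [/\ E f', nrm f' = nrm f,
    (forall l, (l < j)%N -> grid_mass m f' l = grid_mass m f l) &
    (\sum_(i <- s) grid_mass m f i = \sum_(i < size s) grid_mass m f' (j + i)%N)%E].
Proof.
move: {2}(size s) (erefl (size s)) => n; elim: n s j f => [|n IH] s j f.
  by move=> /size0nil -> Ef _ _; exists f; split => //; rewrite big_nil big_ord0.
move=> sn Ef us js.
have step x (g : F) : E g -> nrm g = nrm f -> x \in s ->
    (forall l, (l < j)%N -> grid_mass m g l = grid_mass m f l) ->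
    grid_mass m g j = grid_mass m f x ->
    (forall i, i \in rem x s -> grid_mass m g i = grid_mass m f i) ->
    j \notin rem x s ->
    exists f' : F, [/\ E f', nrm f' = nrm f,
    (forall l, (l < j)%N -> grid_mass m f' l = grid_mass m f l) &
    (\sum_(i <- s) grid_mass m f i = \sum_(i < size s) grid_mass m f' (j + i)%N)%E].
  move=> Eg gf xs low gj grem jrem.
  have srem : size (rem x s) = n by rewrite size_rem// sn.
  have [||f' [Ef' nf' low' sum']] := IH (rem x s) j.+1 g srem Eg.
  - exact: rem_uniq.
  - apply/allP => i irem; rewrite ltn_neqAle; apply/andP; split.
      by apply: contraNneq jrem => ->.
    by move/allP: js; apply; exact: mem_rem irem.
  exists f'; split => //; first by rewrite nf'.
    by move=> l lj; rewrite low' ?low//; exact: ltnW.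
  rewrite (perm_big _ (perm_to_rem xs)) big_cons/= -gj sn big_ord_recl addn0 -low'//.
  congr (_ + _)%E; rewrite -(eq_big_seq _ grem) sum' srem.
  by apply: eq_bigr => i _; rewrite addSnnS.
(* If cell j is wanted it stays in place; otherwise the head x of the list, which is larger than j,
   is exchanged with it. *)
have [jins|jnots] := boolP (j \in s).
  apply: (step j f) => //; last by rewrite (mem_rem_uniq _ us) !inE eqxx.
move: sn us js jnots step; case: s => // x s [sn] us js jnots step.
have xs : x \in x :: s by rewrite inE eqxx.
have jx : (j < x)%N.
  rewrite ltn_neqAle; move/allP: js => -> //; rewrite andbT.
  by apply: contraNneq jnots => ->.
have [g [Eg ng gj gl]] := ri_swap_grid m jx Ef.
apply: (step x g) => //.
- move=> l lj; apply: gl; first by rewrite ltn_eqF.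
  by rewrite ltn_eqF//; exact: ltn_trans jx.
- move=> i irem; apply: gl.
    by apply: contraNneq jnots => <-; exact: mem_rem irem.
  by move: irem; rewrite (mem_rem_uniq _ us) !inE => /andP[].
- by apply: contraNN jnots; exact: mem_rem.
Qed.

End gather.

(** * Small sets carry small integrals, uniformly on the unit ball *)

Section small_sets.
Variable R : realType.
Local Notation mu := (lebesgue_half_line R).
Local Notation lam := (@lebesgue_measure R).
Local Notation X := (measurableTypeR R).
Local Notation F := {mfun X >-> R}.
Variables (E : set F) (nrm : F -> R).
Hypothesis hE : rearrangement_invariant E nrm.

Lemma half_line_lebesgue (A : set X) : A `<=` `[0, +oo[ -> mu A = lam A.
Proof. by move=> A0; rewrite /lebesgue_half_line /= /mrestr setIidl. Qed.

Lemma itv_half_line (b : R) : `[0, b[%classic `<=` (`[0, +oo[%classic : set X).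
Proof. by move=> t; rewrite /= !in_itv/= andbT => /andP[]. Qed.

Lemma half_line_itv (b : R) : 0 <= b -> mu `[0, b[%classic = b%:E.
Proof.
move=> b0; rewrite half_line_lebesgue; last exact: itv_half_line.
rewrite lebesgue_measure_itv/= lte_fin oppr0 adde0; case: ltP => // b0'.
by congr EFin; apply/eqP; rewrite eq_le b0.
Qed.

Lemma measurable_norm_EFin (f : F) (D : set X) : measurable_fun D (fun t => `|f t|%:E).
Proof. by apply/measurable_EFinP/measurable_funTS; exact: measurableT_comp. Qed.

(** Here d depends on f; this suffices for the part of a set missed by its grid approximation, which
    may be chosen after f. *)
Lemma ri_abs_continuous (f : F) (k : nat) (e : R) : E f -> 0 < e ->
  exists2 d : R, 0 < d & forall A : set X, measurable A -> A `<=` `[0, k%:R[ -> (mu A < d%:E)%E ->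
    (\int[mu]_(t in A) `|f t|%:E <= e%:E)%E.
Proof.
move=> Ef e0.
pose J : set X := `[0, k%:R[%classic.
have mJ : measurable J by exact: measurable_itv.
have iJ : mu.-integrable J (EFin \o f).
  apply: (koethe_locally_integrable (ri_koethe hE) Ef) => //.
  by rewrite half_line_itv// ltry.
have : mu.-integrable setT (EFin \o (f \_ J)).
  rewrite (_ : EFin \o _ = (EFin \o f) \_ J); last by rewrite restrict_EFin.
  by apply/integrable_restrict => //; rewrite setTI.
move=> /integral_normr_continuous/(_ _ e0)[d [d0 dA]]; exists d => // A mA AJ Ad.
have := dA A mA Ad; rewrite /Rintegral.
rewrite (_ : (\int[mu]_(t in A) _)%E = \int[mu]_(t in A) `|f t|%:E)%E; last first.
  by apply: eq_integral => t; rewrite inE => /AJ tJ; rewrite patchE mem_set.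
move=> /ltW; rewrite -lee_fin fineK// ge0_fin_numE; last exact: integral_ge0.
apply: (@le_lt_trans _ _ (\int[mu]_(t in J) `|f t|%:E)%E).
  by apply: ge0_subset_integral => //; exact: measurable_norm_EFin.
by have /integrableP[_] := iJ.
Qed.

Hypothesis small : forall e : R, 0 < e -> exists2 a : R, 0 < a & forall f, E f -> nrm f <= 1 ->
  (\int[mu]_(t in `[0%R, a[) `|f t|%:E <= e%:E)%E.

(* A small set is approximated by a union of grid cells, and swaps gather these
   cells in an initial interval without changing the norm. *)
Lemma ri_small_sets (k : nat) (e : R) : 0 < e -> exists2 a : R, 0 < a &
  forall (f : F) (A : set X), E f -> nrm f <= 1 -> measurable A -> A `<=` `[0, k%:R[ -> (mu A < a%:E)%E ->
    (\int[mu]_(t in A) `|f t|%:E <= e%:E)%E.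
Proof.
move=> e0; have e2 : 0 < e / 2 by rewrite divr_gt0.
have [a a0 Ha] := small e2.
have a2 : 0 < a / 2 by rewrite divr_gt0.
exists (a / 2) => // f A Ef f1 mA Ak Aa.
have [d d0 Hd] := ri_abs_continuous k Ef e2.
(* The L^1 error. A minus D and D minus A will have measure at most 2 h: this is below d, for the
   absolute continuity of f, and at most a / 4, so that D has measure at most a and fits into [0, a[
   once gathered. *)
pose h := Num.min (d / 8) (a / 8).
have h0 : 0 < h by rewrite lt_min !divr_gt0.
have lamA : lam A = mu A.
  by rewrite half_line_lebesgue//; apply: subset_trans Ak _; exact: itv_half_line.
pose J : set X := `[0, k%:R[%classic.
have mJ : measurable J by exact: measurable_itv.
have iA : lam.-integrable `[0, k%:R] (EFin \o \1_A).
  have mI : measurable (`[0, k%:R]%classic : set X) by exact: measurable_itv.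
  apply/integrableP; split; first exact/measurable_EFinP/measurable_indic.
  rewrite (eq_integral (fun x => (\1_A x)%:E)); last first.
    by move=> t _; rewrite gee0_abs// lee_fin.
  rewrite integral_indic//; apply: (@le_lt_trans _ _ (lam `[0%R, k%:R])).
    by apply: le_measure; rewrite ?inE//; exact: measurableI.
  by rewrite lebesgue_measure_itv/=; case: ifP => _; rewrite ?ltry// -EFinD ltry.
have [m [s [sk As]]] := grid_step_dense h0 iA.
(* Cutting at 1/2: wherever A and D differ, the step function is at distance at least 1/2 from the
   indicator of A, and Markov's inequality applies. *)
pose S := [seq i <- iota 0 (size s) | 2^-1 < ratr s`_i :> R].
pose D : set X := \big[setU/set0]_(i <- S) @grid R m i.
have mD : measurable D by apply: bigsetU_measurable => i _; exact: measurable_grid.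
have DP t : D t <-> exists2 i, (i < size s)%N /\ 2^-1 < ratr s`_i :> R & @grid R m i t.
  rewrite /D -bigcup_seq; split=> [[i /=]|[i [si s2] ti]].
    by rewrite mem_filter mem_iota add0n => /andP[s2 /andP[_ si]] ti; exists i.
  by exists i => //=; rewrite mem_filter mem_iota add0n s2.
have uS : uniq S by rewrite filter_uniq// iota_uniq.
have triv : trivIset [set` S] (@grid R m).
  apply/trivIsetP => i j _ _ /eqP ij; apply/seteqP; split => // t [ti tj].
  by apply: ij; exact: grid_inj ti tj.
have DJ : D `<=` J.
  move=> t /DP[i [si _]]; rewrite /grid/J/= !in_itv/= => /andP[t1 t2].
  apply/andP; split; first by apply: le_trans t1; rewrite divr_ge0.
  apply: lt_le_trans t2 _; rewrite ler_pdivrMr ?ltr0n// -natrM ler_nat.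
  exact: leq_trans sk.
have close : (lam (J `&` [set t | (2^-1)%:E <= `|(\1_A t - grid_step m s t)%:E|]) <= (2 * h)%:E)%E.
  have m2 : measurable_fun J (fun t => (\1_A t - grid_step m s t)%:E).
    apply/measurable_EFinP/measurable_funTS/measurable_funB; first exact: measurable_indic.
    exact: measurable_grid_step.
  have half0 : 0 < 2^-1 :> R by rewrite invr_gt0.
  have := le_integral_abse lam mJ m2 half0.
  move=> /le_trans/(_ As); rewrite -lee_pdivlMl// invrK => /le_trans; apply.
  by rewrite -EFinM.
have diff1 : A `\` D `<=` J `&` [set t | ((2^-1)%:E <= `|(\1_A t - grid_step m s t)%:E|)%E].
  move=> t [At Dt]; have Jt := Ak _ At; split => //=; rewrite lee_fin indicE mem_set//.
  have gs : grid_step m s t <= 2^-1.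
    have [[i [si ti]]|nt] := pselect (exists i, (i < size s)%N /\ @grid R m i t).
      rewrite (grid_stepE si ti) leNgt; apply/negP => s2.
      by apply: Dt; apply/DP; exists i.
    by rewrite grid_step_out ?invr_ge0// => i si ti; apply: nt; exists i.
  by apply: le_trans (ler_norm _); rewrite lerBrDl; move: gs => /= gs; lra.
have diff2 : D `\` A `<=` J `&` [set t | ((2^-1)%:E <= `|(\1_A t - grid_step m s t)%:E|)%E].
  move=> t [Dt At]; split; first exact: DJ.
  rewrite /= lee_fin indicE memNset// sub0r normrN.
  have [i [si s2] ti] := (DP t).1 Dt.
  by rewrite (grid_stepE si ti); apply: le_trans (ler_norm _); exact: ltW.
have mclose : measurable (J `&` [set t | ((2^-1)%:E <= `|(\1_A t - grid_step m s t)%:E|)%E]).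
  have m2 : measurable_fun J (fun t => `|(\1_A t - grid_step m s t)%:E|%E).
    apply: measurableT_comp => //.
    apply/measurable_EFinP/measurable_funTS/measurable_funB; first exact: measurable_indic.
    exact: measurable_grid_step.
  by have := emeasurable_fun_c_infty mJ m2; apply.
have lamAD : (lam (A `\` D) <= (2 * h)%:E)%E.
  by apply: le_trans close; apply: le_measure; rewrite ?inE//; exact: measurableD.
have lamDA : (lam (D `\` A) <= (2 * h)%:E)%E.
  by apply: le_trans close; apply: le_measure; rewrite ?inE//; exact: measurableD.
have lamD : lam D = ((size S)%:R / m.+1%:R)%:E.
  have := @ge0_integral_bigsetU _ _ R lam _ (@grid R m) (cst 1%E) S (@measurable_grid R m) uS triv.
  rewrite /= -/D => /(_ (measurable_cst _) (fun _ _ => lee01)).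
  rewrite integral_cst// mul1e => ->.
  rewrite (eq_bigr (fun=> (m.+1%:R^-1)%:E)) => [|i _]; last first.
    rewrite integral_cst; last exact: measurable_grid.
    rewrite mul1e; change (lam (@grid R m i) = (m.+1%:R^-1)%:E).
    rewrite /grid lebesgue_measure_itv/= lte_fin ltr_pM2r ?invr_gt0// ltr_nat ltnSn.
    by rewrite -EFinD -mulrBl -[i.+1%:R]natr1 addrAC subrr add0r mul1r.
  by rewrite sumEFin big_const_seq count_predT iter_addr addr0 mulr_natl.
have sizeD : (size S)%:R / m.+1%:R <= a.
  rewrite -lee_fin -lamD.
  apply: (@le_trans _ _ (lam A + lam (D `\` A))%E).
    apply: (@le_trans _ _ (lam (A `|` (D `\` A)))).
      apply: le_measure; rewrite ?inE//; first by apply: measurableU => //; exact: measurableD.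
      by move=> t Dt; have [At|At] := pselect (A t); [left|right].
    by apply: measureU2 => //; exact: measurableD.
  rewrite [leRHS](_ : _ = ((a / 2) + (a / 2))%:E); last by rewrite -splitr.
  rewrite EFinD lamA; apply: leeD; first exact: ltW.
  apply: le_trans lamDA _; rewrite lee_fin.
  have : h <= a / 8 by rewrite ge_min lexx orbT.
  by move: (h) => ?; lra.
have S0 : all (leq 0) S by apply/allP.
have [f' [Ef' nf' _ sum']] := ri_gather hE m Ef uS S0.
apply: (@le_trans _ _ (\int[mu]_(t in D) `|f t|%:E + \int[mu]_(t in A `\` D) `|f t|%:E)%E).
  rewrite -ge0_integral_setU//; last 3 first.
  - exact: measurableD.
  - exact: measurable_norm_EFin.
  - by rewrite disj_set2E; apply/eqP/seteqP; split => // t [Dt []].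
  apply: ge0_subset_integral => //.
  - by apply: measurableU => //; exact: measurableD.
  - exact: measurable_norm_EFin.
  - by move=> t At; have [Dt|Dt] := pselect (D t); [left|right].
rewrite (splitr e) EFinD; apply: leeD; last first.
  apply: Hd; first exact: measurableD.
    by move=> t [At _]; exact: Ak.
  rewrite half_line_lebesgue; last first.
    by move=> t [At _]; apply: itv_half_line; exact: Ak _ At.
  apply: le_lt_trans lamAD _; rewrite lte_fin.
  have : h <= d / 8 by rewrite ge_min lexx.
  by move: (h) => ?; lra.
rewrite ge0_integral_bigsetU//; last 2 first.
  - by move=> i; exact: measurable_grid.
  - exact: measurable_norm_EFin.
(* [f'] has the norm of f and carries the mass of D on initial cells, inside [0, a[, where [small]
   applies. *)
rewrite [leLHS]sum'.
apply: le_trans (Ha f' Ef' _); last by rewrite nf'.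
rewrite -(@ge0_integral_bigsetU _ _ R mu _ (fun i : 'I_(size S) => @grid R m (0 + i)))//; last 4 first.
- by move=> i; exact: measurable_grid.
- by rewrite /index_enum -enumT; exact: enum_uniq.
- apply/trivIsetP => i1 i2 _ _ /eqP i12; apply/seteqP; split => // t [t1 t2].
  by apply: i12; apply: val_inj; have := grid_inj t1 t2; rewrite !add0n.
- exact: measurable_norm_EFin.
apply: ge0_subset_integral => //.
- by apply: bigsetU_measurable => i _; exact: measurable_grid.
- exact: measurable_norm_EFin.
move=> t; rewrite -(bigcup_mkord _ (fun i => @grid R m (0 + i))) => -[i /= iS].
rewrite add0n /grid/= !in_itv/= => /andP[t1 t2]; apply/andP; split.
  by apply: le_trans t1; rewrite divr_ge0.
apply: lt_le_trans t2 _; apply: le_trans sizeD.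
by rewrite ler_pM2r ?invr_gt0// ler_nat.
Qed.

End small_sets.

(** * Averaging over translations *)

Section convolution.
Variable R : realType.
Local Notation X := (measurableTypeR R).
Local Notation lam := (@lebesgue_measure R).

Lemma measurable_indicator (A : set X) : measurable A -> exists p : X -> R,
  [/\ measurable_fun setT p, forall x, 0 <= p x, forall x, A x -> p x = 1 &
      forall x, ~ A x -> p x = 0].
Proof.
move=> mA; exists \1_A; split; first exact: measurable_indic.
- by [].
- by move=> x Ax; rewrite indicE mem_set.
- by move=> x Ax; rewrite indicE memNset.
Qed.

(* Tonelli: average the hypothesis over the translations x in [al, be]. *)
Lemma convolution_interval_le (k g : X -> R) (a al be : R) :
  measurable_fun setT k -> measurable_fun setT g -> (forall t, 0 <= k t) ->
  a <= al -> al <= be ->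
  (forall x, a <= x -> (\int[lam]_(u in `[0%R, a[) (`|g u| * k (x + u)%R)%:E <= 1)%E) ->
  ((\int[lam]_(t in `[0%R, a[) `|g t|%:E) * \int[lam]_(t in `[(al + a)%R, be]) (k t)%:E
    <= (be - al)%:E)%E.
Proof.
move=> mhT mfT h0 aal albe tb.
pose I : set X := `[al, be]%classic; pose J : set X := `[0, a[%classic.
have mI : measurable I by exact: measurable_itv.
have mJ : measurable J by exact: measurable_itv.
pose H := (\int[lam]_(t in `[(al + a)%R, be]) (k t)%:E)%E.
have H0 : (0 <= H)%E by apply: integral_ge0 => t _; rewrite lee_fin.
have [p [mp p0 pin pout]] := measurable_indicator mI.
have [j [mj j0 jin jout]] := measurable_indicator mJ.
have mg : measurable_fun setT (fun t => `|g t|) by exact: measurableT_comp.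
pose q (u : X) := j u * `|g u|.
have mq : measurable_fun setT q by exact: measurable_funM.
have q0 u : 0 <= q u by rewrite mulr_ge0.
have qin u : J u -> q u = `|g u| by move=> Ju; rewrite /q jin// mul1r.
have qout u : ~ J u -> q u = 0 by move=> Ju; rewrite /q jout// mul0r.
clearbody q.
have [s sE ms] : exists2 s : X -> X -> X, s = (fun x u => x + u) &
    measurable_fun [set: X * X] (fun z => s z.1 z.2).
  exists (fun x u => x + u) => //.
  by apply: measurable_funD; [exact: measurable_fst|exact: measurable_snd].
pose Phi (z : X * X) : \bar R := (p z.1 * q z.2 * k (s z.1 z.2))%:E.
have mPhi : measurable_fun setT Phi.
  apply/measurable_EFinP; apply: measurable_funM; last exact: (measurableT_comp mhT ms).
  apply: measurable_funM.
    by apply: measurableT_comp => //; exact: measurable_fst.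
  by apply: measurableT_comp => //; exact: measurable_snd.
have Phi0 z : (0 <= Phi z)%E by rewrite lee_fin !mulr_ge0.
have inner1 x : (\int[lam]_u Phi (x, u) <= (p x)%:E)%E.
  have [Ix|Ix] := pselect (I x); last first.
    rewrite integral0_eq; first by rewrite lee_fin.
    by move=> u _; rewrite /Phi pout//= !mul0r.
  rewrite (pin _ Ix).
  apply: le_trans (tb x _); last first.
    by apply: le_trans aal _; move: Ix; rewrite /I/= in_itv/= => /andP[].
  rewrite le_eqVlt; apply/orP; left; apply/eqP.
  rewrite [RHS]integral_mkcond; apply: eq_integral => u _.
  rewrite /Phi/= pin// mul1r patchE sE; have [Ju|Ju] := pselect (J u).
    by rewrite (mem_set Ju) qin.
  by rewrite (memNset Ju) qout// mul0r.
have inner2 u : ((q u)%:E * H <= \int[lam]_x Phi (x, u))%E.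
  have [Ju|Ju] := pselect (J u); last first.
    by rewrite qout// mul0e; exact: integral_ge0.
  have mks : measurable_fun setT (fun x : X => (k (s x u))%:E).
    by apply/measurable_EFinP/(measurableT_comp mhT); rewrite sE; exact: measurable_funD.
  rewrite (_ : (\int[lam]_x _)%E = (q u)%:E * \int[lam]_(x in I) (k (s x u))%:E)%E; last first.
    rewrite [X in (_ * X)%E]integral_mkcond -ge0_integralZl//; last 3 first.
    - by apply/(measurable_restrictT _ mI); exact: measurable_funTS.
    - by move=> x _; rewrite patchE; case: ifP => _ //; rewrite lee_fin.
    - by rewrite lee_fin.
    apply: eq_integral => x _; rewrite /Phi/= patchE; have [Ix|Ix] := pselect (I x).
      by rewrite (mem_set Ix) pin// mul1r EFinM.
    by rewrite (memNset Ix) pout// !mul0r mule0.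
  apply: lee_wpmul2l; first by rewrite lee_fin.
  have mhE : measurable_fun setT (fun t => (k t)%:E) by exact/measurable_EFinP.
  have kE t : (0 <= (k t)%:E)%E by rewrite lee_fin.
  have := @ge0_integral_affine R 1 u `[(al + u)%R, (be + u)%R]%classic (fun t => (k t)%:E) ltr01
    (measurable_itv _) mhE kE.
  rewrite mul1e (_ : affine 1 u @^-1` _ = I); last first.
    by apply/seteqP; split => t; rewrite /I /affine/= mul1r !in_itv/= !lerD2r.
  rewrite (_ : (\int[lam]_(t in I) _)%E = \int[lam]_(t in I) (k (s t u))%:E)%E; last first.
    by apply: eq_integral => t _; rewrite /affine mul1r sE.
  move=> E1.
  apply: (@le_trans _ _ (\int[lam]_(t in `[(al + u)%R, (be + u)%R]) (k t)%:E)%E); last first.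
    by rewrite le_eqVlt; apply/orP; left; apply/eqP; symmetry; exact: E1.
  apply: ge0_subset_integral; [exact: measurable_itv|exact: measurable_itv| | |].
  - exact: measurable_funTS.
  - by move=> t _; exact: kE.
  (* As 0 <= u < a, every translate [al + u, be + u] contains [al + a, be]. *)
  move=> t; move: Ju; rewrite /J/= !in_itv/= => /andP[u0 ua] /andP[t1 t2].
  by apply/andP; split; [apply: le_trans t1; rewrite lerD2l ltW|apply: le_trans t2 _; rewrite lerDl].
apply: (@le_trans _ _ (\int[lam]_x \int[lam]_u Phi (x, u))%E); last first.
  apply: (@le_trans _ _ (\int[lam]_x (p x)%:E)%E).
    apply: ge0_le_integral => //.
    - by move=> x _; exact: integral_ge0.
    - exact: measurable_fun_fubini_tonelli_F.
    - exact/measurable_EFinP.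
  rewrite (_ : (\int[lam]_x _)%E = \int[lam]_(x in I) 1)%E; last first.
    rewrite [RHS]integral_mkcond; apply: eq_integral => x _; rewrite patchE.
    have [Ix|Ix] := pselect (I x); first by rewrite (mem_set Ix) pin.
    by rewrite (memNset Ix) pout.
  rewrite integral_cst// mul1e; change (lam I <= (be - al)%:E)%E.
  rewrite /I lebesgue_measure_itv/= lte_fin.
  by case: ifP => // _; rewrite lee_fin subr_ge0.
rewrite (@fubini_tonelli _ _ X X R lam lam Phi mPhi Phi0).
apply: (@le_trans _ _ (\int[lam]_u ((q u)%:E * H))%E).
  rewrite ge0_integralZr//; last 2 first.
  - exact/measurable_EFinP.
  - by move=> u _; rewrite lee_fin.
  apply: lee_wpmul2r => //.
  rewrite (_ : (\int[lam]_u (q u)%:E)%E = \int[lam]_(u in J) `|g u|%:E)%E//.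
  rewrite [RHS]integral_mkcond; apply: eq_integral => u _.
  rewrite patchE; have [Ju|Ju] := pselect (J u); first by rewrite (mem_set Ju) qin.
  by rewrite (memNset Ju) qout.
apply: ge0_le_integral => //.
- by move=> u _; rewrite mule_ge0 ?lee_fin.
- by apply: emeasurable_funM => //; exact/measurable_EFinP.
- exact: measurable_fun_fubini_tonelli_G.
Qed.

End convolution.

(** * Boundedness of the dual ball when mass concentrates on short intervals *)

Section dual_bounded.
Variable R : realType.
Local Notation mu := (lebesgue_half_line R).
Local Notation lam := (@lebesgue_measure R).
Local Notation X := (measurableTypeR R).
Local Notation F := {mfun X >-> R}.
Variables (E : set F) (nrm : F -> R).
Hypothesis hE : rearrangement_invariant E nrm.
Variable c : R.
Hypothesis c0 : 0 < c.
Hypothesis large : forall a : R, 0 < a -> exists f, [/\ E f, nrm f <= 1 &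
  (c%:E <= \int[mu]_(t in `[0%R, a[) `|f t|%:E)%E].

(** Exchanging [0, a[ with [x, x + a[, disjoint because a <= x, keeps the norm of f and brings its
    initial piece against the values of h after x. *)
Lemma translate_bound (h : F) (a x : R) (f : F) : pos_dual E nrm h -> 0 <= a -> a <= x ->
  E f -> nrm f <= 1 ->
  (\int[lam]_(u in `[0%R, a[) (`|f u| * h (x + u)%R)%:E <= 1)%E.
Proof.
move=> [h0 hf] a0 ax Ef f1.
have xa : 0 + a <= x by rewrite add0r.
have [f' [Ef' nf' f'E]] := ri_swap hE (lexx 0) a0 xa Ef.
have := hf f' Ef'; rewrite nf' => /le_trans/(_ (_ : _ <= 1%:E)%E) H.
have {H} : (\int[mu]_t `|f' t * h t|%:E <= 1)%E by apply: H; rewrite lee_fin.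
apply: le_trans.
pose D : set X := `[x, x + a[%classic.
have mD : measurable D by exact: measurable_itv.
have mfh : measurable_fun setT (fun t => `|f' t * h t|%:E) by exact: measurable_norm_mul.
apply: (@le_trans _ _ (\int[mu]_(t in D) `|f' t * h t|%:E)%E); last first.
  by apply: ge0_subset_integral.
rewrite ge0_integral_half_line; last first.
  move=> t; rewrite /D/= !in_itv/= andbT => /andP[xt _].
  by apply: le_trans xt; exact: le_trans ax.
have := @ge0_integral_affine R 1 x D _ ltr01 mD mfh (fun t => normr_ge0 _).
rewrite mul1e => <-.
have -> : affine 1 x @^-1` D = `[0, a[%classic.
  apply/seteqP; split => t; rewrite /D /affine/= mul1r !in_itv/=;
  by rewrite lerDr [x + a]addrC ltrD2r.
rewrite le_eqVlt; apply/orP; left; apply/eqP; apply: eq_integral => u.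
rewrite inE/= in_itv/= => ua; congr EFin.
have xu : x <= x + u < x + a by case/andP: ua => u0 ua; rewrite lerDl u0 ltrD2l.
have -> : affine 1 x u = x + u by rewrite /affine mul1r addrC.
rewrite f'E (swap_right xa xu) normrM (ger0_norm (h0 _)).
by rewrite subr0 addrAC subrr add0r.
Qed.

Lemma interval_bound_shift (h : F) (a al be : R) : pos_dual E nrm h ->
  0 < a -> a <= al -> al <= be ->
  (c%:E * \int[lam]_(t in `[(al + a)%R, be]) (h t)%:E <= (be - al)%:E)%E.
Proof.
move=> hd a0 aal albe; have [f [Ef f1 fc]] := large a0.
have tb x (ax : a <= x) := translate_bound hd (ltW a0) ax Ef f1.
have [h0 _] := hd.
have mh : measurable_fun setT (h : X -> R) by [].
have mf : measurable_fun setT (f : X -> R) by [].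
apply: le_trans (convolution_interval_le mh mf h0 aal albe tb).
apply: lee_wpmul2r; first by apply: integral_ge0 => t _; rewrite lee_fin.
apply: le_trans fc _; rewrite ge0_integral_half_line//.
by move=> t; rewrite /= !in_itv/= andbT => /andP[].
Qed.

(** The shifted estimate loses a length a on the left, so it is applied from al - a with a tending
    to 0; a <= al / 2 gives the required a <= al - a. *)
Lemma interval_bound (h : F) (al be : R) : pos_dual E nrm h -> 0 < al -> al <= be ->
  (c%:E * \int[lam]_(t in `[al, be]) (h t)%:E <= (be - al)%:E)%E.
Proof.
move=> hd al0 albe; apply/lee_addgt0Pr => e e0.
pose a := Num.min e (al / 2).
have al2 : 0 < al / 2 by rewrite divr_gt0.
have a0 : 0 < a by rewrite lt_min e0.
have ae : a <= e by rewrite ge_min lexx.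
have a2 : a <= al / 2 by rewrite ge_min lexx orbT.
have h1 : a <= al - a by lra.
have h2 : al - a <= be by lra.
have := interval_bound_shift hd a0 h1 h2; rewrite subrK => /le_trans; apply.
by rewrite -EFinD lee_fin; lra.
Qed.

(* The averages of h over intervals are at most 1/c, so its Lebesgue points are. *)
Lemma pos_dual_bounded (h : F) : pos_dual E nrm h -> lam.-integrable setT (EFin \o h) ->
  {ae mu, forall t, h t <= c^-1}.
Proof.
move=> hd ih; have [h0 _] := hd.
have loch : locally_integrable setT h by apply: open_integrable_locally => //; exact: openT.
have [N [mN lN hN]] := lebesgue_differentiation loch.
(* Besides the points that are not Lebesgue points, t <= 0 is excluded, so that small balls around t
   stay among the positive reals; on the half-line this removes only 0. *)
exists (N `|` (~` `]0, +oo[%classic)); split.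
- by apply: measurableU => //; apply: measurableC; exact: measurable_itv.
- rewrite /lebesgue_half_line /= /mrestr; apply/eqP; rewrite eq_le measure_ge0 andbT.
  apply: (@le_trans _ _ (lam (N `|` [set 0]))).
    apply: le_measure; rewrite ?inE.
    + apply: measurableI; last exact: measurable_itv.
      by apply: measurableU => //; apply: measurableC; exact: measurable_itv.
    + by apply: measurableU => //; exact: measurable_set1.
    + move=> t [[Nt|/= nt]]; first by left.
      rewrite /= !in_itv/= !andbT in nt * => t0; right => /=.
      by apply/eqP; rewrite eq_le t0 andbT leNgt; exact/negP.
  apply: (le_trans (measureU2 _ mN (measurable_set1 0))).
  change (lam N + lam [set 0%R] <= 0)%E; by rewrite lN lebesgue_measure_set1 adde0.
move=> t /= ht; have [tN|tN] := pselect (N t); [by left|right] => /=.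
rewrite in_itv/= andbT => t0; apply: ht.
have tleb : lebesgue_pt h t by apply: contrapT => nt; apply: tN; exact: hN.
have r0 n : 0 < n.+1%:R^-1 :> R by rewrite invr_gt0.
pose B (x : R) (n : nat) : set R := ball x n.+1%:R^-1.
have shrink x : nicely_shrinking x (B x).
  split; first by move=> n; exact: measurable_ball.
  exists (1, fun n => PosNum (r0 n)); split => //=; [exact: cvg_harmonic|by move=> n y|].
  by move=> n; rewrite mul1e.
have := nice_lebesgue_differentiation shrink loch tleb.
move=> hcvg; rewrite -lee_fin -(cvg_lim _ hcvg)//; apply: lime_le.
  by apply/cvg_ex; exists (h t)%:E.
near=> n.
have nt : n.+1%:R^-1 < t by near: n; exact: (near_infty_natSinv_lt (PosNum t0)).
rewrite /B lebesgue_measure_ball ?(ltW (r0 n))// inver ifF; last first.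
  by apply/negbTE; rewrite mulrn_eq0/= gt_eqF.
rewrite lee_pdivrMl ?mulrn_wgt0//.
apply: (@le_trans _ _ (\int[lam]_(y in `[(t - n.+1%:R^-1)%R, (t + n.+1%:R^-1)%R]) (h y)%:E)%E).
  apply: ge0_subset_integral => //; first exact: measurable_ball.
  - exact/measurable_EFinP/measurable_funTS.
  - by move=> y _; rewrite lee_fin.
  - by rewrite ball_itv => y; rewrite /= !in_itv/= => /andP[y1 y2]; rewrite !ltW.
have al0 : 0 < t - n.+1%:R^-1 by rewrite subr_gt0.
have albe : t - n.+1%:R^-1 <= t + n.+1%:R^-1 by rewrite lerD2l (le_trans _ (ltW (r0 n)))// oppr_le0 ltW.
have := interval_bound hd al0 albe; rewrite -lee_pdivlMl// => /le_trans; apply.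
rewrite -!EFinM lee_fin mulrC ler_pM2r ?invr_gt0//.
by rewrite opprD opprK addrACA subrr add0r mulr2n.
Unshelve. all: by end_near. Qed.

End dual_bounded.

(** * A countable norming family of bounded functions *)

Section countable_norming.
Variable R : realType.
Local Notation mu := (lebesgue_half_line R).
Local Notation lam := (@lebesgue_measure R).
Local Notation X := (measurableTypeR R).
Local Notation F := {mfun X >-> R}.
Variables (E : set F) (nrm : F -> R).
Hypothesis hE : rearrangement_invariant E nrm.

Definition bounded_dual (k : nat) (h : F) : Prop :=
  pos_dual E nrm h /\ forall t, h t <= k%:R * \1_(`[0, k%:R[%classic : set X) t.

Lemma bounded_dual0 : bounded_dual 0 (cst 0).
Proof.
split; last by move=> t; rewrite mul0r.
split=> [t|f Ef] //; rewrite integral0_eq.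
  by rewrite lee_fin (ri_norm_ge0 hE).
by move=> t _; rewrite mulr0 normr0.
Qed.

Definition truncate (k : nat) (f : X -> R) (t : X) : R :=
  Num.min `|f t| k%:R * \1_(`[0, k%:R[%classic : set X) t.

Lemma measurable_truncate k (f : F) : measurable_fun setT (truncate k f).
Proof.
apply: measurable_funM; last by apply: measurable_indic; exact: measurable_itv.
by apply: measurable_minr => //; exact: measurableT_comp.
Qed.

Lemma truncate_ge0 k f t : 0 <= truncate k f t.
Proof. by rewrite mulr_ge0// le_min normr_ge0/=. Qed.

Lemma truncate_le k f t : truncate k f t <= `|f t|.
Proof.
rewrite /truncate indicE; case: (_ \in _); rewrite ?mulr1 ?mulr0//.
by rewrite ge_min lexx.
Qed.

Lemma truncate_le_indic k f t :
  truncate k f t <= k%:R * \1_(`[0, k%:R[%classic : set X) t.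
Proof. by rewrite ler_wpM2r// ge_min lexx orbT. Qed.

Lemma truncate_nd f t : nondecreasing_seq (fun k => truncate k f t).
Proof.
move=> m n mn; rewrite /truncate; apply: ler_pM; rewrite ?le_min ?normr_ge0//=.
  by rewrite !ge_min lexx/= ler_nat mn orbT.
rewrite !indicE; have [tm|tm] := pselect ((`[0, m%:R[%classic : set X) t); last first.
  by rewrite (memNset tm).
rewrite !mem_set//=; move: tm; rewrite /= !in_itv/= => /andP[-> tm]/=.
by apply: lt_le_trans tm _; rewrite ler_nat.
Qed.

(** Truncations vanish at negative points, so they converge to |f| on the half-line only, and
    monotone convergence needs that domain explicitly. *)
Lemma ge0_integral_half_lineT (f : X -> \bar R) : measurable_fun setT f ->
  (forall t, 0 <= f t)%E ->
  (\int[mu]_t f t = \int[mu]_(t in `[0%R, +oo[) f t)%E.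
Proof.
move=> mf f0; have m0 : measurable (`]-oo, 0%R[%classic : set X) by exact: measurable_itv.
rewrite (@ge0_negligible_integral _ _ _ mu setT `]-oo, 0%R[%classic)//.
  congr integral; apply/seteqP; split => t /=; rewrite !in_itv/= andbT.
    by move=> [_ /negP]; rewrite -leNgt.
  by move=> t0; split => //; apply/negP; rewrite -leNgt.
rewrite /lebesgue_half_line /= /mrestr (_ : _ `&` _ = set0) ?measure0//.
apply/seteqP; split => t //= [].
by rewrite !in_itv/= andbT => t1 t2; have := lt_le_trans t1 t2; rewrite ltxx.
Qed.

Lemma truncate_cvg f t : 0 <= t -> exists N, forall k, (N <= k)%N -> truncate k f t = `|f t|.
Proof.
move=> t0; exists (maxn (Num.truncn t).+1 (Num.truncn `|f t|).+1) => k; rewrite geq_max => /andP[k1 k2].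
have /andP[_ h1] := truncn_itv t0; have /andP[_ h2] := truncn_itv (normr_ge0 (f t)).
rewrite /truncate indicE mem_set/= ?in_itv/= ?t0/= ?mulr1.
  by apply/min_idPl; apply: le_trans (ltW h2) _; rewrite ler_nat.
by apply: lt_le_trans h1 _; rewrite ler_nat.
Qed.

(** By monotone convergence the integrals of [truncate k f * truncate k h] increase to that of |f
    h|. *)
Lemma bounded_dual_norming (f : F) (e : R) : E f -> 0 < e -> exists k h,
  bounded_dual k h /\ ((nrm f - e)%:E < \int[mu]_t (truncate k f t * h t)%:E)%E.
Proof.
move=> Ef e0; have [h hd fh] := pos_dual_norming hE Ef e0.
pose u k (t : X) : \bar R := (truncate k f t * truncate k h t)%:E.
have mu' k : measurable_fun setT (u k).
  by apply/measurable_EFinP; apply: measurable_funM; exact: measurable_truncate.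
have u0 k t : setT t -> (0 <= u k t)%E by move=> _; rewrite lee_fin mulr_ge0// truncate_ge0.
have nd t : setT t -> nondecreasing_seq (u^~ t).
  move=> _ m n mn; rewrite lee_fin ler_pM ?truncate_ge0//; exact: truncate_nd.
have mD : measurable (`[0, +oo[%classic : set X) by exact: measurable_itv.
have uk_half k : (\int[mu]_t u k t = \int[mu]_(t in `[0%R, +oo[) u k t)%E.
  by apply: ge0_integral_half_lineT => // t; exact: u0.
have mon := @cvg_monotone_convergence _ _ _ mu _ mD _ (fun n => measurable_funTS (mu' n))
  (fun n t _ => u0 n t I) (fun t _ => nd t I).
have [k uk] : exists k, ((nrm f - e)%:E < \int[mu]_t u k t)%E.
  apply: contrapT => none; move: fh; rewrite ltNge => /negP; apply.
  rewrite ge0_integral_half_lineT//; last exact: measurable_norm_mul.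
  rewrite (_ : (\int[mu]_(t in _) _)%E = \int[mu]_(t in `[0%R, +oo[) limn (u^~ t))%E.
    rewrite -(cvg_lim _ mon)//; apply: lime_le; first by apply/cvg_ex; eexists; exact: mon.
    near=> k; rewrite -uk_half leNgt; apply/negP => uk; apply: none; exists k.
    exact: uk.
  apply: eq_integral => t; rewrite inE/= in_itv/= andbT => t0.
  have [N1 fN] := truncate_cvg f t0; have [N2 hN] := truncate_cvg h t0.
  apply/esym/cvg_lim => //; apply: cvg_near_cst; near=> k.
  by rewrite /u fN ?hN ?normrM//; near: k; exact: nbhs_infty_ge.
exists k, (mfun_of (measurable_truncate k h)); split => //.
split; last by move=> t; exact: truncate_le_indic.
apply: (pos_dual_solid hd) => t; rewrite truncate_ge0/=.
by apply: le_trans (truncate_le _ _ _) _; rewrite ger0_norm//; case: hd.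
Unshelve. all: by end_near. Qed.

(** An L^1 error e costs at most k e since [h] is bounded by k; stated without subtraction, as the
    integrals are extended reals. *)
Lemma weighted_integral_le (D : set X) (p q w h : X -> R) (k : nat) (e : R) :
  measurable D -> measurable_fun setT p -> measurable_fun setT q ->
  measurable_fun setT w -> measurable_fun setT h ->
  (forall t, 0 <= p t) -> (forall t, 0 <= q t) -> (forall t, 0 <= w t) ->
  (forall t, 0 <= h t <= k%:R) -> (forall t, p t <= q t + w t) ->
  (\int[lam]_(t in D) (w t)%:E <= e%:E)%E ->
  (\int[lam]_(t in D) (p t * h t)%:E <= \int[lam]_(t in D) (q t * h t)%:E + (k%:R * e)%:E)%E.
Proof.
move=> mD mp mq mw mh p0 q0 w0 h01 pqw we.
have h0 t : 0 <= h t by case/andP: (h01 t).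
have mqh : measurable_fun D (fun t => (q t * h t)%:E).
  by apply/measurable_EFinP/measurable_funTS; exact: measurable_funM.
have mwE : measurable_fun D (fun t => (w t)%:E).
  exact/measurable_EFinP/measurable_funTS.
apply: (@le_trans _ _ (\int[lam]_(t in D) ((q t * h t)%:E + k%:R%:E * (w t)%:E))%E).
  apply: ge0_le_integral => //.
  - by move=> t _; rewrite lee_fin mulr_ge0.
  - by apply/measurable_EFinP/measurable_funTS; exact: measurable_funM.
  - by apply: emeasurable_funD => //; exact: measurable_funeM.
  - move=> t _; rewrite -EFinM -EFinD lee_fin.
    apply: (@le_trans _ _ ((q t + w t) * h t)); first by rewrite ler_wpM2r.
    by rewrite mulrDl lerD2l mulrC ler_wpM2r//; case/andP: (h01 t).
rewrite ge0_integralD//; last 3 first.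
- by move=> t _; rewrite lee_fin mulr_ge0.
- by move=> t _; rewrite mule_ge0 ?lee_fin.
- exact: measurable_funeM.
apply: leeD => //; rewrite ge0_integralZl//; last by move=> t _; rewrite lee_fin.
by rewrite EFinM; apply: lee_wpmul2l => //; rewrite lee_fin.
Qed.

Lemma bounded_dual_le k h t : bounded_dual k h -> 0 <= h t <= k%:R.
Proof.
move=> [[h0 _] hk]; rewrite h0/=; apply: le_trans (hk t) _.
by rewrite indicE; case: (_ \in _); rewrite ?mulr1// mulr0.
Qed.

Lemma bounded_dualS k h : bounded_dual k h -> bounded_dual k.+1 h.
Proof.
move=> [hd hk]; split => // t; apply: le_trans (hk t) _.
apply: ler_pM => //; first by rewrite ler_nat.
rewrite !indicE; have [tm|tm] := pselect ((`[0, k%:R[%classic : set X) t); last first.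
  by rewrite (memNset tm).
rewrite !mem_set//=; move: tm; rewrite /= !in_itv/= => /andP[-> tm]/=.
by apply: lt_le_trans tm _; rewrite ler_nat.
Qed.

(* Choosing, for each step function phi with rational data and each rational q,
   some h in the dual ball with \int phi h > q gives a countable norming family,
   because phi ranges over an L^1-dense set and h is bounded. *)
Lemma countable_norming : exists (u : nat -> F) (kap : nat -> nat),
  (forall n, (0 < kap n)%N /\ bounded_dual (kap n) (u n)) /\
  forall f (e : R), E f -> 0 < e -> exists n,
    ((nrm f - e)%:E < \int[mu]_t `|f t * u n t|%:E)%E.
Proof.
pose I := (nat * nat * seq rat * rat)%type.
pose val (i : I) (h : F) : \bar R :=
  (\int[lam]_(t in `[0%R, i.1.1.1%:R[) (`|@grid_step R i.1.1.2 i.1.2 t| * h t)%:E)%E.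
pose good (i : I) (h : F) := bounded_dual i.1.1.1 h /\ ((ratr i.2)%:E < val i h)%E.
have choice (i : I) : {h : F | bounded_dual i.1.1.1 h /\ ((exists h', good i h') -> good i h)}.
  apply: cid; have [[h hi]|nh] := pselect (exists h, good i h).
    by exists h; split => //; case: hi.
  exists (cst 0); split; last by move=> /nh.
  split; first by case: bounded_dual0.
  by move=> t; rewrite mulr_ge0.
(* Numbers that encode nothing go to a default index, which is harmless because [choice] gives a
   member of the dual ball for every index. The successor below makes [kap] positive. *)
pose U (n : nat) : I := odflt (0%N, 0%N, [::], 0) (unpickle n).
exists (fun n => sval (choice (U n))), (fun n => (U n).1.1.1.+1); split => [n|f e Ef e0].
  by split => //; apply: bounded_dualS; case: (svalP (choice (U n))).
have e2 : 0 < e / 2 by rewrite divr_gt0.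
have [k [h [hk fh]]] := bounded_dual_norming Ef e2.
pose J : set X := `[0, k%:R[%classic.
have mJ : measurable J by exact: measurable_itv.
pose phi := truncate k f.
have mphi : measurable_fun setT phi by exact: measurable_truncate.
pose eta := e / (8 * k.+1%:R).
have eta0 : 0 < eta by rewrite divr_gt0// mulr_gt0.
have keta : k%:R * eta <= e / 8.
  rewrite /eta invfM [e * _]mulrA mulrCA ler_piMr ?divr_ge0 ?(ltW e0)//.
  by rewrite ler_pdivrMr ?ltr0n// mul1r ler_nat.
have iphi : lam.-integrable `[0, k%:R] (EFin \o phi).
  apply: measurable_bounded_integrable.
  - exact: measurable_itv.
  - change (lam `[0%R, k%:R]%classic < +oo)%E.
    by rewrite lebesgue_measure_itv/=; case: ifP => _; rewrite ?ltry// -EFinD ltry.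
  - exact: measurable_funTS.
  - exists k%:R; split; first exact: num_real.
    move=> M kM t _; rewrite /= ger0_norm ?truncate_ge0//; apply: le_trans (ltW kM).
    apply: le_trans (truncate_le_indic _ _ _) _.
    by rewrite indicE; case: (_ \in _); rewrite ?mulr1// mulr0.
have [m [s [_ phis]]] := grid_step_dense eta0 iphi.
pose d := @grid_step R m s.
have md : measurable_fun setT d by exact: measurable_grid_step.
pose w (t : X) := `|phi t - d t|.
have mw : measurable_fun setT w by apply: measurableT_comp => //; exact: measurable_funB.
have mnd : measurable_fun setT (fun t => `|d t|) by exact: measurableT_comp.
have phi0 t : 0 <= phi t by exact: truncate_ge0.
have phi_mu (g : F) : (forall t, 0 <= g t) ->
    (\int[mu]_t (phi t * g t)%:E = \int[lam]_(t in J) (phi t * g t)%:E)%E.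
  move=> g0; rewrite -ge0_integral_half_line; last exact: itv_half_line.
  rewrite [RHS]integral_mkcond; apply: eq_integral => t _; rewrite patchE.
  have [tJ|tJ] := pselect (J t); first by rewrite (mem_set tJ).
  by rewrite (memNset tJ) /phi /truncate indicE (memNset tJ) mulr0 mul0r.
have cmp1 (g : F) : bounded_dual k g ->
    (\int[lam]_(t in J) (phi t * g t)%:E <= \int[lam]_(t in J) (`|d t| * g t)%:E + (e / 8)%:E)%E.
  move=> gk; apply: (@le_trans _ _ (\int[lam]_(t in J) (`|d t| * g t)%:E + (k%:R * eta)%:E)%E).
    apply: (@weighted_integral_le J phi (fun t => `|d t|) w g k eta) => //.
    - by move=> t; exact: normr_ge0.
    - by move=> t; exact: bounded_dual_le.
    - move=> t; rewrite -{1}(ger0_norm (phi0 t)) -{1}(subrK (d t) (phi t)) addrC.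
      by rewrite [leRHS]addrC (le_trans (ler_normD _ _))// addrC.
  by apply: leeD => //; rewrite lee_fin.
have cmp2 (g : F) : bounded_dual k g ->
    (\int[lam]_(t in J) (`|d t| * g t)%:E <= \int[lam]_(t in J) (phi t * g t)%:E + (e / 8)%:E)%E.
  move=> gk; apply: (@le_trans _ _ (\int[lam]_(t in J) (phi t * g t)%:E + (k%:R * eta)%:E)%E).
    apply: (@weighted_integral_le J (fun t => `|d t|) phi w g k eta) => //.
    - by move=> t; exact: normr_ge0.
    - by move=> t; exact: bounded_dual_le.
    - move=> t; have := ler_normB (phi t) (phi t - d t).
      by rewrite opprB addrC subrK (ger0_norm (phi0 t)).
  by apply: leeD => //; rewrite lee_fin.
(* The budget: h gives more than nrm f - e / 2, and each passage between [phi] and the step function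
   costs e / 8 by the choice of [eta]. So h beats q, and the chosen function gives more than q - e /
   8 > nrm f - e. *)
have ee : nrm f - 3 / 4 * e < nrm f - 5 / 8 * e by lra.
have [q] := rat_in_itvoo ee; rewrite in_itv/= => /andP[q1 q2].
pose i : I := (k, m, s, q).
have gi : good i h.
  split => //; rewrite /val/=.
  have := lt_le_trans fh (_ : _ <= \int[lam]_(t in J) (`|d t| * h t)%:E + (e / 8)%:E)%E.
  rewrite phi_mu; last by move=> t; case/andP: (bounded_dual_le t hk).
  move=> /(_ (cmp1 h hk)); rewrite -/J -/d.
  case: (\int[lam]_(t in J) _)%E => [r| |] //=; rewrite ?ltry//.
  by rewrite -EFinD !lte_fin; lra.
exists (pickle i); rewrite /U pickleK/=.
have [gk ggood] := svalP (choice i); have [_ gq] := ggood (ex_intro _ h gi).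
set g := sval (choice i) in gk gq *.
apply: (@lt_le_trans _ _ (\int[mu]_t (phi t * g t)%:E)%E); last first.
  apply: ge0_le_integral => //.
  - by move=> t _; rewrite lee_fin mulr_ge0//; case/andP: (bounded_dual_le t gk).
  - by apply/measurable_EFinP; exact: measurable_funM.
  - exact: measurable_norm_mul.
  - move=> t _; have /andP[g0 _] := bounded_dual_le t gk.
    by rewrite lee_fin normrM (ger0_norm g0) ler_wpM2r// truncate_le.
rewrite phi_mu; last by move=> t; case/andP: (bounded_dual_le t gk).
have := lt_le_trans gq (cmp2 g gk).
case: (\int[lam]_(t in J) _)%E => [r| |] //=; rewrite ?ltry//.
by rewrite -EFinD !lte_fin; lra.
Qed.

End countable_norming.

(** * Clamping and the tail it cuts off *)

Section clamp.
Variable R : realType.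
Implicit Types (K x y : R).

Definition clamp K x : R := Num.max (- K) (Num.min x K).

Definition tail K x : R := `|x| * (K < `|x|)%R%:R.

Lemma clamp_bound K x : 0 <= K -> `|clamp K x| <= K.
Proof.
move=> K0; rewrite /clamp ler_norml; apply/andP; split; first by rewrite le_max lexx.
by rewrite ge_max ge_min lexx orbT andbT ge0_cp.
Qed.

Lemma clamp_norm K x : 0 <= K -> `|clamp K x| <= `|x|.
Proof.
move=> K0; rewrite /clamp; have [h|h] := leP x K; last first.
  rewrite (max_idPr _) ?ge0_cp// (ger0_norm K0) ltW//.
  by apply: lt_le_trans h _; exact: ler_norm.
have [h'|h'] := leP (- K) x => //.
by rewrite normrN (ger0_norm K0) ltr0_norm; [lra|lra].
Qed.

Lemma clamp_tail K x : 0 <= K -> `|clamp K x - x| <= tail K x.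
Proof.
move=> K0; rewrite /tail; have [h|h] := ltP K `|x|; last first.
  move: h; rewrite ler_norml => /andP[h1 h2].
  by rewrite /clamp (min_idPl h2) (max_idPr h1) subrr normr0 mulr0.
rewrite mulr1 /clamp; have [h1|h1] := leP x K; last first.
  have x0 : 0 < x by apply: le_lt_trans h1.
  rewrite (max_idPr _) ?ge0_cp// (gtr0_norm x0) ler0_norm; lra.
have [h2|h2] := leP (- K) x; first by rewrite subrr normr0.
have x0 : x < 0 by lra.
by rewrite (ltr0_norm x0) ger0_norm; lra.
Qed.

Lemma clamp_homo K : {homo clamp K : x y / x <= y}.
Proof.
move=> x y xy; rewrite /clamp ge_max !le_max lexx/=; apply/orP; right.
by rewrite le_min !ge_min xy lexx orbT.
Qed.

Lemma clamp_max K x y : clamp K (Num.max x y) = Num.max (clamp K x) (clamp K y).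
Proof.
by have [xy|/ltW xy] := leP x y;
  [rewrite (max_idPr (clamp_homo K xy))|rewrite (max_idPl (clamp_homo K xy))].
Qed.

Lemma clamp_min K x y : clamp K (Num.min x y) = Num.min (clamp K x) (clamp K y).
Proof.
by have [xy|/ltW xy] := leP x y;
  [rewrite (min_idPl (clamp_homo K xy))|rewrite (min_idPr (clamp_homo K xy))].
Qed.

Lemma tail_ge0 K x : 0 <= tail K x.
Proof. by rewrite mulr_ge0. Qed.

Lemma measurable_clamp d (T : measurableType d) K (f : T -> R) :
  measurable_fun setT f -> measurable_fun setT (fun t => clamp K (f t)).
Proof. by move=> mf; apply: measurable_maxr => //; exact: measurable_minr. Qed.

Lemma tailE d (T : measurableType d) K (f : T -> R) :
  (fun t => tail K (f t)) = (fun t => `|f t| * \1_[set t | K < `|f t|] t).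
Proof.
apply/funext => t; rewrite /tail indicE; congr (_ * _).
by have [h|h] := ltP K `|f t|; [rewrite mem_set|rewrite memNset//= ltNge h].
Qed.

Lemma measurable_gt_norm d (T : measurableType d) K (f : T -> R) :
  measurable_fun setT f -> measurable [set t | K < `|f t|].
Proof.
move=> mf; have mn : measurable_fun setT (fun t => `|f t|) by exact: measurableT_comp.
rewrite (_ : [set _ | _] = setT `&` (fun t => `|f t|) @^-1` `]K, +oo[%classic); last first.
  by rewrite setTI; apply/seteqP; split => t /=; rewrite in_itv/= andbT.
by apply: mn => //; exact: measurable_itv.
Qed.

Lemma measurable_tail d (T : measurableType d) K (f : T -> R) :
  measurable_fun setT f -> measurable_fun setT (fun t => tail K (f t)).
Proof.
move=> mf; rewrite tailE; apply: measurable_funM; first exact: measurableT_comp.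
by apply: measurable_indic; exact: measurable_gt_norm.
Qed.

End clamp.

(** * Choice of the clamping levels *)

Section levels.
Variable R : realType.
Local Notation mu := (lebesgue_half_line R).
Local Notation lam := (@lebesgue_measure R).
Local Notation X := (measurableTypeR R).
Local Notation F := {mfun X >-> R}.
Variables (E : set F) (nrm : F -> R).
Hypothesis hE : rearrangement_invariant E nrm.
Variables (h : nat -> F) (k : nat -> nat).
Hypotheses (k_gt0 : forall n, (0 < k n)%N) (hk : forall n, bounded_dual E nrm (k n) (h n)).

(** One sequence [K] for all f, while the rate [n0] may depend on f. *)
Definition small_tails (K : nat -> nat) := forall f (e : R), E f -> 0 < e ->
  exists n0, forall n, (n0 <= n)%N ->
    (\int[mu]_t (tail (K n)%:R (f t * h n t))%:E <= e%:E)%E.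

Lemma markov_half_line (v : F) (M b : R) : 0 < M ->
  (\int[mu]_t `|v t|%:E <= b%:E)%E -> (mu [set t | (M < `|v t|)%R] <= (b / M)%:E)%E.
Proof.
move=> M0 vb; have mv : measurable_fun setT (fun t : X => (v t)%:E) by exact/measurable_EFinP.
have := le_integral_abse mu measurableT mv M0.
move=> /le_trans/(_ vb); rewrite -lee_pdivlMl// -EFinM mulrC; apply: le_trans.
have mset : measurable ([set: X] `&` [set t | (M%:E <= `|(v t)%:E|)%E]).
  have mnv : measurable_fun setT (fun t : X => `|(v t)%:E|%E) by exact: measurableT_comp.
  exact: (emeasurable_fun_c_infty measurableT mnv M%:E).
apply: le_measure; rewrite ?inE//; first exact: measurable_gt_norm.
by move=> t /= /ltW Mt; split => //; rewrite lee_fin.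
Qed.

Lemma integral_tail (K : R) (v : F) :
  (\int[mu]_t (tail K (v t))%:E = \int[mu]_(t in [set t | (K < `|v t|)%R]) `|v t|%:E)%E.
Proof.
rewrite [RHS]integral_mkcond; apply: eq_integral => t _; rewrite patchE /tail.
by have [tK|tK] := ltP K `|v t|; [rewrite mem_set// mulr1|rewrite memNset//= ?ltNge ?tK// mulr0].
Qed.

Lemma mulf_bounded_dual f n t : `|f t * h n t| <= (k n)%:R * `|f t|.
Proof.
have /andP[h0 hb] := bounded_dual_le t (hk n).
by rewrite normrM (ger0_norm h0) mulrC ler_wpM2r.
Qed.

Lemma bounded_dual_out n t : ~ (`[0, (k n)%:R[%classic : set X) t -> h n t = 0.
Proof.
move=> tk; have /andP[h0 _] := bounded_dual_le t (hk n).
apply/eqP; rewrite eq_le h0 andbT; have [_ /(_ t)] := hk n.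
by rewrite indicE (memNset tk) mulr0.
Qed.

(** With N = n.+1 >= nrm f, the set where |f h n| exceeds K n has measure at most N / K n < a n. The
    bound 1 / (N^2 k n) attached to [a n], applied to f / N in the unit ball, and h n <= k n then
    give an integral of at most 1 / N. *)
Lemma small_tails_small : (forall e : R, 0 < e -> exists2 a : R, 0 < a & forall f, E f ->
    nrm f <= 1 -> (\int[mu]_(t in `[0%R, a[) `|f t|%:E <= e%:E)%E) ->
  exists2 K, forall n, (0 < K n)%N & small_tails K.
Proof.
move=> small.
pose N n : R := n.+1%:R.
have N0 n : 0 < N n by [].
have kn0 n : 0 < (k n)%:R :> R by rewrite ltr0n.
have e0 n : 0 < (N n ^+ 2 * (k n)%:R)^-1 by rewrite invr_gt0 mulr_gt0// exprn_gt0.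
have aP n := ri_small_sets hE small (k n) (e0 n).
pose a n := s2val (cid2 (aP n)).
have a0 n : 0 < a n by exact: (s2valP (cid2 (aP n))).
have ha n := s2valP' (cid2 (aP n)).
exists (fun n => (Num.truncn (N n / a n)).+1) => // f e Ef e0'.
have x0 : 0 <= e^-1 + nrm f by rewrite addr_ge0 ?invr_ge0 ?(ltW e0')// (ri_norm_ge0 hE).
exists (Num.truncn (e^-1 + nrm f)) => n n0n.
have Nn : e^-1 + nrm f <= N n.
  have /andP[_ /ltW h1] := truncn_itv x0; apply: le_trans h1 _.
  by rewrite ler_nat ltnS.
have nf0 := ri_norm_ge0 hE Ef.
have einv0 : 0 < e^-1 by rewrite invr_gt0.
have fN : nrm f <= N n by lra.
have eN : (N n)^-1 <= e by rewrite -[e]invrK lef_pV2 ?posrE//; lra.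
set K := (_.+1)%:R : R.
have K0 : 0 < K by [].
have aK : N n / K < a n.
  rewrite ltr_pdivrMr// mulrC -ltr_pdivrMr//.
  have y0 : 0 <= N n / a n by rewrite divr_ge0// ltW.
  by have /andP[] := truncn_itv y0.
have mfh : measurable_fun setT (fun t => f t * h n t) by exact: measurable_funM.
pose v : F := mfun_of mfh.
rewrite (integral_tail K v).
pose A : set X := [set t | K < `|v t|].
have mA : measurable A by exact: measurable_gt_norm.
have AJ : A `<=` `[0, (k n)%:R[%classic.
  move=> t At; apply: contrapT => nt; have Kt : K < `|f t * h n t| by exact: At.
  by move: Kt; rewrite (bounded_dual_out nt) mulr0 normr0 ltNge (ltW K0).
have muA : (mu A < (a n)%:E)%E.
  apply: (@le_lt_trans _ _ (N n / K)%:E); last by rewrite lte_fin.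
  apply: markov_half_line => //.
  apply: (@le_trans _ _ (nrm f)%:E); last by rewrite lee_fin.
  by have [[_ hd] _] := hk n; exact: hd.
pose f1 := (N n)^-1 *: f.
have Ef1 : E f1 by exact: (ri_scale hE).
have nf1 : nrm f1 <= 1.
  rewrite (koethe_normZ (ri_koethe hE))// gtr0_norm ?invr_gt0//.
  by rewrite ler_pdivrMl// mulr1.
have := ha n f1 A Ef1 nf1 mA AJ muA.
have mfA : measurable_fun A (fun t => `|f t|%:E) by exact: measurable_norm_EFin.
rewrite (_ : (\int[mu]_(t in A) `|f1 t|%:E)%E = ((N n)^-1)%:E * \int[mu]_(t in A) `|f t|%:E)%E; last first.
  rewrite -ge0_integralZl ?lee_fin ?invr_ge0 ?(ltW (N0 n))//.
  apply: eq_integral => t _; rewrite -EFinM; congr EFin.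
  by change (`|(N n)^-1 * f t| = (N n)^-1 * `|f t|); rewrite normrM gtr0_norm// invr_gt0.
rewrite lee_pdivrMl// -EFinM => fA.
apply: (@le_trans _ _ (\int[mu]_(t in A) ((k n)%:R%:E * `|f t|%:E))%E).
  apply: ge0_le_integral => //.
  - exact: measurable_norm_EFin.
  - exact: measurable_funeM.
  - by move=> t _; rewrite -EFinM lee_fin; exact: mulf_bounded_dual.
rewrite ge0_integralZl//.
apply: (le_trans (lee_wpmul2l _ fA)); first by rewrite lee_fin.
rewrite -EFinM lee_fin; apply: le_trans eN.
rewrite expr2 !invfM; move: (mulfV (lt0r_neq0 (kn0 n))) (mulfV (lt0r_neq0 (N0 n))).
move: (k n)%:R (N n) ((k n)%:R^-1) ((N n)^-1) => p q p' q' pp qq.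
rewrite (_ : p * _ = (p * p') * ((q * q') * q')); last lra.
by rewrite pp qq !mul1r.
Qed.

(** Almost everywhere h n <= 1 / c and |f| <= s (|v| + 2) with v integrable. So for large n, |f h n|
    > n.+1 forces t into a fixed set B where |v| is large; there |f h n| <= (2 s / c) |v|, whose
    integral over B is small and does not involve n. *)
Lemma small_tails_large (c : R) : 0 < c -> (forall a : R, 0 < a -> exists f, [/\ E f, nrm f <= 1 &
    (c%:E <= \int[mu]_(t in `[0%R, a[) `|f t|%:E)%E]) ->
  exists2 K, forall n, (0 < K n)%N & small_tails K.
Proof.
move=> c0 large; exists succn => // f e Ef e0.
have s0 : 0 < nrm f + 1 by rewrite ltr_wpDl// (ri_norm_ge0 hE).
set s := nrm f + 1 in s0 *.
have [v v2 fv] := ri_decomposition hE Ef.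
have hb n : {ae mu, forall t, h n t <= c^-1}.
  have [hd hkn] := hk n.
  apply: (pos_dual_bounded hE c0 large hd).
  have mJ : measurable (`[0, (k n)%:R[%classic : set X) by exact: measurable_itv.
  have mh : measurable_fun setT (EFin \o h n) by exact/measurable_EFinP.
  apply/integrableP; split => //.
  apply: (@le_lt_trans _ _ (\int[lam]_(t in `[0%R, (k n)%:R[) (k n)%:R%:E)%E); last first.
    rewrite integral_cst//; change (((k n)%:R)%:E * lam `[0%R, (k n)%:R[%classic < +oo)%E.
    rewrite lebesgue_measure_itv/=; case: ifP => _; last by rewrite mule0 ltry.
    by rewrite -EFinD -EFinM ltry.
  rewrite [leRHS]integral_mkcond; apply: ge0_le_integral => //.
  - exact: measurableT_comp.
  - by apply/(measurable_restrictT _ mJ).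
  - move=> t _; rewrite patchE; have /andP[h0 hkt] := bounded_dual_le t (hk n).
    have [tJ|tJ] := pselect ((`[0, (k n)%:R[%classic : set X) t).
      by rewrite (mem_set tJ) lee_fin ger0_norm.
    by rewrite (memNset tJ) /= (bounded_dual_out tJ) normr0.
have e'0 : 0 < e * c / (2 * s) by rewrite divr_gt0 ?mulr_gt0.
have iv : mu.-integrable setT (EFin \o v).
  apply/integrableP; split; first exact/measurable_EFinP.
  by apply: le_lt_trans v2 _; rewrite ltry.
have [d [d0 dv]] := integral_normr_continuous iv e'0.
(* The integral of |v| is at most 2, so B has measure at most d / 2. *)
pose M := 4 / d.
have M0 : 0 < M by rewrite divr_gt0.
pose B : set X := [set t | M < `|v t|].
have mB : measurable B by exact: measurable_gt_norm.
have muB : (mu B < d%:E)%E.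
  apply: le_lt_trans (markov_half_line M0 v2) _.
  by rewrite lte_fin /M invf_div mulrA ltr_pdivrMr// mulrC ltr_pM2l//; lra.
have vB : (\int[mu]_(t in B) `|v t|%:E <= (e * c / (2 * s))%:E)%E.
  have := dv B mB muB; rewrite /Rintegral => /ltW; rewrite -lee_fin fineK//.
  rewrite ge0_fin_numE; last exact: integral_ge0.
  apply: (@le_lt_trans _ _ (\int[mu]_t `|v t|%:E)%E); last by apply: le_lt_trans v2 _; rewrite ltry.
  by apply: ge0_subset_integral => //; exact: measurable_norm_EFin.
have y0 : 0 <= s / c * (4 + M) by rewrite mulr_ge0 ?divr_ge0 ?(ltW s0) ?(ltW c0)// addr_ge0// ltW.
exists (Num.truncn (s / c * (4 + M))) => n n0n.
have Kn : s / c * (4 + M) <= n.+1%:R.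
  have /andP[_ /ltW h1] := truncn_itv y0; apply: le_trans h1 _.
  by rewrite ler_nat ltnS.
have mfh : measurable_fun setT (fun t => f t * h n t) by exact: measurable_funM.
apply: (@le_trans _ _ (\int[mu]_(t in B) ((2 * s / c)%:E * `|v t|%:E))%E); last first.
  have c2 : 0 <= 2 * s / c by rewrite divr_ge0 ?mulr_ge0 ?(ltW s0) ?(ltW c0).
  rewrite ge0_integralZl ?lee_fin//; last exact: measurable_norm_EFin.
  apply: (le_trans (lee_wpmul2l _ vB)); first by rewrite lee_fin.
  rewrite -EFinM lee_fin; have s2 : 2 * s != 0 by rewrite mulf_neq0// gt_eqF.
  move: s2; move: (2 * s) => p p0.
  rewrite (_ : p / c * _ = e * (c / c) * (p / p)); last lra.
  by rewrite !mulfV ?mulr1// gt_eqF.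
rewrite [leRHS]integral_mkcond; apply: ae_ge0_le_integral => //.
- by move=> t _; rewrite lee_fin tail_ge0.
- by apply/measurable_EFinP; exact: measurable_tail.
- move=> t _; rewrite patchE; case: ifP => _ //.
  by rewrite mule_ge0// lee_fin divr_ge0 ?mulr_ge0 ?(ltW s0) ?(ltW c0).
- by apply/(measurable_restrictT _ mB)/measurable_funeM; exact: measurable_norm_EFin.
apply: filterS2 fv (hb n) => t ft ht _; rewrite patchE.
have /andP[h0 _] := bounded_dual_le t (hk n).
have fh : `|f t * h n t| <= (s * (`|v t| + 2)) * c^-1.
  by rewrite normrM (ger0_norm h0) ler_pM.
rewrite /tail; have [big|_] := ltP n.+1%:R `|f t * h n t|; last first.
  rewrite mulr0; case: ifP => _ //.
  by rewrite -EFinM lee_fin mulr_ge0// divr_ge0 ?mulr_ge0 ?(ltW s0) ?(ltW c0).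
(* This gives both |v| > M, that is membership in B, and |v| + 2 <= 2 |v|. *)
have vM : 4 + M < `|v t| + 2.
  have sc : 0 < s / c by rewrite divr_gt0.
  rewrite -(ltr_pM2l sc); apply: le_lt_trans Kn _; apply: lt_le_trans big _.
  by apply: le_trans fh _; rewrite mulrAC.
rewrite mem_set; last by rewrite /B/=; lra.
rewrite mulr1 -EFinM lee_fin; apply: le_trans fh _.
rewrite mulrAC [2 * s]mulrC -!mulrA ler_pM2l// mulrCA ler_pM2l ?invr_gt0//.
by lra.
Qed.

Lemma small_tails_exist : exists2 K, forall n, (0 < K n)%N & small_tails K.
Proof.
have [small|nsmall] := pselect (forall e : R, 0 < e -> exists2 a : R, 0 < a &
    forall f, E f -> nrm f <= 1 -> (\int[mu]_(t in `[0%R, a[) `|f t|%:E <= e%:E)%E).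
  exact: small_tails_small.
have [c c0 hc] : exists2 c : R, 0 < c & forall a : R, 0 < a -> exists f, [/\ E f, nrm f <= 1 &
    (c%:E <= \int[mu]_(t in `[0%R, a[) `|f t|%:E)%E].
  apply: contrapT => nc; apply: nsmall => e e0; apply: contrapT => na.
  apply: nc; exists e => // a a0; apply: contrapT => nf; apply: na; exists a => // f Ef f1.
  by rewrite leNgt; apply/negP => /ltW ef; apply: nf; exists f.
exact: small_tails_large c0 hc.
Qed.

End levels.

(** * The embedding and its properties *)

Section embedding.
Variable R : realType.
Local Notation mu := (lebesgue_half_line R).
Local Notation lam := (@lebesgue_measure R).
Local Notation lu := (lebesgue_unit R).
Local Notation X := (measurableTypeR R).
Local Notation F := {mfun X >-> R}.
Variables (E : set F) (nrm : F -> R).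
Hypothesis hE : rearrangement_invariant E nrm.
Variables (h : nat -> F) (k K : nat -> nat).
Hypotheses (k_gt0 : forall n, (0 < k n)%N) (K_gt0 : forall n, (0 < K n)%N).
Hypothesis hk : forall n, bounded_dual E nrm (k n) (h n).
Hypothesis hK : small_tails E h K.
Hypothesis norming : forall f (e : R) (n0 : nat), E f -> 0 < e -> exists2 n, (n0 <= n)%N &
  ((nrm f - e)%:E < \int[mu]_t `|f t * h n t|%:E)%E.

Definition block (f : F) (n : nat) (t : X) : R := clamp (K n)%:R (f t * h n t).

Lemma measurable_block f n : measurable_fun setT (block f n).
Proof. by apply: measurable_clamp; exact: measurable_funM. Qed.

Lemma block_bound f n t : `|block f n t| <= (K n)%:R.
Proof. exact: clamp_bound. Qed.

Lemma integral_block_le (p q : X -> R) (n : nat) :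
  measurable_fun setT p -> measurable_fun setT q -> (forall t, `|p t| <= q t) ->
  (\int[lam]_(t in `[0%R, (k n)%:R[) `|p t|%:E <= \int[mu]_t (q t)%:E)%E.
Proof.
move=> mp mq pq; have q0 t : 0 <= q t by exact: le_trans (pq t).
have mJ : measurable (`[0, (k n)%:R[%classic : set X) by exact: measurable_itv.
have mqE D : measurable_fun D (fun t => (q t)%:E).
  exact/measurable_EFinP/measurable_funTS.
rewrite -ge0_integral_half_line; last exact: itv_half_line.
apply: (@le_trans _ _ (\int[mu]_(t in `[0%R, (k n)%:R[) (q t)%:E)%E).
  apply: ge0_le_integral => //.
    by apply/measurable_EFinP/measurable_funTS; exact: measurableT_comp.
  by move=> t _; rewrite lee_fin.
by apply: ge0_subset_integral => // t _; rewrite lee_fin.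
Qed.

Lemma integral_block_norm f n : E f ->
  (\int[lam]_(t in `[0%R, (k n)%:R[) `|block f n t|%:E <= (nrm f)%:E)%E.
Proof.
move=> Ef; have [[_ hd] _] := hk n; apply: le_trans (hd f Ef).
apply: integral_block_le; first exact: measurable_block.
  by apply: measurableT_comp => //; exact: measurable_funM.
by move=> t; exact: clamp_norm.
Qed.

Lemma weak_qnorm_block f : E f -> (weak_qnorm lu (glue_blocks k K (block f)) < +oo)%E.
Proof.
move=> Ef; apply: (@le_lt_trans _ _ (nrm f + 1 / 1%:R)%:E); last exact: ltry.
apply: (weak_qnorm_glue_le k_gt0 K_gt0) => //.
- exact: (ri_norm_ge0 hE).
- by move=> n; exact: measurable_block.
- by move=> n t; rewrite mul1r; exact: block_bound.
- by move=> n _; exact: integral_block_norm.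
Qed.

Definition glued (f : F) : F := mfun_of (measurable_glue k_gt0 K_gt0 (measurable_block f)).

(** Total in f by a default value 0, a case that [embedE] excludes on E. *)
Definition embed (f : F) : weakL1 lu :=
  if pselect (glued f \in weakL1_pred lu) is left H then WeakL1 H else 0.

Lemma embedE f : E f -> forall t, embed f t = glue_blocks k K (block f) t.
Proof.
move=> Ef t; rewrite /embed; case: pselect => // H; exfalso; apply: H.
by rewrite inE/=; exact: weak_qnorm_block.
Qed.

(** Equality of images in the quotient is proved through this: only the limit of the block integrals
    matters. *)
Lemma weak_gauge_block0 (x : weakL1 lu) (g : nat -> X -> R) (C : R) : 0 < C ->
  (forall t, x t = glue_blocks k K g t) -> (forall n, measurable_fun setT (g n)) ->
  (forall n t, `|g n t| <= C * (K n)%:R) ->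
  (forall e : R, 0 < e -> exists n0, forall n, (n0 <= n)%N ->
    (\int[lam]_(t in `[0%R, (k n)%:R[) `|g n t|%:E <= e%:E)%E) ->
  weak_gauge x = 0.
Proof.
move=> C0 xE mg gK small; apply/eqP; rewrite eq_le weak_gauge_ge0 andbT.
apply/ler_addgt0Pr => e e0; rewrite add0r; have [n0 gn0] := small e e0.
exact: (weak_gauge_glue_le k_gt0 K_gt0 (ltW e0) C0 xE mg gK gn0).
Qed.

Lemma glue_comb (g1 g2 g3 : nat -> X -> R) (a : R) t :
  glue_blocks k K (fun n t => g1 n t - (a * g2 n t + g3 n t)) t =
  glue_blocks k K g1 t - (a * glue_blocks k K g2 t + glue_blocks k K g3 t).
Proof.
rewrite /glue_blocks; case: (cell_index k K t) => [i|]; last by rewrite mulr0 addr0 subr0.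
by rewrite mulrBl mulrDl mulrA.
Qed.

Lemma embed_ae f g : E f -> E g -> {ae mu, forall t, f t = g t} ->
  weak_gauge (embed f - embed g) = 0.
Proof.
move=> Ef Eg fg.
(* The factor 1 and the summand 0 give the difference the form of [glue_comb]. *)
pose G n t := block f n t - (1 * block g n t + 0).
have mG n : measurable_fun setT (G n).
  apply: measurable_funB; first exact: measurable_block.
  apply: measurable_funD => //; apply: measurable_funM => //; exact: measurable_block.
apply: (@weak_gauge_block0 _ G 2) => //.
- move=> t; rewrite weakL1B.
  apply: (etrans (congr2 (fun u v => u - v) (embedE Ef t) (embedE Eg t))).
  rewrite /G (glue_comb (block f) (block g) (fun _ _ => 0) 1 t) mul1r.
  have -> : glue_blocks k K (fun _ (_ : X) => 0) t = 0.
    by rewrite /glue_blocks; case: (cell_index k K t) => [i|]; rewrite ?mul0r.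
  by rewrite addr0.
- move=> n t; rewrite /G mul1r addr0 (le_trans (ler_normB _ _))//.
  by rewrite mulr2n mulrDl mul1r lerD ?block_bound.
- move=> e e0; exists 0%N => n _.
  apply: (@le_trans _ _ (\int[mu]_t `|G n t|%:E)%E).
    by apply: integral_block_le => //; exact: measurableT_comp.
  rewrite (_ : (\int[mu]_t _)%E = \int[mu]_t (cst 0 t))%E; last first.
    apply: ge0_ae_eq_integral => //.
      by apply/measurable_EFinP; exact: measurableT_comp.
    apply: filterS fg => t ft _.
    by rewrite /G /block ft mul1r addr0 subrr normr0.
  by rewrite integral0 lee_fin ltW.
Qed.

(** Each clamp differs from its argument by at most a tail, and the arguments cancel; so the defect
    of linearity is at most the tail for a f + g, plus |a| times that for f, plus that for g, and
    these integrals tend to 0 by [hK]. *)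
Lemma embed_linear (a : R) f g : E f -> E g ->
  weak_gauge (embed (a *: f + g) - (a *: embed f + embed g)) = 0.
Proof.
move=> Ef Eg; have Efg : E (a *: f + g) by exact: (koethe_linear (ri_koethe hE)).
pose G n t := block (a *: f + g) n t - (a * block f n t + block g n t).
have mG n : measurable_fun setT (G n).
  apply: measurable_funB; first exact: measurable_block.
  apply: measurable_funD; last exact: measurable_block.
  by apply: measurable_funM => //; exact: measurable_block.
(* C serves twice: the defect is at most C K n pointwise, and its integral at most C d. *)
pose C := 2 + `|a|.
have C0 : 0 < C by rewrite ltr_pwDl.
apply: (@weak_gauge_block0 _ G C) => //.
- move=> t; rewrite weakL1B weakL1D weakL1Z /G glue_comb.
  exact: (congr2 (fun u v => u - v) (embedE Efg t)
    (congr2 (fun u v => a * u + v) (embedE Ef t) (embedE Eg t))).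
- move=> n t; rewrite /G (le_trans (ler_normB _ _))//.
  rewrite (_ : C * (K n)%:R = (K n)%:R + (`|a| * (K n)%:R + (K n)%:R)); last by rewrite /C; lra.
  rewrite lerD ?block_bound// (le_trans (ler_normD _ _))// lerD ?block_bound//.
  by rewrite normrM ler_wpM2l// block_bound.
- move=> e e0; pose d := e / C.
  have d0 : 0 < d by rewrite divr_gt0.
  have [n1 H1] := hK Efg d0; have [n2 H2] := hK Ef d0; have [n3 H3] := hK Eg d0.
  exists (maxn n1 (maxn n2 n3)) => n; rewrite !geq_max => /and3P[nn1 nn2 nn3].
  pose T (v : F) (t : X) := tail (K n)%:R (v t * h n t).
  have mT v : measurable_fun setT (T v) by apply: measurable_tail; exact: measurable_funM.
  have mTE v D : measurable_fun D (fun t => (T v t)%:E).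
    exact/measurable_EFinP/measurable_funTS.
  have T0 v t : 0 <= T v t by exact: tail_ge0.
  apply: (@le_trans _ _ (\int[mu]_t (T (a *: f + g)%R t + (`|a| * T f t + T g t))%:E)%E).
    apply: integral_block_le => //.
      by apply: measurable_funD => //; apply: measurable_funD => //; exact: measurable_funM.
    move=> t; rewrite /G /block; set K' := (K n)%:R.
    have K'0 : 0 <= K' by [].
    have c1 := clamp_tail ((a *: f + g) t * h n t) K'0.
    have c2 := clamp_tail (f t * h n t) K'0.
    have c3 := clamp_tail (g t * h n t) K'0.
    have fgE : (a *: f + g) t * h n t = a * (f t * h n t) + g t * h n t.
      by rewrite -[(a *: f + g) t]/(a * f t + g t) mulrDl mulrA.
    rewrite (_ : _ - _ = (clamp K' ((a *: f + g) t * h n t) - (a *: f + g) t * h n t) -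
      (a * (clamp K' (f t * h n t) - f t * h n t) + (clamp K' (g t * h n t) - g t * h n t))).
      rewrite (le_trans (ler_normB _ _))// lerD// (le_trans (ler_normD _ _))// lerD//.
      by rewrite normrM ler_wpM2l.
    by rewrite fgE; move: (clamp K' _) (clamp K' _) (clamp K' _) => p q r; lra.
  rewrite (_ : (\int[mu]_t _)%E = \int[mu]_t ((T (a *: f + g)%R t)%:E +
      (`|a|%:E * (T f t)%:E + (T g t)%:E)))%E; last exact: eq_integral.
  have aT0 t : (0 <= `|a|%:E * (T f t)%:E)%E by rewrite mule_ge0// lee_fin.
  rewrite ge0_integralD//; last 3 first.
  - by move=> t _; rewrite lee_fin.
  - by move=> t _; rewrite adde_ge0// lee_fin.
  - by apply: emeasurable_funD; [exact: measurable_funeM|exact: mTE].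
  rewrite ge0_integralD//; last 2 first.
  - by apply: measurable_funeM.
  - by move=> t _; rewrite lee_fin.
  rewrite ge0_integralZl//; last by move=> t _; rewrite lee_fin.
  apply: (@le_trans _ _ (d%:E + (`|a|%:E * d%:E + d%:E))%E).
    apply: leeD; first exact: H1.
    apply: leeD; last exact: H3.
    by apply: lee_wpmul2l; [rewrite lee_fin|exact: H2].
  rewrite -!(EFinM, EFinD) lee_fin (_ : d + _ = C * d); last by rewrite /C; lra.
  by rewrite /d mulrCA mulfV ?mulr1// gt_eqF.
Qed.

Lemma embed_norm f : E f -> weak_gauge (embed f) = nrm f.
Proof.
move=> Ef; have nf0 := ri_norm_ge0 hE Ef; apply/eqP; rewrite eq_le; apply/andP; split.
  apply: (@weak_gauge_glue_le _ _ _ k_gt0 K_gt0 _ (block f) (nrm f) 1 0) => //.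
  - exact: embedE.
  - by move=> n; exact: measurable_block.
  - by move=> n t; rewrite mul1r; exact: block_bound.
  - by move=> n _; exact: integral_block_norm.
rewrite leNgt; apply/negP => lt.
pose tau := (weak_gauge (embed f) + nrm f) / 2.
have taulo : weak_gauge (embed f) < tau by rewrite /tau; lra.
have tauhi : tau < nrm f by rewrite /tau; lra.
have tau0 : 0 < tau by apply: le_lt_trans taulo; exact: weak_gauge_ge0.
have [D D0 HD] := weak_gauge_glue_ge k_gt0 K_gt0 (embedE Ef) (measurable_block f)
  (block_bound f) taulo.
(* A quarter of the gap: the choice of n, the clamped tail and the error in [weak_gauge_glue_ge]
   cost e each, and one e remains for the contradiction. *)
pose e := (nrm f - tau) / 4.
have e0 : 0 < e by rewrite /e; lra.
have [n1 H1] := hK Ef e0.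
have D20 : 0 <= 2 * D by rewrite mulr_ge0.
have y0 : 0 <= (tau + 2 * D) / e by rewrite divr_ge0 ?(ltW e0)// addr_ge0// (ltW tau0).
have [n] := @norming f e (maxn n1 (Num.truncn ((tau + 2 * D) / e))) Ef e0.
rewrite geq_max => /andP[nn1 nn2] fh.
have err : (tau + 2 * D) / n.+1%:R <= e.
  rewrite ler_pdivrMr// [leRHS]mulrC -ler_pdivrMr//.
  by have /andP[_ /ltW h1] := truncn_itv y0; apply: le_trans h1 _; rewrite ler_nat ltnS.
have main : (\int[mu]_t `|f t * h n t|%:E <=
    \int[lam]_(t in `[0%R, (k n)%:R[) `|block f n t|%:E + e%:E)%E.
  have mJ : measurable (`[0, (k n)%:R[%classic : set X) by exact: measurable_itv.
  have mfh : measurable_fun setT (fun t => f t * h n t) by exact: measurable_funM.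
  have mT : measurable_fun setT (fun t => (tail (K n)%:R (f t * h n t))%:E).
    by apply/measurable_EFinP; exact: measurable_tail.
  have mb : measurable_fun setT (fun t => `|block f n t|%:E).
    by apply/measurable_EFinP; apply: measurableT_comp => //; exact: measurable_block.
  rewrite (_ : (\int[mu]_t _)%E = \int[mu]_(t in `[0%R, (k n)%:R[) `|f t * h n t|%:E)%E; last first.
    rewrite [RHS]integral_mkcond; apply: eq_integral => t _; rewrite patchE.
    have [tJ|tJ] := pselect ((`[0, (k n)%:R[%classic : set X) t); first by rewrite (mem_set tJ).
    by rewrite (memNset tJ) (bounded_dual_out hk tJ) mulr0 normr0.
  rewrite -ge0_integral_half_line; last exact: itv_half_line.
  apply: (@le_trans _ _ (\int[mu]_(t in `[0%R, (k n)%:R[)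
     (`|block f n t|%:E + (tail (K n)%:R (f t * h n t))%:E))%E).
    apply: ge0_le_integral => //.
    - exact: measurable_norm_mul.
    - by apply: emeasurable_funD; exact: measurable_funTS.
    - move=> t _; rewrite -EFinD lee_fin.
      have H (p q r : R) : `|p - q| <= r -> `|q| <= `|p| + r.
        by move=> pq; rewrite -[q](subKr p) (le_trans (ler_normB _ _))// lerD2l.
      exact: H (clamp_tail (f t * h n t) (ler0n R (K n))).
  rewrite ge0_integralD//; last 3 first.
  - exact: measurable_funTS.
  - by move=> t _; rewrite lee_fin tail_ge0.
  - exact: measurable_funTS.
  apply: leeD => //; apply: le_trans (H1 n nn1).
  by apply: ge0_subset_integral => // t _; rewrite lee_fin tail_ge0.
have := lt_le_trans fh (le_trans main (leeD (HD n) (lexx _))).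
rewrite -EFinD lte_fin ltNge => /negP; apply.
have Dn : D / n.+1%:R <= D by rewrite ler_pdivrMr// ler_peMr// ler1n.
have n10 : 0 < n.+1%:R^-1 :> R by rewrite invr_gt0.
have n11 : n.+1%:R^-1 <= 1 :> R by rewrite invf_le1// ler1n.
(* With x = 1 / n.+1 <= 1, the term D x^2 of (1 + x) (tau + D x) is at most D x, whence 2 D. *)
have rE : ratio R n * (tau + D / n.+1%:R) <= tau + (tau + 2 * D) / n.+1%:R.
  rewrite /ratio; move: (n.+1%:R^-1) Dn n10 n11 => x Dx x0 x1.
  have : x * (D * x) <= x * D by rewrite ler_wpM2l// ltW.
  by lra.
have ye : ratio R n * (tau + D / n.+1%:R) <= tau + e by apply: le_trans rE _; rewrite lerD2l.
rewrite (_ : nrm f - e = tau + e + (e + e)); last by rewrite /e; lra.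
by apply: lerD => //; rewrite lerDl ltW.
Qed.

(** By solidity, as |max(f, g)| <= |f| + |g|. *)
Lemma ri_max f g : E f -> E g -> E (max_mfun f g).
Proof.
move=> Ef Eg.
have abs v : E v -> exists2 v' : F, E v' & forall t, v' t = `|v t|.
  move=> Ev; have mv : measurable_fun setT (fun t => `|v t|) by exact: measurableT_comp.
  exists (mfun_of mv) => //.
  have H t : `|mfun_of mv t| <= `|v t|.
    by change (`| `|v t| | <= `|v t|); rewrite normr_id.
  by have [] := ri_solid hE Ev H.
have [f' Ef' f'E] := abs f Ef; have [g' Eg' g'E] := abs g Eg.
have Efg : E (1 *: f' + g') by exact: (koethe_linear (ri_koethe hE)).
have [] // := @ri_solid _ _ _ hE (max_mfun f g) _ Efg.
move=> t; rewrite -[(1 *: f' + g') t]/(1 * f' t + g' t) mul1r f'E g'E.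
rewrite [leRHS]ger0_norm ?addr_ge0//.
have H (x y : R) : `|Num.max x y| <= `|x| + `|y|.
  by case: (leP x y) => _; rewrite ?lerDl ?lerDr.
exact: H.
Qed.

Lemma ri_min f g : E f -> E g -> E (min_mfun f g).
Proof.
move=> Ef Eg.
have -> : min_mfun f g = (-1) *: max_mfun ((-1) *: f) ((-1) *: g).
  apply: mfun_ext => t.
  change (Num.min (f t) (g t) = -1 * Num.max (-1 * f t) (-1 * g t)).
  by rewrite !mulN1r -oppr_min opprK.
by apply: (ri_scale hE); apply: ri_max; exact: (ri_scale hE).
Qed.

(** An equality of functions, before any quotient: multiplication by h n >= 0, clamping, and
    division by a positive level all commute with max. *)
Lemma embed_max f g : E f -> E g ->
  embed (max_mfun f g) = weakL1_max (embed f) (embed g).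
Proof.
move=> Ef Eg; apply: weakL1_ext => t; rewrite weakL1_maxE.
apply: (etrans (embedE (ri_max Ef Eg) t)).
apply: (etrans _ (esym (congr2 Num.max (embedE Ef t) (embedE Eg t)))).
have [[i ti Ci]|[ti _]] := cell_indexP k K t; rewrite /glue_blocks ti ?maxxx//.
have l0 := ltW (level_gt0 R k_gt0 K_gt0 i.1 i.2).
have [[h0 _] _] := hk i.1.
rewrite -maxr_pMl ?invr_ge0// -clamp_max -maxr_pMl//.
Qed.

Lemma embed_min f g : E f -> E g ->
  embed (min_mfun f g) = weakL1_min (embed f) (embed g).
Proof.
move=> Ef Eg; apply: weakL1_ext => t; rewrite weakL1_minE.
apply: (etrans (embedE (ri_min Ef Eg) t)).
apply: (etrans _ (esym (congr2 Num.min (embedE Ef t) (embedE Eg t)))).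
have [[i ti Ci]|[ti _]] := cell_indexP k K t; rewrite /glue_blocks ti ?minxx//.
have l0 := ltW (level_gt0 R k_gt0 K_gt0 i.1 i.2).
have [[h0 _] _] := hk i.1.
rewrite -minr_pMl ?invr_ge0// -clamp_min -minr_pMl//.
Qed.

End embedding.

Theorem theorem7 (R : realType) (E : set {mfun (measurableTypeR R) >-> R})
    (nrm : {mfun (measurableTypeR R) >-> R} -> R)
    (hE : rearrangement_invariant E nrm) :
  exists J : {mfun (measurableTypeR R) >-> R} ->
      normed_envelope (lebesgue_unit R),
    [/\ (forall f g, E f -> E g ->
           {ae lebesgue_half_line R, forall t, f t = g t} -> J f = J g),
        (forall (a : R) f g, E f -> E g -> J (a *: f + g) = a *: J f + J g),
        (forall f, E f -> `|J f| = nrm f),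
        (forall f g, E f -> E g ->
           J (max_mfun f g) = Order.join (J f) (J g)) &
        (forall f g, E f -> E g ->
           J (min_mfun f g) = Order.meet (J f) (J g))].
Proof.
have [u [kap [ukap norming]]] := countable_norming hE.
(* logn 2 n.+1 takes every value infinitely often. *)
pose m n := logn 2 n.+1.
pose h n := u (m n); pose k n := kap (m n).
have k_gt0 n : (0 < k n)%N by case: (ukap (m n)).
have hk n : bounded_dual E nrm (k n) (h n) by case: (ukap (m n)).
have [K K_gt0 hK] := small_tails_exist hE k_gt0 hk.
have often f (e : R) n0 : E f -> 0 < e -> exists2 n, (n0 <= n)%N &
    ((nrm f - e)%:E < \int[lebesgue_half_line R]_t `|f t * h n t|%:E)%E.
  move=> Ef e0; have [i fi] := norming f e Ef e0.
  (* n.+1 is 2^i times an odd number above n0, so its 2-adic valuation is i. *)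
  exists (2 ^ i * n0.*2.+1).-1.
    rewrite -ltnS prednK ?muln_gt0 ?expn_gt0//.
    by apply: leq_trans (leq_pmull _ _); rewrite ?expn_gt0// ltnS -addnn leq_addr.
  rewrite /h /m prednK ?muln_gt0 ?expn_gt0// lognM ?expn_gt0// pfactorK//.
  by rewrite lognE/= dvdn2/= odd_double/= addn0.
exists (fun f => envelope_class (embed h k_gt0 K_gt0 f)); split.
- by move=> f g Ef Eg fg; apply/envelope_classP; exact: (embed_ae hE).
- move=> a f g Ef Eg; rewrite -envelope_classZ -envelope_classD.
  by apply/envelope_classP; exact: (embed_linear hE).
- by move=> f Ef; rewrite envelope_norm; exact: (embed_norm hE).
- by move=> f g Ef Eg; rewrite envelope_join (embed_max hE).
- by move=> f g Ef Eg; rewrite envelope_meet (embed_min hE).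
Qed.
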